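(* Let $(W,S)$ be a Coxeter system. The atomic nilCoxeter algebroid $\mathcal{SD}^{\mathrm{core}}$ admits the following presentation by generators and relations as a $\mathbb Z$-linear category (with objects the finitary subsets of $S$). It is generated by the morphisms $\partial_{\mathtt a}$, where $\mathtt a$ runs over all atoms (equivalently, by $\partial_{\mathtt a^J_t}$ for $J\subset S$, $t\in S\setminus J$, $Jt$ finitary; equivalently, by $\partial_{{}^I_s\mathtt a}$ for $I\subset S$, $s\in S\setminus I$, $Is$ finitary), subject to the relations: (i) for each finitary subset $I\subset S$ and elements $s\neq t$ in $S\setminus I$ such that $Ist$ is finitary, the atomic braid relation $$\underbrace{\partial_{\mathtt a}\circ\partial_{\mathtt b'}\circ\cdots}_{m}=\underbrace{\partial_{\mathtt b}\circ\partial_{\mathtt a'}\circ\cdots}_{m}$$ where $\mathtt a={}^I_s\mathtt a$, $\mathtt b={}^I_t\mathtt a$, and the remaining atoms and $m\ge2$ are those of the atomic braid relation starting at $I$ with $M=Ist$ (spelled out in the context); (ii) for each atom $\mathtt a=\mathtt a^I_s$, the atomic nil-quadratic relation $\partial_{\mathtt a}\circ\partial_{\mathtt a^{-1}}=0$, i.e. $\partial_{\mathtt a^I_s}\circ\partial_{{}^I_s\mathtt a}=0$.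
   Context: For $I\subset S$, $W_I$ is the subgroup generated by $I$; $I$ is finitary if $W_I$ is finite, and then $w_I$ is the longest element of $W_I$. Write $Is=I\sqcup\{s\}$, $I\setminus s=I\setminus\{s\}$, $Ist=I\sqcup\{s,t\}$. Cosets. For finitary $I,J$, an $(I,J)$-coset is an element $p\in W_I\backslash W/W_J$ (the pair $(I,J)$ is part of the data), with unique Bruhat-maximal element $\overline p$ and unique Bruhat-minimal element $\underline p$. It is core if $I=\underline pJ\underline p^{-1}$. Let $*$ be the Coxeter monoid product on $W$ ($w*s=ws$ if $\ell(ws)>\ell(w)$, else $w*s=w$). For an $(I,J)$-coset $p$ and a $(J,K)$-coset $q$ set $p*q=W_I(\overline p*\overline q)W_K$; it is reduced if $\ell(\overline pw_J^{-1}\overline q)=\ell(\overline pw_J^{-1})+\ell(\overline q)$. For an $(I,J)$-coset $p=W_IwW_J$, $p^{-1}=W_Jw^{-1}W_I$. Expressions. An expression is a sequence $[I_0,\dots,I_m]$ of finitary subsets in which consecutive subsets differ by adding or removing one element, also written $[I_0\pm s_1\pm\cdots\pm s_m]$ recording added ($+$)/removed ($-$) elements. It expresses the $(I_0,I_m)$-coset $(W_{I_0}eW_{I_1})*\cdots*(W_{I_{m-1}}eW_{I_m})$, and is reduced if for each $1\le i\le m-1$ the composition of the coset expressed by $[I_0,\dots,I_i]$ with $W_{I_i}eW_{I_{i+1}}$ is reduced. Atoms. An atom is a core coset having a reduced expression $[I+s-t]$; equivalently, a coset expressed by $[I+s-t]$ with $Is$ finitary, $s\notin I$, $t=w_{Is}sw_{Is}$.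 For $I\subset S$, $s\in S\setminus I$ with $Is$ finitary, ${}^I_s\mathtt a=W_Iw_{Is}W_J$ and $\mathtt a^I_s=W_Jw_{Is}W_I$ with $J=Is\setminus w_{Is}sw_{Is}$; these are the unique atoms of these forms and ${}^I_s\mathtt a=(\mathtt a^I_s)^{-1}$. Rotation sequences. For finitary $M\subset S$ and $s',t'\in M$ with $t'\ne w_Ms'w_M$, the rotation sequence $(u_i)_{i\in\mathbb Z}$ of $(M,s',t')$ is defined by $u_0=s'$, $u_{-1}=w_Mt'w_M$, $u_{i+1}=w_{M\setminus u_i}u_{i-1}w_{M\setminus u_i}$. Put $P_i=M\setminus u_i$, $L_i=M\setminus\{u_i,u_{i-1}\}$. Let $d=d(M,s',t')$ be the maximal $k\ge0$ such that $[L_0,P_0,L_1,P_1,\dots,L_k,P_k,L_{k+1}]$ is reduced. The nilCoxeter algebroid $\mathcal{SD}=\mathcal{SD}(W,S)$ is the $\mathbb Z$-linear category with objects the finitary subsets of $S$, generated by morphisms $\partial_{[I,Is]}:Is\to I$ and $\partial_{[Is,I]}:I\to Is$ for $Is$ finitary; write $\partial_{[I_0,\dots,I_m]}=\partial_{[I_0,I_1]}\circ\cdots\circ\partial_{[I_{m-1},I_m]}$. The relations are (whenever the expressions are well defined): $\partial_{[I+s+t]}=\partial_{[I+t+s]}$; $\partial_{[I-s-t]}=\partial_{[I-t-s]}$; the switchback relation $\partial_{[I+s-t]}=\partial_{[I-u_1+u_0-u_2+u_1-\cdots-u_d+u_{d-1}]}$ when $w_{Is}sw_{Is}\ne t$,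 where $u_\bullet$ is the rotation sequence of $(Is,s,t)$ and $d=d(Is,s,t)$; and $\partial_{[I-s+s]}=0$. For a coset $p$, $\partial_p:=\partial_{[I_0,\dots,I_m]}$ for any reduced expression of $p$; this is well defined and $\{\partial_p\}$ over all $(I,J)$-cosets $p$ is a $\mathbb Z$-basis of the space of morphisms from $J$ to $I$. $\mathcal{SD}^{\mathrm{core}}$ is the subcategory of $\mathcal{SD}$ (with the same objects) spanned by the morphisms $\partial_p$ with $p$ a core coset. The atomic braid relation in (i): let $M=Ist$ and let $\bar x=w_Mxw_M$, $\bar L=w_MLw_M$. Take the rotation sequence $u_\bullet$ of $(M,t,\bar s)$, so $u_0=t$, $u_{-1}=s$, $L_0=I$, and let $d=d(M,t,\bar s)$, $m=d+1$. Let $\mathtt a_i$ be the atom expressed by $[L_i,P_i,L_{i+1}]$ and $\mathtt b_i$ the atom expressed by $[\bar L_{i+1},\bar P_i,\bar L_i]$. The relation is $\partial_{\mathtt a_0}\circ\partial_{\mathtt a_1}\circ\cdots\circ\partial_{\mathtt a_d}=\partial_{\mathtt b_d}\circ\partial_{\mathtt b_{d-1}}\circ\cdots\circ\partial_{\mathtt b_0}$; here $\mathtt a_0={}^I_s\mathtt a$ and $\mathtt b_d={}^I_t\mathtt a$. *)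

(* Defs.v *)
From HB Require Import structures.
From mathcomp Require Import all_boot all_order all_algebra.
From mathcomp Require Import boolp classical_sets functions cardinality.

Set Implicit Arguments.
Unset Strict Implicit.
Unset Printing Implicit Defensive.

Import GRing.Theory.
Local Open Scope classical_set_scope.

(* [lhom C A B] is the group of morphisms from [A] to [B], and [lcomp g f] is
   "g after f".  Keeping the objects as a parameter lets one speak of functors
   that are the identity on objects without transporting along equalities. *)
Record lincat (Ob : Type) := LinCat {
  lhom : Ob -> Ob -> zmodType;
  lid : forall A, lhom A A;
  lcomp : forall A B C, lhom B C -> lhom A B -> lhom A C;
  compA : forall A B C D (h : lhom C D) (g : lhom B C) (f : lhom A B),
    lcomp h (lcomp g f) = lcomp (lcomp h g) f;
  comp1m : forall A B (f : lhom A B), lcomp (lid B) f = f;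
  compm1 : forall A B (f : lhom A B), lcomp f (lid A) = f;
  compDl : forall A B C (g g' : lhom B C) (f : lhom A B),
    lcomp (g + g')%R f = (lcomp g f + lcomp g' f)%R;
  compDr : forall A B C (g : lhom B C) (f f' : lhom A B),
    lcomp g (f + f')%R = (lcomp g f + lcomp g f')%R
}.

Definition linear_functor (Ob : Type) (C D : lincat Ob)
    (F : forall A B, lhom C A B -> lhom D A B) : Prop :=
  [/\ forall A B (f g : lhom C A B), F _ _ (f + g)%R = (F _ _ f + F _ _ g)%R,
      forall A, F _ _ (lid C A) = lid D A
    & forall A B E (g : lhom C B E) (f : lhom C A B),
        F _ _ (lcomp g f) = lcomp (F _ _ g) (F _ _ f)].

Section Presentation.
Variables (Ob : Type) (gen : Ob -> Ob -> Type).

Inductive term : Ob -> Ob -> Type :=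
| Gen A B : gen A B -> term A B
| Id A : term A A
| Comp A B C : term B C -> term A B -> term A C
| Zero A B : term A B
| Opp A B : term A B -> term A B
| Add A B : term A B -> term A B -> term A B.

Variable rel : forall A B, term A B -> term A B -> Prop.

Inductive eqterm : forall A B, term A B -> term A B -> Prop :=
| eqt_rel A B (x y : term A B) : rel x y -> eqterm x y
| eqt_refl A B (x : term A B) : eqterm x x
| eqt_sym A B (x y : term A B) : eqterm x y -> eqterm y x
| eqt_trans A B (x y z : term A B) : eqterm x y -> eqterm y z -> eqterm x z
| eqt_comp A B C (g g' : term B C) (f f' : term A B) :
    eqterm g g' -> eqterm f f' -> eqterm (Comp g f) (Comp g' f')
| eqt_opp A B (x x' : term A B) : eqterm x x' -> eqterm (Opp x) (Opp x')
| eqt_add A B (x x' y y' : term A B) :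
    eqterm x x' -> eqterm y y' -> eqterm (Add x y) (Add x' y')
| eqt_compA A B C D (h : term C D) (g : term B C) (f : term A B) :
    eqterm (Comp h (Comp g f)) (Comp (Comp h g) f)
| eqt_comp1m A B (f : term A B) : eqterm (Comp (Id B) f) f
| eqt_compm1 A B (f : term A B) : eqterm (Comp f (Id A)) f
| eqt_compDl A B C (g g' : term B C) (f : term A B) :
    eqterm (Comp (Add g g') f) (Add (Comp g f) (Comp g' f))
| eqt_compDr A B C (g : term B C) (f f' : term A B) :
    eqterm (Comp g (Add f f')) (Add (Comp g f) (Comp g f'))
| eqt_addA A B (x y z : term A B) :
    eqterm (Add x (Add y z)) (Add (Add x y) z)
| eqt_addC A B (x y : term A B) : eqterm (Add x y) (Add y x)
| eqt_add0 A B (x : term A B) : eqterm (Add (Zero A B) x) x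
| eqt_addN A B (x : term A B) : eqterm (Add (Opp x) x) (Zero A B).

HB.instance Definition _ A B := gen_eqMixin (term A B).
HB.instance Definition _ A B := gen_choiceMixin (term A B).

Definition eqtermb A B (x y : term A B) : bool := `[< eqterm x y >].

Lemma eqtermb_equiv A B : equiv_class_of (@eqtermb A B).
Proof.
split=> [x|x y|y x z].
- exact/asboolP/eqt_refl.
- by apply/asboolP/asboolP; exact: eqt_sym.
- by move=> /asboolP xy /asboolP yz; apply/asboolP; exact: eqt_trans xy yz.
Qed.

Canonical eqtermb_equivRel A B := EquivRelPack (@eqtermb_equiv A B).

Definition phom A B := {eq_quot (@eqtermb A B)}%qT.
HB.instance Definition _ A B := Choice.on (phom A B).
HB.instance Definition _ A B := EqQuotient.on (phom A B).

Definition cls A B (x : term A B) : phom A B := (\pi_(phom A B) x)%qT.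

Lemma clsP A B (x y : term A B) : eqterm x y -> cls x = cls y.
Proof. by move=> xy; apply/eqmodP/asboolP. Qed.

Lemma cls_eq A B (x y : term A B) : cls x = cls y -> eqterm x y.
Proof. by move=> /eqmodP/asboolP. Qed.

Lemma repr_cls A B (x : term A B) : eqterm (repr (cls x)) x.
Proof. by apply: cls_eq; rewrite /cls reprK. Qed.

Lemma clsK A B (x : phom A B) : cls (repr x) = x.
Proof. exact: reprK. Qed.

Definition padd A B (x y : phom A B) := cls (Add (repr x) (repr y)).
Definition popp A B (x : phom A B) := cls (Opp (repr x)).
Definition pcomp A B C (g : phom B C) (f : phom A B) :=
  cls (Comp (repr g) (repr f)).

Lemma paddE A B (x y : term A B) : padd (cls x) (cls y) = cls (Add x y).
Proof. by apply: clsP; apply: eqt_add; exact: repr_cls. Qed.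
Lemma poppE A B (x : term A B) : popp (cls x) = cls (Opp x).
Proof. by apply: clsP; apply: eqt_opp; exact: repr_cls. Qed.
Lemma pcompE A B C (g : term B C) (f : term A B) :
  pcomp (cls g) (cls f) = cls (Comp g f).
Proof. by apply: clsP; apply: eqt_comp; exact: repr_cls. Qed.

Lemma paddA A B : associative (@padd A B).
Proof.
move=> x y z; rewrite -(clsK x) -(clsK y) -(clsK z) !paddE.
exact/clsP/eqt_addA.
Qed.
Lemma paddC A B : commutative (@padd A B).
Proof. by move=> x y; apply/clsP/eqt_addC. Qed.
Lemma padd0 A B : left_id (cls (Zero A B)) (@padd A B).
Proof. by move=> x; rewrite -(clsK x) paddE; apply/clsP/eqt_add0. Qed.
Lemma paddN A B : left_inverse (cls (Zero A B)) (@popp A B) (@padd A B).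
Proof. by move=> x; rewrite -(clsK x) poppE paddE; apply/clsP/eqt_addN. Qed.

HB.instance Definition _ A B :=
  GRing.isZmodule.Build (phom A B) (@paddA A B) (@paddC A B) (@padd0 A B)
    (@paddN A B).

Lemma pcompA A B C D (h : phom C D) (g : phom B C) (f : phom A B) :
  pcomp h (pcomp g f) = pcomp (pcomp h g) f.
Proof.
rewrite -(clsK h) -(clsK g) -(clsK f) !pcompE; exact/clsP/eqt_compA.
Qed.
Lemma pcomp1m A B (f : phom A B) : pcomp (cls (Id B)) f = f.
Proof. by rewrite -(clsK f) pcompE; apply/clsP/eqt_comp1m. Qed.
Lemma pcompm1 A B (f : phom A B) : pcomp f (cls (Id A)) = f.
Proof. by rewrite -(clsK f) pcompE; apply/clsP/eqt_compm1. Qed.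
Lemma pcompDl A B C (g g' : phom B C) (f : phom A B) :
  pcomp (g + g')%R f = (pcomp g f + pcomp g' f)%R.
Proof.
rewrite -(clsK g) -(clsK g') -(clsK f) /GRing.add /= paddE !pcompE paddE.
exact/clsP/eqt_compDl.
Qed.
Lemma pcompDr A B C (g : phom B C) (f f' : phom A B) :
  pcomp g (f + f')%R = (pcomp g f + pcomp g f')%R.
Proof.
rewrite -(clsK g) -(clsK f) -(clsK f') /GRing.add /= paddE !pcompE paddE.
exact/clsP/eqt_compDr.
Qed.

Definition presented : lincat Ob :=
  LinCat pcompA pcomp1m pcompm1 pcompDl pcompDr.

Definition pterm A B (x : term A B) : lhom presented A B := cls x.

(* A path from [I_m] to [I_0], written in the order of composition, target
   first: [gcons g1 (gcons g2 ...)] stands for g1 o g2 o ... *)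
Inductive gpath : Ob -> Ob -> Type :=
| gnil I : gpath I I
| gcons I J K : gen J I -> gpath J K -> gpath I K.

Fixpoint path_term I K (p : gpath I K) : term K I :=
  match p with
  | gnil A => Id A
  | gcons _ _ _ g q => Comp (Gen g) (path_term q)
  end.

Fixpoint trace (T : Type) (lab : forall A B, gen B A -> T) I K
    (p : gpath I K) : seq T :=
  match p with
  | gnil _ => [::]
  | gcons A B _ g q => lab A B g :: trace lab q
  end.

End Presentation.

Local Open Scope group_scope.

Section Coxeter.
Variables (W : groupType) (S : set W).

Definition has_order (x : W) (n : nat) : Prop :=
  [/\ (0 < n)%N, x ^+ n = 1 & forall k, (0 < k < n)%N -> x ^+ k <> 1].

Definition generated (I : set W) : set W :=
  smallest [set H : set W | group_closed (mem H)] I.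

Definition word (l : seq W) : Prop := forall s, s \in l -> S s.
Definition wprod (l : seq W) : W := \prod_(s <- l) s.

(* The congruence on words generated by (s t)^{m(s,t)} = 1, where m(s,t) is the
   order of s t, for the pairs with m(s,t) finite; s = t gives s^2 = 1. *)
Inductive coxeter_congr : seq W -> seq W -> Prop :=
| cox_refl l : coxeter_congr l l
| cox_sym l l' : coxeter_congr l l' -> coxeter_congr l' l
| cox_trans l l' l'' :
    coxeter_congr l l' -> coxeter_congr l' l'' -> coxeter_congr l l''
| cox_cat a b l l' :
    coxeter_congr l l' -> coxeter_congr (a ++ l ++ b) (a ++ l' ++ b)
| cox_braid s t n : S s -> S t -> has_order (s * t) n ->
    coxeter_congr (flatten (nseq n [:: s; t])) [::].

Definition coxeter_system : Prop :=
  [/\ forall s, S s -> has_order s 2,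
      generated S = setT
    & forall l l', word l -> word l' -> wprod l = wprod l' ->
        coxeter_congr l l'].

Definition reduced_word (w : W) (l : seq W) : Prop :=
  [/\ word l, wprod l = w
    & forall l', word l' -> wprod l' = w -> (size l <= size l')%N].

Definition redword (w : W) : seq W := xget [::] (reduced_word w).
Definition len (w : W) : nat := size (redword w).

Inductive bruhat : W -> W -> Prop :=
| bruhat_refl x : bruhat x x
| bruhat_step x y w s : S s -> bruhat x y ->
    (len y < len (y * (w * s * w^-1)))%N -> bruhat x (y * (w * s * w^-1)).

(* Right multiplication by a generator in the Coxeter monoid; x * y is then
   obtained by multiplying x by the letters of a reduced word of y. *)
Definition dmul1 (w s : W) : W := if (len w < len (w * s))%N then w * s else w.
Definition dmul (x y : W) : W := foldl dmul1 x (redword y).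

Definition is_finitary (I : set W) : Prop :=
  I `<=` S /\ finite_set (generated I).

Record finitary := Finitary {
  finitary_set :> set W;
  finitaryP : is_finitary finitary_set
}.

Definition longest (I : set W) : W :=
  xget 1 [set w | generated I w /\ forall x, generated I x -> (len x <= len w)%N].

Definition wconj (M : set W) (x : W) : W := longest M * x * longest M.

Definition dcoset (I : set W) (w : W) (J : set W) : set W :=
  [set a * w * b | a in generated I & b in generated J].

Definition is_coset (I J : set W) (p : set W) : Prop :=
  exists w, p = dcoset I w J.

Definition maxel (p : set W) : W :=
  xget 1 [set x | p x /\ forall y, p y -> bruhat x y -> y = x].
Definition minel (p : set W) : W :=
  xget 1 [set x | p x /\ forall y, p y -> bruhat y x -> y = x].

Definition core (I J : set W) (p : set W) : Prop :=
  is_coset I J p /\ I = [set minel p * j * (minel p)^-1 | j in J].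

Definition coset_comp (I K : set W) (p q : set W) : set W :=
  dcoset I (dmul (maxel p) (maxel q)) K.

Definition reduced_comp (J : set W) (p q : set W) : Prop :=
  len (maxel p * (longest J)^-1 * maxel q) =
  (len (maxel p * (longest J)^-1)%g + len (maxel q))%N.

(* In the next two functions [p] is the (I0, J)-coset expressed by the part
   [I0, ..., J] already read, and [l] is what follows [J]. *)
Fixpoint expressed_from (I0 J p : set W) (l : seq (set W)) : set W :=
  match l with
  | [::] => p
  | K :: l' => expressed_from I0 K (coset_comp I0 K p (dcoset J 1 K)) l'
  end.

Fixpoint reduced_from (I0 J p : set W) (l : seq (set W)) : Prop :=
  match l with
  | [::] => True
  | K :: l' => reduced_comp J p (dcoset J 1 K) /\
      reduced_from I0 K (coset_comp I0 K p (dcoset J 1 K)) l'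
  end.

Definition expressed (l : seq (set W)) : set W :=
  match l with
  | [::] => set0
  | [:: I0] => dcoset I0 1 I0
  | I0 :: I1 :: l' => expressed_from I0 I1 (dcoset I0 1 I1) l'
  end.

Definition reduced (l : seq (set W)) : Prop :=
  match l with
  | I0 :: I1 :: l' => reduced_from I0 I1 (dcoset I0 1 I1) l'
  | _ => True
  end.

Inductive move := Plus of W | Minus of W.

Definition do_move (I : set W) (m : move) : set W :=
  match m with Plus s => s |` I | Minus s => I `\ s end.

(* The sequence of subsets [I +- s_1 +- ... +- s_m]. *)
Definition walk (I : set W) (ms : seq move) : seq (set W) :=
  I :: scanl do_move I ms.

Definition adjacent (I J : set W) : Prop :=
  exists s, (~ I s /\ J = s |` I) \/ (I s /\ J = I `\ s).

Definition sd_gen (J I : finitary) : Type := adjacent I J.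

(* [expr I J] is the type of expressions [I_0, ..., I_m] with I_0 = I, I_m = J;
   [subsets] lists the subsets, so [subsets e = walk I ms] in particular asserts
   that the right-hand side is a well defined expression from I to J. *)
Definition expr : finitary -> finitary -> Type := gpath sd_gen.

Definition subsets (I J : finitary) (e : expr I J) : seq (set W) :=
  (I : set W) :: trace (fun (_ K : finitary) _ => K : set W) e.

Definition atom (I J : finitary) (p : set W) : Prop :=
  core I J p /\
  exists (e : expr I J) (s t : W),
    [/\ subsets e = walk I [:: Plus s; Minus t],
        reduced (subsets e) & expressed (subsets e) = p].

(* [is_finitary (s |` I)] includes s \in S. *)
Definition addable (I : set W) (s : W) : Prop :=
  ~ I s /\ is_finitary (s |` I).

Definition atom_end (I : set W) (s : W) : set W :=
  (s |` I) `\ wconj (s |` I) s.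

(* {}^I_s a, an (I, J)-coset, and a^I_s, a (J, I)-coset, for J = atom_end I s. *)
Definition latom (I : set W) (s : W) : set W :=
  dcoset I (longest (s |` I)) (atom_end I s).
Definition ratom (I : set W) (s : W) : set W :=
  dcoset (atom_end I s) (longest (s |` I)) I.

(* [rot M s t i] is the pair (u_{i-1}, u_i), i >= 0, of the rotation sequence of
   (M, s, t). *)
Definition rot (M : set W) (s t : W) (i : nat) : W * W :=
  iter i (fun v => (v.2, wconj (M `\ v.2) v.1)) (wconj M t, s).

Definition rotu M s t i : W := (rot M s t i).2.
Definition rotP M s t i : set W := M `\ (rot M s t i).2.
Definition rotL M s t i : set W :=
  M `\` [set (rot M s t i).2; (rot M s t i).1].

(* [L_0, P_0, L_1, P_1, ..., L_k, P_k, L_{k+1}] *)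
Definition rot_expr M s t (k : nat) : seq (set W) :=
  rcons (flatten [seq [:: rotL M s t i; rotP M s t i] | i <- iota 0 k.+1])
        (rotL M s t k.+1).

Definition rot_depth M s t : nat :=
  xget 0%N [set k | reduced (rot_expr M s t k) /\
                 forall k', reduced (rot_expr M s t k') -> (k' <= k)%N].

Definition sd_path (I J : finitary) (e : expr I J) : term sd_gen J I :=
  path_term e.

Inductive sd_rel : forall J I, term sd_gen J I -> term sd_gen J I -> Prop :=
| sd_up (I J : finitary) (e e' : expr I J) s t :
    subsets e = walk I [:: Plus s; Plus t] ->
    subsets e' = walk I [:: Plus t; Plus s] ->
    sd_rel (sd_path e) (sd_path e')
| sd_down (I J : finitary) (e e' : expr I J) s t :
    subsets e = walk I [:: Minus s; Minus t] ->
    subsets e' = walk I [:: Minus t; Minus s] ->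
    sd_rel (sd_path e) (sd_path e')
| sd_switchback (I J : finitary) (e e' : expr I J) s t :
    subsets e = walk I [:: Plus s; Minus t] ->
    wconj (s |` I) s <> t ->
    subsets e' =
      walk I (flatten [seq [:: Minus (rotu (s |` I) s t i);
                               Plus (rotu (s |` I) s t i.-1)]
                      | i <- iota 1 (rot_depth (s |` I) s t)]) ->
    sd_rel (sd_path e) (sd_path e')
| sd_nil (I : finitary) (e : expr I I) s :
    subsets e = walk I [:: Minus s; Plus s] ->
    sd_rel (sd_path e) (Zero sd_gen I I).

Definition SD : lincat finitary := presented sd_rel.

Definition dexpr (I J : finitary) (e : expr I J) : lhom SD J I :=
  pterm sd_rel (sd_path e).

(* The morphism of p: its value at a chosen reduced expression. *)
Definition dcos (I J : finitary) (p : set W) : lhom SD J I :=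
  xget 0%R [set f | exists e : expr I J,
    [/\ reduced (subsets e), expressed (subsets e) = p & f = dexpr e]].

Definition SDcore (J I : finitary) : set (lhom SD J I) :=
  [set f | exists (n : nat) (c : 'I_n -> int) (p : 'I_n -> set W),
    (forall i, core I J (p i)) /\
    f = (\sum_(i < n) dcos I J (p i) *~ c i)%R].

Definition atom_gen (J I : finitary) : Type := {p : set W | atom I J p}.

Definition atom_path : finitary -> finitary -> Type := gpath atom_gen.

(* The sequence of triples (I, p, J) for the (I, J)-cosets p along a path. *)
Definition atoms (I J : finitary) (x : atom_path I J) :
    seq (set W * set W * set W) :=
  trace (fun (I J : finitary) (a : atom_gen J I) => (I : set W, sval a, J : set W)) x.

Definition expr_coset (I P J : set W) : set W * set W * set W :=
  (I, expressed [:: I; P; J], J).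

(* a_0, a_1, ..., a_d, where d is the depth of the rotation sequence *)
Definition braid_lhs (M : set W) (s t : W) : seq (set W * set W * set W) :=
  let L := rotL M t (wconj M s) in
  let P := rotP M t (wconj M s) in
  let d := rot_depth M t (wconj M s) in
  [seq expr_coset (L i) (P i) (L i.+1) | i <- iota 0 d.+1].

(* b_d, b_{d-1}, ..., b_0 *)
Definition braid_rhs (M : set W) (s t : W) : seq (set W * set W * set W) :=
  let L i := wconj M @` rotL M t (wconj M s) i in
  let P i := wconj M @` rotP M t (wconj M s) i in
  let d := rot_depth M t (wconj M s) in
  [seq expr_coset (L i.+1) (P i) (L i) | i <- rev (iota 0 d.+1)].

Inductive atom_rel :
  forall J I, term atom_gen J I -> term atom_gen J I -> Prop :=
| atom_braid (I J : finitary) (x y : atom_path I J) s t :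
    ~ finitary_set I s -> ~ finitary_set I t -> s <> t ->
    is_finitary (s |` (t |` I)) ->
    atoms x = braid_lhs (s |` (t |` I)) s t ->
    atoms y = braid_rhs (s |` (t |` I)) s t ->
    atom_rel (path_term x) (path_term y)
| atom_nil (I J : finitary) s (a : atom_gen I J) (a' : atom_gen J I) :
    addable I s -> J = atom_end I s :> set W ->
    sval a = ratom I s -> sval a' = latom I s ->
    atom_rel (Comp (Gen a) (Gen a')) (Zero atom_gen J J).

Definition atomic_cat : lincat finitary := presented atom_rel.

Definition datom (I J : finitary) (a : atom_gen J I) : lhom atomic_cat J I :=
  pterm atom_rel (Gen a).

End Coxeter.

Arguments SDcore {W} S J I _.

(* Main.v *)
(* SD acts on Z[W]: the morphism [I, J] sends v to w_I w_(I u J) v if v is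
   minimal in its coset W_(I u J) v, and to 0 otherwise.  A reduced expression of
   a core coset p sends 1 to the minimal element of p, so the morphisms of core
   cosets are linearly independent.
   For the atomic category, call an element w that is minimal in W_I w and
   satisfies I = w J w^-1 a core element.  Both sides of an atomic braid relation
   move 1 to w_I w_M, so an induction on the length of w, as in Matsumoto's
   theorem, shows that all reduced atomic paths of the core element w agree;
   with the nil-quadratic relation, they span all morphisms.  This gives
   injectivity.
   For surjectivity, the switchback relation lets one rewrite any expression as a
   descending part, then atoms, then an ascending part; on a reduced expression of
   a core coset, lengths force the two outer parts to be trivial. *)

(* That ∂_p is independent of the reduced expression is not taken for granted: [dcos] is a choice,
   and for core cosets its independence falls out of comparing reduced expressions with normal forms
   of atomic paths. The obstacle is that reducedness and the depth d of a rotation sequence are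
   given by maximal elements, the Coxeter monoid and a maximum. Both become statements on lengths:
   an expression from I is reduced iff w_I times the product of the elements w_J w_(J u K), over its
   steps from J to K, has additive length. For a rotation sequence in M this holds exactly until the
   product reaches w_M. Hence the sequence ends at w_M L_0 w_M, its reversal is a conjugate rotation
   sequence, and the right side of an atomic braid relation is the left side for exchanged s and t.
   In [SD] the braid relation holds because the inner part of either side is the long side of a
   switchback relation. With s' = w_M s w_M and t' = w_M t w_M, the two sides collapse to
   [I + s + t - s' - t'] and [I + t + s - t' - s'], which agree by the two commutation relations. *)
From HB Require Import structures.
Require Import Defs.
From mathcomp Require Import all_boot all_algebra zify.
From mathcomp Require Import boolp classical_sets cardinality.

Set Implicit Arguments.
Unset Strict Implicit.
Unset Printing Implicit Defensive.

Local Open Scope classical_set_scope.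
Local Open Scope group_scope.

(* The multiplication of [W] is reached through several canonical paths, which
   [lia] does not identify; [llia] first renames them all to [gmul]. *)
Definition gmul (W : groupType) (x y : W) : W := x * y.
Definition ginv (W : groupType) (x : W) : W := x^-1.
Ltac llia := intros;
  repeat match goal with
  | H : context [@monoid.mul _ ?a ?b] |- _ =>
      change (@monoid.mul _ a b) with (gmul a b) in H
  | |- context [@monoid.mul _ ?a ?b] =>
      change (@monoid.mul _ a b) with (gmul a b)
  | H : context [@monoid.inv _ ?a] |- _ =>
      change (@monoid.inv _ a) with (ginv a) in H
  | |- context [@monoid.inv _ ?a] => change (@monoid.inv _ a) with (ginv a)
  end; lia.

(** * Words and the reflections they define *)

Section Words.
Variable W : groupType.
Implicit Types (s t x y w : W) (l : seq W).

Lemma wprod_nil : wprod [::] = 1 :> W.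
Proof. by rewrite /wprod big_nil. Qed.
Lemma wprod_cons s l : wprod (s :: l) = s * wprod l.
Proof. by rewrite /wprod big_cons. Qed.
Lemma wprod_cat l l' : wprod (l ++ l') = wprod l * wprod l'.
Proof. by rewrite /wprod big_cat. Qed.

(** The multiplicity of [t] among the elements (s_1...s_{i-1}) s_i (s_1...s_{i-1})^-1 attached to a
    word; its parity serves as the test for inversions. *)
Fixpoint nrefl l t : nat :=
  if l is s :: l' then ((t == s) + nrefl l' (s^-1 * t * s))%N else 0%N.

Lemma nrefl_cat l l' t :
  nrefl (l ++ l') t = (nrefl l t + nrefl l' ((wprod l)^-1 * t * wprod l))%N.
Proof.
elim: l t => [|s l IH] t /=; first by rewrite wprod_nil invg1 mul1g mulg1.
by rewrite IH addnA wprod_cons invgM !mulgA.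
Qed.

Lemma wprod_alt s t n : wprod (flatten (nseq n [:: s; t])) = (s * t) ^+ n.
Proof.
elim: n => [|n IH] /=; first by rewrite wprod_nil expg0.
by rewrite !wprod_cons IH expgS mulgA.
Qed.

(** When (st)^n = 1, the terms with j >= n repeat those with j < n, so every multiplicity in a
    relator is even. *)
Lemma nrefl_alt s t n x : s * s = 1 -> t * t = 1 ->
  nrefl (flatten (nseq n [:: s; t])) x =
    (\sum_(j < n.*2) (x == (s * t) ^+ j * s)%g)%N.
Proof.
move=> ss tt.
have sV : s^-1 = s by rewrite -[LHS]mulg1 -ss mulKg.
have tV : t^-1 = t by rewrite -[LHS]mulg1 -tt mulKg.
have ssK y : y * s * s = y by rewrite -mulgA ss mulg1.
have ttK y : y * t * t = y by rewrite -mulgA tt mulg1.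
elim: n x => [|n IH] x /=; first by rewrite big_ord0.
rewrite doubleS !big_ord_recl /= expg0 mul1g expg1; congr (_ + (_ + _))%N.
  by rewrite sV; congr nat_of_bool; apply/eqP/eqP => [<-|->];
    rewrite !mulgA ?ssK // ss mul1g.
rewrite IH; apply: eq_bigr => j _; congr nat_of_bool.
rewrite /bump /= !add1n expgS expgSr sV tV.
set p := _ ^+ j; apply/eqP/eqP => [H|->].
  have -> : s * t * (p * (s * t)) * s = s * t * (p * s) * t * s.
    by rewrite !mulgA.
  by rewrite -H !mulgA; do !rewrite ?(ssK, ttK) ?(ss, tt) ?mul1g.
by rewrite !mulgA; do !rewrite ?(ssK, ttK) ?(ss, tt) ?mul1g.
Qed.
End Words.

Arguments lcomp : simpl never.
Arguments lid : simpl never.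
Arguments lhom : simpl never.

(** * Linear functors out of a presented category *)

Section PresentedTerms.
Variables (Ob : Type) (gen : Ob -> Ob -> Type).
Variable rel : forall A B, term gen A B -> term gen A B -> Prop.

Lemma ptermK A B (f : lhom (presented rel) A B) : pterm rel (repr f) = f.
Proof. exact: clsK. Qed.
Lemma pterm_comp A B E (g : term gen B E) (f : term gen A B) :
  pterm rel (Comp g f) = lcomp (pterm rel g) (pterm rel f).
Proof. by rewrite /lcomp /= pcompE. Qed.
Lemma ptermD A B (x y : term gen A B) :
  pterm rel (Add x y) = (pterm rel x + pterm rel y)%R.
Proof. exact/esym/paddE. Qed.
Lemma ptermN A B (x : term gen A B) : pterm rel (Opp x) = (- pterm rel x)%R.
Proof. exact/esym/poppE. Qed.
End PresentedTerms.

Section PresentedFunctor.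
Variables (Ob : Type) (gen : Ob -> Ob -> Type).
Variable rel : forall A B, term gen A B -> term gen A B -> Prop.
Variables (D : lincat Ob) (phi : forall A B, gen A B -> lhom D A B).

Fixpoint teval A B (x : term gen A B) : lhom D A B :=
  match x in term _ A B return lhom D A B with
  | Gen _ _ g => phi g
  | Id A => lid D A
  | Comp _ _ _ g f => lcomp (teval g) (teval f)
  | Zero _ _ => 0%R
  | Opp _ _ x => (- teval x)%R
  | Add _ _ x y => (teval x + teval y)%R
  end.

Hypothesis phi_rel : forall A B (x y : term gen A B),
  rel x y -> teval x = teval y.

Lemma teval_eqterm A B (x y : term gen A B) : eqterm rel x y -> teval x = teval y.
Proof.
elim=> {A B x y} /=.
- by move=> A B x y /phi_rel.
- by [].
- by [].
- by move=> A B x y z _ -> _ ->.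
- by move=> A B C g g' f f' _ -> _ ->.
- by move=> A B x x' _ ->.
- by move=> A B x x' y y' _ -> _ ->.
- by move=> *; rewrite Defs.compA.
- by move=> *; rewrite comp1m.
- by move=> *; rewrite compm1.
- by move=> *; rewrite compDl.
- by move=> *; rewrite compDr.
- by move=> *; rewrite GRing.addrA.
- by move=> *; rewrite GRing.addrC.
- by move=> *; rewrite GRing.add0r.
- by move=> *; rewrite GRing.addNr.
Qed.

Definition pfun A B (x : lhom (presented rel) A B) : lhom D A B := teval (repr x).

Lemma pfunE A B (x : term gen A B) : pfun (pterm rel x) = teval x.
Proof. exact/teval_eqterm/repr_cls. Qed.

Lemma pfun_linear : linear_functor pfun.
Proof.
split=> [A B f g|A|A B E g f].
- by rewrite -(ptermK f) -(ptermK g) -ptermD !pfunE.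
- exact: (pfunE (Id gen A)).
- by rewrite -(ptermK f) -(ptermK g) -pterm_comp !pfunE.
Qed.
End PresentedFunctor.

Section LincatTheory.
Variables (Ob : Type) (C : lincat Ob).
Implicit Types A B : Ob.

Lemma comp0m A B E (f : lhom C A B) : lcomp (0 : lhom C B E)%R f = 0%R.
Proof.
by apply: (@GRing.addrI _ (lcomp (0 : lhom C B E)%R f)); rewrite -compDl !GRing.addr0.
Qed.
Lemma compm0 A B E (g : lhom C B E) : lcomp g (0 : lhom C A B)%R = 0%R.
Proof.
by apply: (@GRing.addrI _ (lcomp g (0 : lhom C A B)%R)); rewrite -compDr !GRing.addr0.
Qed.
Lemma compNm A B E (g : lhom C B E) (f : lhom C A B) : lcomp (- g)%R f = (- lcomp g f)%R.
Proof.
by apply: (@GRing.addrI _ (lcomp g f)); rewrite -compDl !GRing.subrr comp0m.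
Qed.
Lemma compmN A B E (g : lhom C B E) (f : lhom C A B) : lcomp g (- f)%R = (- lcomp g f)%R.
Proof.
by apply: (@GRing.addrI _ (lcomp g f)); rewrite -compDr !GRing.subrr compm0.
Qed.
End LincatTheory.

Section LinearFunctorTheory.
Variables (Ob : Type) (C D : lincat Ob) (F : forall A B, lhom C A B -> lhom D A B).
Hypothesis HF : linear_functor F.

Lemma lfunctor0 A B : F (0 : lhom C A B)%R = 0%R.
Proof.
case: HF => FD _ _; apply: (@GRing.addrI _ (F (0 : lhom C A B)%R)).
by rewrite -FD !GRing.addr0.
Qed.
Lemma lfunctorN A B (f : lhom C A B) : F (- f)%R = (- F f)%R.
Proof.
case: HF => FD _ _; apply: (@GRing.addrI _ (F f)).
by rewrite -FD !GRing.subrr lfunctor0.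
Qed.
Lemma lfunctorZ A B (f : lhom C A B) (n : int) : F (f *~ n)%R = (F f *~ n)%R.
Proof.
have FMn (m : nat) : F (f *+ m)%R = (F f *+ m)%R.
  elim: m => [|m IH]; first by rewrite !GRing.mulr0n lfunctor0.
  by case: HF => FD _ _; rewrite !GRing.mulrS FD IH.
case: n => m; first exact: FMn.
exact: etrans (lfunctorN _) (congr1 _ (FMn _)).
Qed.
Lemma lfunctor_sum A B (I : Type) (s : seq I) (f : I -> lhom C A B) :
  F (\sum_(i <- s) f i)%R = (\sum_(i <- s) F (f i))%R.
Proof.
elim: s => [|i s IH]; first by rewrite !big_nil lfunctor0.
by case: HF => FD _ _; rewrite !big_cons FD IH.
Qed.
End LinearFunctorTheory.

(** * Lengths, exchange and parabolic subgroups *)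

Section CoxeterTheory.
Variables (W : groupType) (S : set W).
Hypothesis HS : coxeter_system S.
Implicit Types (s t r x y z w v a b : W) (l : seq W) (I J K M : set W) (n : nat).
Notation len := (len S).

Lemma word_cons I s l : word I (s :: l) <-> I s /\ word I l.
Proof.
split=> [H|[Is H] r]; last by rewrite inE => /orP [/eqP -> //|/H].
by split=> [|r rl]; apply: H; rewrite inE ?eqxx ?rl ?orbT.
Qed.
Lemma word_cat I l l' : word I (l ++ l') <-> word I l /\ word I l'.
Proof.
split=> [H|[H H'] s]; last by rewrite mem_cat => /orP [/H|/H'].
by split=> s sl; apply: H; rewrite mem_cat sl ?orbT.
Qed.
Lemma word_sub I J l : I `<=` J -> word I l -> word J l.
Proof. by move=> IJ H s /H /IJ. Qed.

Lemma Sinvol s : S s -> s * s = 1.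
Proof. by case: HS => H _ _ /H [_ + _]; rewrite expg2. Qed.
Lemma Sneq1 s : S s -> s <> 1.
Proof. by case: HS => H _ _ /H [_ _ /(_ 1%N)]; rewrite expg1; apply. Qed.
Lemma SinvE s : S s -> s^-1 = s.
Proof. by move=> Ss; rewrite -[LHS]mulg1 -(Sinvol Ss) mulKg. Qed.
Lemma SKl s x : S s -> s * (s * x) = x.
Proof. by move=> Ss; rewrite mulgA Sinvol ?mul1g. Qed.
Lemma wprod_rev l : word S l -> wprod (rev l) = (wprod l)^-1.
Proof.
elim: l => [|s l IH]; first by rewrite wprod_nil invg1.
move=> /word_cons [Ss Sl]; rewrite rev_cons -cats1 wprod_cat wprod_cons.
by rewrite wprod_cons wprod_nil mulg1 IH // invgM (SinvE Ss).
Qed.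

Lemma gen1 I : generated I 1.
Proof. by move=> H [[H1 _] _]; rewrite inE in H1. Qed.
Lemma genS I s : I s -> generated I s.
Proof. by move=> Is H [_]; apply. Qed.
Lemma genM I x y : generated I x -> generated I y -> generated I (x * y).
Proof.
move=> Hx Hy H HH; move: (Hx _ HH) (Hy _ HH); case: HH => HH _ h1 h2.
have := group_closedM HH; move=> /(_ x y); rewrite !inE; exact.
Qed.
Lemma genV I x : generated I x -> generated I x^-1.
Proof.
move=> Hx H HH; move: (Hx _ HH); case: HH => HH _ h1.
have := group_closedV HH; move=> /(_ x); rewrite !inE; exact.
Qed.
Lemma gen_mono I J : I `<=` J -> generated I `<=` generated J.
Proof. by move=> IJ x Hx H [H1 H2]; apply: Hx; split=> // s /IJ /H2. Qed.
Lemma gen_wprod I l : word I l -> generated I (wprod l).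
Proof.
elim: l => [|s l IH]; first by rewrite wprod_nil => _; exact: gen1.
by move=> /word_cons [Is /IH H]; rewrite wprod_cons; apply: genM => //; exact: genS.
Qed.

Lemma gen_word I x : I `<=` S -> generated I x ->
  exists2 l, word I l & wprod l = x.
Proof.
move=> IS; apply: (@smallest_sub _ _ _
  [set x | exists2 l, word I l & wprod l = x]); last first.
  by move=> s Is; exists [:: s]; rewrite ?wprod_cons ?wprod_nil ?mulg1 // => r;
    rewrite inE => /eqP ->.
split; first by rewrite inE; exists [::]; rewrite ?wprod_nil.
move=> y z; rewrite !inE => -[l ol <-] [l' ol' <-].
exists (l ++ rev l').
  by apply/word_cat; split=> // s; rewrite mem_rev => /ol'.
by rewrite wprod_cat wprod_rev // => s /ol' /IS.
Qed.

Lemma genT x : generated S x.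
Proof. by case: HS => _ -> _. Qed.

Lemma redwordP w : reduced_word S w (redword S w).
Proof.
rewrite /redword; apply: xgetPex.
have [l0 H0 E0] := gen_word (@subset_refl _ S) (genT w).
have ex : exists n, `[< exists l, [/\ word S l, wprod l = w & size l = n] >].
  by exists (size l0); apply/asboolP; exists l0.
case: (ex_minnP ex) => n /asboolP [l [H1 H2 H3]] Hmin.
exists l; split=> // l' H1' H2'; rewrite H3; apply: Hmin.
by apply/asboolP; exists l'.
Qed.

Lemma len_le l : word S l -> (len (wprod l) <= size l)%N.
Proof. by case: (redwordP (wprod l)) => _ _ H wl; exact: H. Qed.

Lemma len1 : len 1 = 0%N.
Proof. by apply/eqP; rewrite -leqn0 -wprod_nil; exact: len_le. Qed.

Lemma len_eq0 w : len w = 0%N -> w = 1.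
Proof.
move=> /size0nil E; case: (redwordP w) => _ <- _; by rewrite E wprod_nil.
Qed.

Lemma lenM x y : (len (x * y) <= len x + len y)%N.
Proof.
case: (redwordP x) (redwordP y) => h1 h2 _ [h3 h4 _].
rewrite -{1}h2 -{1}h4 -wprod_cat -size_cat; apply: len_le.
by apply/word_cat.
Qed.

Lemma lenV x : len x^-1 = len x.
Proof.
have le y : (len y^-1 <= len y)%N.
  case: (redwordP y) => h1 h2 _; rewrite -{1}h2 -wprod_rev //.
  rewrite -[len y]/(size (redword S y)) -size_rev; apply: len_le.
  by move=> s; rewrite mem_rev => /h1.
by apply/eqP; rewrite eqn_leq le -{1}[x]invgK le.
Qed.

Lemma len_S s : S s -> len s = 1%N.
Proof.
move=> Ss; apply/eqP; rewrite eqn_leq; apply/andP; split.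
  rewrite -{1}[s]mulg1 -wprod_nil -wprod_cons; apply: len_le.
  by apply/word_cons.
by case: posnP => // /len_eq0 /(Sneq1 Ss).
Qed.

Lemma congr_inv l l' : coxeter_congr S l l' ->
  wprod l = wprod l' /\ forall t, odd (nrefl l t) = odd (nrefl l' t).
Proof.
elim=> {l l'} [l|l l' _ [E H]|l1 l2 l3 _ [E H] _ [E' H']|a b l l' _ [E H]|
  s t n Ss St [_ hn _]].
- by [].
- by split.
- by split=> [|t]; [rewrite E|rewrite H].
- split=> [|t]; first by rewrite !wprod_cat E.
  by rewrite !nrefl_cat !oddD H E.
- split=> [|x]; first by rewrite wprod_alt hn wprod_nil.
  rewrite nrefl_alt ?Sinvol // -addnn big_split_ord /=.
  under [X in (_ + X)%N]eq_bigr => j _ do rewrite expgnDr hn mul1g.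
  by rewrite addnn odd_double.
Qed.

(** By the third clause of [coxeter_system] and [congr_inv], every word of [w] gives the same
    parity, so this is a function of the group element. *)
Definition eta w t := odd (nrefl (redword S w) t).

Lemma etaE l t : word S l -> eta (wprod l) t = odd (nrefl l t).
Proof.
move=> wl; case: (redwordP (wprod l)) => h1 h2 _; case: HS => _ _ H.
by have [_ E] := congr_inv (H _ _ h1 wl h2); exact: E.
Qed.

(** If [t] is the element attached to position i, multiplying by [t] on the left cancels the i-th
    letter. *)
Lemma exchange_refl l t : word S l -> (0 < nrefl l t)%N ->
  exists l1 r l2, l = l1 ++ r :: l2 /\ t * wprod l = wprod (l1 ++ l2).
Proof.
elim: l t => [|s l IH] t //= /word_cons [Ss Sl].
case: eqP => [->|_] /=.
  by exists [::], s, l; rewrite wprod_cons SKl.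
rewrite add0n => /(IH _ Sl) [l1 [r [l2 [-> E]]]].
exists (s :: l1), r, l2; split=> //; rewrite cat_cons 2!wprod_cons -E.
by rewrite !mulgA mulgV mul1g.
Qed.

Lemma len_refl_lt w t : eta w t -> (len (t * w) < len w)%N.
Proof.
move=> H; case: (redwordP w) => h1 h2 _.
have [|l1 [r [l2 [E1 E2]]]] := exchange_refl (t := t) h1; first exact: odd_gt0.
rewrite -h2 E2; apply: leq_ltn_trans (len_le _) _.
  by move: h1; rewrite E1 => /word_cat [? /word_cons [_ ?]]; apply/word_cat.
by rewrite h2 /len E1 !size_cat /= addnS.
Qed.

Lemma eta_S s w : S s -> eta (s * w) s = ~~ eta w s.
Proof.
move=> Ss; case: (redwordP w) => h1 h2 _.
rewrite -{1}h2 -wprod_cons etaE; last exact/word_cons.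
by rewrite /= eqxx oddD /= mulVg mul1g.
Qed.

Lemma eta_lt s w : S s -> eta w s = (len (s * w) < len w)%N.
Proof.
move=> Ss; apply/idP/idP => [/len_refl_lt //|].
(* Multiplication by [s] flips the parity at [s], so parity 0 for [w] is parity 1 for [s * w], and
   then [w] is shorter than [s * w]. *)
apply: contraLR => H; rewrite -leqNgt ltnW //.
by rewrite -{1}(SKl w Ss); apply: len_refl_lt; rewrite eta_S.
Qed.

Lemma len_S1 s w : S s -> len (s * w) = (len w).+1 \/ len w = (len (s * w)).+1.
Proof.
move=> Ss; have h1 := lenM s w; have h2 := lenM s (s * w).
rewrite SKl // (len_S Ss) in h1 h2.
case E : (eta w s); first by right; move: E; rewrite eta_lt //; llia.
by left; move/negbT: E; rewrite -eta_S // eta_lt // SKl //; llia.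
Qed.

Lemma exchange s l : S s -> word S l -> (len (s * wprod l) < len (wprod l))%N ->
  exists l1 r l2, l = l1 ++ r :: l2 /\ s * wprod l = wprod (l1 ++ l2).
Proof.
move=> Ss wl; rewrite -eta_lt // etaE // => /odd_gt0; exact: exchange_refl.
Qed.

(** Exchange in a reduced word of [x] followed by [l]: the alternative records on which side of the
    cut the deleted letter lies. *)
Lemma exchange_mul s x l : S s -> word S l ->
  (len (s * (x * wprod l)) < len (x * wprod l))%N ->
  (len (s * x) < len x)%N \/
  exists l1 r l2, l = l1 ++ r :: l2 /\ s * (x * wprod l) = x * wprod (l1 ++ l2).
Proof.
move=> Ss wl; case: (redwordP x) => h1 h2 _.
rewrite -[in X in X -> _]h2 -[in X in X -> _]wprod_cat => /exchange [//||].
  exact/word_cat.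
move=> l1 [r [l2 [E]]]; rewrite wprod_cat h2 => E2.
have : (size l1 < size (redword S x) \/ size (redword S x) <= size l1)%N by llia.
case=> Hs; [left|right].
  have E1 : redword S x = l1 ++ r :: take (size (redword S x) - (size l1).+1) l2.
    have := congr1 (take (size (redword S x))) E.
    rewrite take_size_cat // take_cat ltnNge ltnW //= => {1}->.
    by have -> : (size (redword S x) - size l1 =
      (size (redword S x) - (size l1).+1).+1)%N by llia.
  set l3 := take _ _ in E1.
  have E3 : l2 = l3 ++ l.
    move: E; rewrite E1 -catA /= => /eqP; rewrite eqseq_cat // eqxx /=.
    by rewrite eqseq_cons eqxx /= => /eqP.
  move: E2; rewrite E3 catA wprod_cat mulgA => /mulIg ->.
  apply: leq_ltn_trans (len_le _) _.
    by move: h1; rewrite E1 => /word_cat [? /word_cons [_ ?]]; apply/word_cat.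
  by rewrite /len E1 !size_cat /= addnS.
have E1 : l1 = redword S x ++ drop (size (redword S x)) l1.
  have := congr1 (take (size (redword S x))) E.
  by rewrite take_size_cat // takel_cat // => H; rewrite {1}H cat_take_drop.
set l3 := drop _ _ in E1; exists l3, r, l2; split.
  move: E; rewrite E1 -catA => /eqP; rewrite eqseq_cat // eqxx /=.
  by move/eqP.
by rewrite E2 E1 -catA wprod_cat h2.
Qed.

(** Exchange only deletes letters, so shortening a word over [I] stays over [I], and lengths in W_I
    can be computed there. *)
Lemma gen_redword I x : I `<=` S -> generated I x ->
  exists l, [/\ word I l, wprod l = x & size l = len x].
Proof.
move=> IS /(gen_word IS) [l + <-].
elim: l => [|s l IH]; first by exists [::]; rewrite wprod_nil len1.
move=> /word_cons [Is /IH [l' [H1 E0 H3]]]; rewrite wprod_cons -E0.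
have Ss := IS _ Is; have Sl' : word S l' := word_sub IS H1.
case: (len_S1 (wprod l') Ss) => E.
  exists (s :: l'); rewrite wprod_cons /= E H3 E0; split=> //.
  by apply/word_cons; split.
case: (@exchange s l' Ss Sl'); first by rewrite E.
move=> l1 [r [l2 [E1 E2]]]; exists (l1 ++ l2); split=> //.
  by move: H1; rewrite E1 => /word_cat [? /word_cons [_ ?]]; apply/word_cat.
by move: H3; rewrite -E0 E E1 !size_cat /= addnS => -[].
Qed.

Lemma len_neq s x : S s -> len (s * x) <> len x.
Proof. by move=> Ss; case: (len_S1 x Ss); llia. Qed.

Lemma len_sub_S I s : I `<=` S -> generated I s -> S s -> I s.
Proof.
move=> IS /(gen_redword IS) [l [H1 H2 H3]] Ss.
move: H3; rewrite len_S //; case: l H1 H2 => [|r [|//]] //.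
by move=> /word_cons [Ir _]; rewrite wprod_cons wprod_nil mulg1 => <-.
Qed.

(** Minimality of [v] in W_I v, stated as additivity because products are what it is used for;
    [lminP] is the local criterion. *)
Definition lmin I v := forall x, generated I x -> len (x * v) = (len x + len v)%N.
(** For finite W_I this means that [x] begins with w_I. The form by descents makes sense before W_I
    is known to be finite, and serves to prove it finite. *)
Definition lfull I x := forall s, I s -> (len (s * x) < len x)%N.

Lemma lmin_sub I J v : I `<=` J -> lmin J v -> lmin I v.
Proof. by move=> IJ H x /(gen_mono IJ) /H. Qed.

Lemma lmin1 I : lmin I 1.
Proof. by move=> x _; rewrite mulg1 len1 addn0. Qed.

Lemma parab_decomp I w : I `<=` S ->
  exists x v, [/\ generated I x, lmin I v & w = x * v].
Proof.
move=> IS.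
have ex : exists n, `[< exists2 x, generated I x & len (x * w) = n >].
  by exists (len (1 * w)); apply/asboolP; exists 1 => //; exact: gen1.
case: (ex_minnP ex) => n /asboolP [x0 Hx0 En] Hmin.
have {}Hmin x : generated I x -> (len (x0 * w) <= len (x * w))%N.
  by move=> Hx; rewrite En; apply: Hmin; apply/asboolP; exists x.
exists x0^-1, (x0 * w); split; [exact: genV| |by rewrite mulKg].
move Ev : (x0 * w) => v x /(gen_redword IS) [l [H1 <- _]].
elim: l H1 => [|s l IH]; first by rewrite wprod_nil mul1g len1.
move=> /word_cons [Is Il]; rewrite wprod_cons.
have Ss := IS _ Is; have Sl : word S l := word_sub IS Il.
have {IH}E := IH Il; have Gl := gen_wprod Il.
have [h1 h2 _] := redwordP v.
case: (len_S1 (wprod l * v) Ss); rewrite -mulgA E => E1.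
  have := lenM (s * wprod l) v; rewrite -mulgA.
  by have := lenM s (wprod l); rewrite (len_S Ss); llia.
(* If the length drops, either [s] already shortens the factor in W_I and lengths still add, or a
   letter of [v] is deleted, giving an element of W_I w shorter than the chosen one. *)
case: (@exchange_mul s (wprod l) (redword S v) Ss h1); rewrite ?h2.
- by rewrite E; llia.
- by have := lenM (s * wprod l) v; have := len_S1 (wprod l) Ss; rewrite -mulgA; llia.
move=> [l1 [r [l2 [E2 E3]]]].
have Hl : word S (l1 ++ l2).
  by move: h1; rewrite E2 => /word_cat [? /word_cons [_ ?]]; apply/word_cat.
have E4 : wprod (l1 ++ l2) = (wprod l)^-1 * s * wprod l * x0 * w.
  by rewrite -[LHS](mulKg (wprod l)) -E3 -Ev !mulgA.
have := Hmin ((wprod l)^-1 * s * wprod l * x0).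
rewrite -E4; have /len_le := Hl.
rewrite Ev -[len v]/(size (redword S v)) E2 !size_cat /=.
suff : generated I ((wprod l)^-1 * s * wprod l * x0) by move=> H H1 /(_ H); llia.
by do !apply: genM => //; [apply: genV|apply: genS].
Qed.

Lemma lminP I v : I `<=` S -> (forall s, I s -> (len v < len (s * v))%N) -> lmin I v.
Proof.
move=> IS H; have [x [v0 [Hx Hv E]]] := parab_decomp v IS.
have [l [H1 H2 H3]] := gen_redword IS Hx.
case: l H1 H2 H3 => [|s l].
  by rewrite wprod_nil => _ E1 _; rewrite E -E1 mul1g.
move=> /word_cons [Is Il]; rewrite wprod_cons => Ex Hl.
have := H _ Is; rewrite E -Ex -!mulgA SKl; last exact: IS.
rewrite (Hv _ (gen_wprod Il)) mulgA Hv ?Ex // -Hl /=.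
by have := len_le (word_sub IS Il); llia.
Qed.

Lemma lminS I v s : I `<=` S -> lmin I v -> I s -> (len v < len (s * v))%N.
Proof. by move=> IS H Is; rewrite (H _ (genS Is)) (len_S (IS _ Is)); llia. Qed.

Lemma lmin_eq I x y v v' : generated I x -> generated I y -> lmin I v ->
  lmin I v' -> x * v = y * v' -> x = y /\ v = v'.
Proof.
move=> Hx Hy Hv Hv' E.
have E1 : v = (x^-1 * y) * v' by rewrite -mulgA -E mulKg.
have E2 : v' = (y^-1 * x) * v by rewrite -mulgA E mulKg.
have h1 : len v = (len (x^-1 * y)%g + len v')%N.
  by rewrite {1}E1 Hv' //; apply: genM => //; exact: genV.
have h2 : len v' = (len (y^-1 * x)%g + len v)%N.
  by rewrite {1}E2 Hv //; apply: genM => //; exact: genV.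
have /len_eq0 h3 : len (x^-1 * y) = 0%N by llia.
have E3 : y = x by rewrite -[y](mulVKg x) h3 mulg1.
by split=> //; rewrite E1 h3 mul1g.
Qed.

(** Every element of W_I is a prefix of [x]: when a reduced prefix grows by a letter [s], exchange
    for the descent [s] of [x] cannot delete a letter of the prefix, so it deletes one of the
    rest. *)
Lemma lfull_len I x y : I `<=` S -> lfull I x -> generated I y ->
  len x = (len y + len (y^-1 * x))%N.
Proof.
move=> IS Hx /(gen_redword IS) [l [H1 <- H3]].
have -> : len (wprod l) = size l by [].
elim: l H1 {H3} (esym H3) => [|s l IH]; first by rewrite wprod_nil invg1 mul1g.
move=> /word_cons [Is Il]; rewrite wprod_cons => E.
have Ss := IS _ Is; have Sl := word_sub IS Il.
have E1 : len (wprod l) = size l.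
  by have := len_le Sl; have := len_S1 (wprod l) Ss; rewrite /= in E; llia.
have {}IH := IH Il E1; set c := (wprod l)^-1 * x in IH.
have Ec : x = wprod l * c by rewrite mulVKg.
have [h1 h2 _] := redwordP c.
case: (@exchange_mul s (wprod l) (redword S c) Ss h1).
- by rewrite h2 -Ec; exact: Hx.
- by rewrite E E1 /=; llia.
move=> [l1 [r [l2 [E2 E3]]]].
rewrite h2 -Ec in E3.
have E4 : (s * wprod l)^-1 * x = wprod (l1 ++ l2).
  by rewrite invgM -mulgA (SinvE Ss) E3 mulKg.
have Hl : word S (l1 ++ l2).
  by move: h1; rewrite E2 => /word_cat [? /word_cons [_ ?]]; apply/word_cat.
have : (len x <= size (s :: l) + len ((s * wprod l)^-1 * x)%g)%N.
  by rewrite -{1}[x](mulVKg (s * wprod l)) -E; exact: lenM.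
have := len_le Hl; rewrite -E4 IH -[len c]/(size (redword S c)) E2 !size_cat /=.
by llia.
Qed.

Lemma lfull_len_mul I x y : I `<=` S -> lfull I x -> generated I y ->
  (len (y * x)%g + len y)%N = len x.
Proof.
by move=> IS Hx /genV Hy; rewrite (lfull_len IS Hx Hy) invgK lenV addnC.
Qed.

Lemma lfull_sub I J x : I `<=` J -> lfull J x -> lfull I x.
Proof. by move=> IJ H s /IJ /H. Qed.

Lemma lfull_mul I x y : I `<=` S -> lfull I x -> len (x * y) = (len x + len y)%N ->
  lfull I (x * y).
Proof.
move=> IS H E s Is; have := H s Is; have := lenM (s * x) y.
by rewrite -mulgA E; llia.
Qed.

(** By [lfull_len] the lengths in W_I are bounded by that of [x], which leaves finitely many words.
    This is how enlarged subsets are shown to be finitary. *)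
Lemma lmin_finite_full I x : I `<=` S -> finite_set I -> lfull I x ->
  finite_set (generated I).
Proof.
move=> IS fI Hx.
pose A n := [set y | exists l, [/\ word I l, wprod l = y & size l = n]].
have fA n : finite_set (A n).
  elim: n => [|n IH].
    apply: sub_finite_set (finite_set1 1) => y [l [_ <- /size0nil ->]].
    by rewrite wprod_nil.
  apply: sub_finite_set (finite_image2 (fun s y => s * y) fI IH) => y.
  move=> [[|s l] [// + <- [E]]] => /word_cons [Is Il].
  by exists s => //; exists (wprod l); [exists l|rewrite wprod_cons].
apply: sub_finite_set (bigcup_finite (finite_II (len x).+1) (fun n _ => fA n)).
move=> y Hy; have [l [H1 H2 H3]] := gen_redword IS Hy.
exists (len y); last by exists l.
by have := lfull_len IS Hx Hy; rewrite /mkset; llia.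
Qed.

Lemma fg_sub I J : I `<=` J -> is_finitary S J -> is_finitary S I.
Proof.
move=> IJ [JS fJ]; split; first exact: subset_trans JS.
exact: sub_finite_set (gen_mono IJ) fJ.
Qed.

Lemma fg_finite I : is_finitary S I -> finite_set I.
Proof. by move=> [_]; apply: sub_finite_set => s; exact: genS. Qed.

Lemma finite_longest (A : set W) : finite_set A -> A !=set0 ->
  exists x, A x /\ forall y, A y -> (len y <= len x)%N.
Proof.
move=> /finite_seqP [l ->] [x0 Hx0].
have {Hx0}: l <> [::] by move=> l0; rewrite /= l0 in Hx0.
elim: l => // a [|b l] IH _.
  by exists a; split=> [|y] /=; rewrite ?inE // => /eqP ->.
have [//|x [/= Hx Hm]] := IH.
case: (leqP (len x) (len a)) => H.
  exists a; split=> [|y] /=; first by rewrite inE eqxx.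
  by rewrite inE => /orP [/eqP -> //|/Hm /leq_trans ->].
exists x; split=> [|y] /=; first by rewrite inE Hx orbT.
by rewrite inE => /orP [/eqP ->|/Hm //]; exact: ltnW.
Qed.

Section Longest.
Variable I : set W.
Hypothesis fI : is_finitary S I.
Let IS : I `<=` S := proj1 fI.
Notation wI := (longest S I).

Lemma longest_spec : generated I wI /\ forall x, generated I x -> (len x <= len wI)%N.
Proof.
apply: (@xgetPex _ 1 [set w | generated I w /\
  forall x, generated I x -> (len x <= len w)%N]).
by apply: finite_longest; [exact: (proj2 fI)|exists 1; exact: gen1].
Qed.

Lemma longest_gen : generated I wI. Proof. by case: longest_spec. Qed.
Lemma longest_le x : generated I x -> (len x <= len wI)%N.
Proof. by case: longest_spec => _; apply. Qed.
Lemma longest_full : lfull I wI.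
Proof.
move=> s Is; have := longest_le (genM (genS Is) longest_gen).
by have := len_S1 wI (IS Is); llia.
Qed.
Lemma full_longest x : generated I x -> lfull I x -> x = wI.
Proof.
move=> Hx H; have := lfull_len IS H longest_gen.
have := longest_le Hx => h1 h2.
have /len_eq0 E : len (wI^-1 * x) = 0%N by llia.
by rewrite -[x](mulVKg wI) E mulg1.
Qed.
Lemma longestV : wI^-1 = wI.
Proof.
have := lfull_len IS longest_full (genV longest_gen); rewrite invgK lenV => h.
have /len_eq0 E : len (wI * wI) = 0%N by llia.
by rewrite -[LHS]mulg1 -E mulKg.
Qed.
Lemma longestK : wI * wI = 1.
Proof. by rewrite -{1}longestV mulVg. Qed.
Lemma longest_mul x : generated I x -> len wI = (len x + len (x * wI))%N.
Proof. by move=> /genV Hx; rewrite (lfull_len IS longest_full Hx) invgK lenV. Qed.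
Lemma longest_mulr x : generated I x -> len wI = (len x + len (wI * x))%N.
Proof.
by move=> Hx; rewrite -(lenV (wI * x)) invgM longestV -(lenV x) -longest_mul //;
   exact: genV.
Qed.
Lemma longestKl x : wI * (wI * x) = x.
Proof. by rewrite mulgA longestK mul1g. Qed.
Lemma longestKr x : x * wI * wI = x.
Proof. by rewrite -mulgA longestK mulg1. Qed.

Lemma wconjK : involutive (wconj S I).
Proof. by move=> x; rewrite /wconj !mulgA longestK mul1g longestKr. Qed.
Lemma wconjM x y : wconj S I (x * y) = wconj S I x * wconj S I y.
Proof. by rewrite /wconj !mulgA longestKr. Qed.
Lemma wconj_gen x : generated I x -> generated I (wconj S I x).
Proof. by move=> Hx; do !apply: genM => //; exact: longest_gen. Qed.
Lemma wconj_len x : generated I x -> len (wconj S I x) = len x.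
Proof.
move=> Hx; rewrite /wconj -mulgA.
have := longest_mul Hx; have := longest_mulr (genM Hx longest_gen).
by llia.
Qed.
Lemma wconj_S s : I s -> I (wconj S I s).
Proof.
move=> Is; have Hg := wconj_gen (genS Is).
have [l [H1 H2]] := gen_redword IS Hg.
rewrite wconj_len ?len_S; [|exact: IS|exact: genS].
case: l H1 H2 => [|r [|//]] // /word_cons [Ir _].
by rewrite wprod_cons wprod_nil mulg1 => <-.
Qed.
Lemma wconj_inj : injective (wconj S I).
Proof. exact: inv_inj wconjK. Qed.
Lemma lmin_longest v : lmin I v <-> len (wI * v) = (len wI + len v)%N.
Proof.
split=> [H|H x Hx]; first by rewrite H //; exact: longest_gen.
have := longest_mulr (genV Hx); rewrite lenV.
have := lenM (wI * x^-1) (x * v); rewrite !mulgA mulgVK H.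
by have := lenM x v; llia.
Qed.
End Longest.

Lemma rminP J v y : lmin J v^-1 -> generated J y ->
  len (v * y) = (len v + len y)%N.
Proof.
move=> H Hy; rewrite -(lenV (v * y)) invgM H; last exact: genV.
by rewrite !lenV addnC.
Qed.

(** Left factors from W_I and right factors from W_J shorten [x] and [y] by their full lengths. So x
    b = a^-1 y gives len y - len x = len a - len b, and a x = y b^-1 gives the opposite value. *)
Lemma full_factor_len I J x y a b : I `<=` S -> J `<=` S ->
  lfull I x -> lfull J x^-1 -> lfull I y -> lfull J y^-1 ->
  generated I a -> generated J b -> a * x * b = y -> len a = len b.
Proof.
move=> IS JS Ix Jx Iy Jy Ha Hb E.
have h1 := lfull_len_mul IS Ix Ha.
have h2 := lfull_len_mul IS Iy (genV Ha).
have h3 := lfull_len_mul JS Jx (genV Hb).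
have h4 := lfull_len_mul JS Jy Hb.
have E1 : a^-1 * y = x * b by rewrite -E -mulgA mulKg.
have E2 : b * y^-1 = (a * x)^-1 by rewrite -E !invgM mulVKg.
rewrite E1 in h2; rewrite E2 in h4; rewrite -invgM in h3.
rewrite !lenV in h2 h3 h4; llia.
Qed.

(* Exchange shortens the factors a and b of y = a x b simultaneously. *)
Lemma full_uniq I J x y : I `<=` S -> J `<=` S ->
  lfull I x -> lfull J x^-1 -> lfull I y -> lfull J y^-1 ->
  dcoset I x J y -> y = x.
Proof.
move=> IS JS Ix Jx Iy Jy [a Ha [b Hb]].
have fl := full_factor_len IS JS Ix Jx Iy Jy.
have [la [H1 <- H3]] := gen_redword IS Ha.
have [lb [H4 <- H6]] := gen_redword JS Hb.
elim: la lb {Ha Hb a b} H1 H3 H4 H6 => [|r la IH] lb Ha Ea Hb Eb E.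
  have := fl _ _ (gen_wprod Ha) (gen_wprod Hb) E.
  by rewrite -Ea -Eb -E => /esym /size0nil ->; rewrite !wprod_nil mul1g mulg1.
have Ga := gen_wprod Ha; have Gb := gen_wprod Hb.
have Eab := fl _ _ Ga Gb E.
move/word_cons: (Ha) => [Ir Hla].
have Sr := IS _ Ir.
have Hs : len (wprod la) = size la.
  have := len_le (word_sub IS Hla); have := len_S1 (wprod la) Sr.
  by rewrite wprod_cons /= in Ea; llia.
have hr : r * (wprod (r :: la) * x) = wprod la * x.
  by rewrite wprod_cons -!mulgA SKl.
case: (@exchange_mul r (wprod (r :: la) * x) lb Sr (word_sub JS Hb)).
- by rewrite E; exact: Iy.
- rewrite hr; have := lfull_len_mul IS Ix (gen_wprod Hla).
  by have := lfull_len_mul IS Ix Ga; rewrite -Ea /=; llia.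
move=> [l1 [r' [l2 [E1 E2]]]].
rewrite E in E2.
have Hl12 : word J (l1 ++ l2).
  by move: Hb; rewrite E1 => /word_cat [? /word_cons [_ ?]]; apply/word_cat.
have E3 : wprod la * x * wprod (l1 ++ l2) = y.
  by rewrite -[RHS](SKl _ Sr) E2 wprod_cons -!mulgA SKl.
apply: (IH (l1 ++ l2)) => //.
rewrite -(fl _ _ (gen_wprod Hla) (gen_wprod Hl12) E3) Hs.
by move: Eb; rewrite -Eab -Ea E1 !size_cat /= addnS => -[].
Qed.

(** * Core cosets *)

Definition conj_set w (J : set W) : set W := [set w * j * w^-1 | j in J].

Lemma conj_setV w I J : I = conj_set w J -> J = conj_set w^-1 I.
Proof.
move=> ->; apply/seteqP; split=> [j Jj|_ [_ [j Jj <-] <-]].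
  by exists (w * j * w^-1); [exists j|rewrite invgK !mulgA mulVg mul1g mulgVK].
by rewrite invgK !mulgA mulVg mul1g mulgVK.
Qed.

Lemma conj_setM w v I J K : I = conj_set w J -> J = conj_set v K ->
  I = conj_set (w * v) K.
Proof.
move=> -> ->; apply/seteqP; split=> [_ [_ [k Kk <-] <-]|_ [k Kk <-]].
  by exists k => //; rewrite invgM !mulgA.
exists (v * k * v^-1); first by exists k.
by rewrite invgM !mulgA.
Qed.

Lemma conj_gen w I J y : I = conj_set w J -> generated J y ->
  generated I (w * y * w^-1).
Proof.
move=> E; pose C := [set z | generated I (w * z * w^-1)].
apply: (@smallest_sub _ _ _ C); last first.
  by move=> j Jj; apply: genS; rewrite E; exists j.
split=> [|a b]; rewrite !inE /C /=; first by rewrite mulg1 mulgV; exact: gen1.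
move=> Ha Hb; have -> : w * (a * b^-1) * w^-1 = (w * a * w^-1) * (w * b * w^-1)^-1.
  by rewrite !invgM invgK !mulgA mulgVK.
by apply: genM => //; exact: genV.
Qed.

(** Conjugation by [w] turns words over [J] into words over [I] letter by letter. *)
Lemma conj_len_le w I J y : I `<=` S -> J `<=` S -> I = conj_set w J ->
  generated J y -> (len (w * y * w^-1) <= len y)%N.
Proof.
move=> IS JS E /(gen_redword JS) [l [H1 <- <-]].
suff [l' [H2 <- <-]] : exists l', [/\ word I l', wprod l' = w * wprod l * w^-1
  & size l' = size l] by apply: len_le; exact: word_sub IS _.
elim: l H1 => [|s l IH]; first by exists [::]; rewrite wprod_nil mulg1 mulgV.
move=> /word_cons [Js /IH [l' [H2 E2 E3]]].
exists (w * s * w^-1 :: l'); rewrite /= E3; split=> //.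
  by apply/word_cons; split=> //; rewrite E; exists s.
by rewrite !wprod_cons E2 !mulgA mulgVK.
Qed.

Lemma conj_len w I J y : I `<=` S -> J `<=` S -> I = conj_set w J ->
  generated J y -> len (w * y * w^-1) = len y.
Proof.
move=> IS JS E Hy; apply/eqP; rewrite eqn_leq (conj_len_le IS JS E) //=.
have := conj_len_le JS IS (conj_setV E) (conj_gen E Hy).
by rewrite invgK !mulgA mulVg mul1g mulgVK.
Qed.

Lemma conj_longest w I J : is_finitary S I -> is_finitary S J ->
  I = conj_set w J -> longest S I = w * longest S J * w^-1.
Proof.
move=> fI fJ E; have [IS _] := fI; have [JS _] := fJ.
apply/esym/full_longest => //; first by apply: (conj_gen E); exact: longest_gen.
move=> s; rewrite {1}E => -[j Jj <-].
have -> : w * j * w^-1 * (w * longest S J * w^-1) = w * (j * longest S J) * w^-1.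
  by rewrite !mulgA mulgVK.
rewrite !(conj_len IS JS E) //; first exact: longest_full.
- exact: longest_gen.
by apply: genM; [exact: genS|exact: longest_gen].
Qed.

(* The minimal elements of the core (I, J)-cosets. *)
Definition iscore I J w := I = conj_set w J /\ lmin I w.

Lemma iscore1 I : iscore I I 1.
Proof.
split; last exact: lmin1.
apply/seteqP; split=> [i Ii|_ [i Ii <-]]; rewrite ?mul1g ?invg1 ?mulg1 //.
by exists i => //; rewrite mul1g invg1 mulg1.
Qed.

Lemma iscoreV I J w : I `<=` S -> J `<=` S -> iscore I J w -> iscore J I w^-1.
Proof.
move=> IS JS [E H]; split; first exact: conj_setV.
move=> y Hy; have Hc := conj_gen E (genV Hy).
rewrite -(lenV (y * _)) invgM invgK.
have -> : w * y^-1 = w * y^-1 * w^-1 * w by rewrite mulgVK.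
by rewrite H // (conj_len IS JS E) ?lenV //; exact: genV.
Qed.

Section CorePeel.
Variables I K : set W.
Hypotheses (fI : is_finitary S I) (fK : is_finitary S K).
Let IS : I `<=` S := proj1 fI.
Let KS : K `<=` S := proj1 fK.

Lemma iscore_longest w : iscore I K w -> longest S I * w = w * longest S K.
Proof. by case=> E _; rewrite (conj_longest fI fK E) mulgVK. Qed.

Lemma iscore_full w : iscore I K w ->
  [/\ len (longest S I * w) = (len (longest S I) + len w)%N,
      lfull I (longest S I * w) & lfull K (longest S I * w)^-1].
Proof.
move=> c; have [E H] := c.
have El := H _ (longest_gen fI); split=> //.
  by apply: lfull_mul => //; exact: longest_full.
have [_ H'] := iscoreV IS KS c.
rewrite (iscore_longest c) invgM (longestV fK).
apply: lfull_mul => //; first exact: longest_full.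
by apply: H'; exact: longest_gen.
Qed.

(** Since w_I w = w w_K with additive lengths, all of M consists of left descents of w_I w. So W_M
    is finite, w_I w begins with w_M, and the rest is core for the conjugate subset. M = Is splits
    off an atom, M = Ist a whole braid word. *)
Lemma core_peel M w : iscore I K w -> I `<=` M -> M `<=` S -> finite_set M ->
  (forall s, M s -> ~ I s -> (len (s * w) < len w)%N) ->
  is_finitary S M /\ exists v, [/\ w = longest S I * longest S M * v, lmin M v &
    iscore (wconj S M @` I) K v].
Proof.
move=> c IM MS finM Hd; have [E H] := c.
have [h1 h2 h3] := iscore_full c.
have [_ H'] := iscoreV IS KS c.
have h4 : len (w * longest S K) = (len w + len (longest S K))%N.
  by apply: rminP H' _; exact: longest_gen.
have fullM : lfull M (longest S I * w).
  move=> s Ms; case: (pselect (I s)) => Is; first exact: h2.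
  rewrite (iscore_longest c) h4 mulgA; have := lenM (s * w) (longest S K).
  by have := Hd _ Ms Is; llia.
have fM : is_finitary S M.
  by split=> //; exact: lmin_finite_full fullM.
split=> //; exists (longest S M * (longest S I * w)).
have mM : lmin M (longest S M * (longest S I * w)).
  apply/lmin_longest => //; rewrite longestKl // -{2}(longestV fM).
  by apply: (lfull_len MS fullM); exact: longest_gen.
split=> //.
  by rewrite -!mulgA longestKl // longestKl.
have S1 : wconj S M @` I `<=` M by move=> _ [i Ii <-]; apply: wconj_S => //; exact: IM.
split; last exact: lmin_sub mM.
have -> : wconj S M @` I = conj_set (longest S M) I.
  by apply: eq_imagel => i _; rewrite /wconj longestV.
apply: (conj_setM erefl); apply: conj_setM E.
apply/seteqP; split=> [i Ii|_ [i Ii <-]]; last first.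
  by rewrite longestV //; exact: (wconj_S fI).
by exists (wconj S I i); [exact: wconj_S|rewrite longestV // -/(wconj S I _) wconjK].
Qed.

(** The converse of [core_peel]: w_I w_M conjugates w_M I w_M to [I], and minimality of [v] for [M]
    makes the lengths add. *)
Lemma core_up M v : is_finitary S M -> I `<=` M -> lmin M v ->
  iscore (wconj S M @` I) K v ->
  iscore I K (longest S I * longest S M * v) /\
  len (longest S I * longest S M * v) =
    (len (longest S I * longest S M) + len v)%N.
Proof.
move=> fM IM Hv [E _].
have gI := gen_mono IM (longest_gen fI).
have El : len (longest S I * longest S M * v) =
    (len (longest S I * longest S M) + len v)%N.
  by apply: Hv; apply: genM => //; exact: longest_gen.
split=> //; split.
  apply: conj_setM E.
  have -> : wconj S M @` I = conj_set (longest S M) I.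
    by apply: eq_imagel => i _; rewrite /wconj longestV.
  apply: (@conj_setM _ _ _ I).
    apply/seteqP; split=> [i Ii|_ [i Ii <-]]; last first.
      by rewrite longestV //; exact: (wconj_S fI).
    by exists (wconj S I i); [exact: wconj_S|rewrite longestV // -/(wconj S I _) wconjK].
  by rewrite -{1}(longestV fM); exact: (conj_setV erefl).
apply/(lmin_longest fI); rewrite !mulgA longestK // mul1g.
rewrite (Hv _ (longest_gen fM)).
by rewrite El (longest_mul fM gI) addnA.
Qed.
End CorePeel.

Lemma dcoset_refl I w J : dcoset I w J w.
Proof. by exists 1; [exact: gen1|exists 1; [exact: gen1|rewrite mul1g mulg1]]. Qed.

Lemma dcoset_mul I w J a b : generated I a -> generated J b ->
  dcoset I w J (a * w * b).
Proof. by move=> Ha Hb; exists a => //; exists b. Qed.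

Lemma dcoset_sub I w J x : dcoset I w J x -> dcoset I x J `<=` dcoset I w J.
Proof.
move=> [a Ha [b Hb <-]] _ [c Hc [d Hd <-]].
have -> : c * (a * w * b) * d = (c * a) * w * (b * d) by rewrite !mulgA.
by apply: dcoset_mul; exact: genM.
Qed.

Lemma dcoset_eq I w J x : dcoset I w J x -> dcoset I x J = dcoset I w J.
Proof.
move=> H; apply/seteqP; split; apply: dcoset_sub => //.
move: H => [a Ha [b Hb <-]].
have {2}-> : w = a^-1 * (a * w * b) * b^-1 by rewrite !mulgA mulVg mul1g mulgK.
by apply: dcoset_mul; exact: genV.
Qed.

(** The Bruhat order enters only through this strict monotonicity and, by the next two lemmas,
    through multiplication by a single generator. *)
Lemma bruhat_len x y : bruhat S x y -> x = y \/ (len x < len y)%N.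
Proof.
elim=> [z|z1 y1 w s Ss _ [->|IH] H]; [by left|by right|right].
exact: ltn_trans IH H.
Qed.

Lemma bruhat_left s y : S s -> (len y < len (s * y))%N -> bruhat S y (s * y).
Proof.
move=> Ss H; have E : s * y = y * (y^-1 * s * y^-1^-1).
  by rewrite invgK !mulgA mulgV mul1g.
by rewrite E; apply: bruhat_step; [|exact: bruhat_refl|rewrite -E].
Qed.

Lemma bruhat_right s y : S s -> (len y < len (y * s))%N -> bruhat S y (y * s).
Proof.
move=> Ss H; have E : y * s = y * (1 * s * 1^-1) by rewrite mul1g invg1 mulg1.
by rewrite E; apply: bruhat_step; [|exact: bruhat_refl|rewrite -E].
Qed.

Section Cosets.
Variables I J : set W.
Hypotheses (fI : is_finitary S I) (fJ : is_finitary S J).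
Let IS : I `<=` S := proj1 fI.
Let JS : J `<=` S := proj1 fJ.

Lemma dcoset_finite w : finite_set (dcoset I w J).
Proof. exact: finite_image2 (proj2 fI) (proj2 fJ). Qed.

Lemma maximal_full w x : dcoset I w J x ->
  (forall y, dcoset I w J y -> bruhat S x y -> y = x) ->
  lfull I x /\ lfull J x^-1.
Proof.
move=> Hx Hm; split=> s Hs.
  have Ss := IS Hs; case: (len_S1 x Ss) => E; last by rewrite E.
  case: (@len_neq s x Ss); rewrite (Hm (s * x)) //; last first.
    by apply: bruhat_left => //; rewrite E.
  apply: (dcoset_sub Hx); rewrite -[s * x]mulg1.
  by apply: dcoset_mul; [exact: genS|exact: gen1].
have Ss := JS Hs; case: (len_S1 x^-1 Ss) => E; last by rewrite E.
have E2 : len (x * s) = (len x).+1.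
  by rewrite -(lenV (x * s)) invgM (SinvE Ss) E lenV.
have : x * s = x.
  apply: Hm; last by apply: bruhat_right => //; rewrite E2.
  apply: (dcoset_sub Hx); rewrite -[x * s]mul1g mulgA.
  by apply: dcoset_mul; [exact: gen1|exact: genS].
by move=> E3; rewrite E3 in E2; llia.
Qed.

Lemma longer_maximal (p : set W) x : (forall y, p y -> (len y <= len x)%N) ->
  forall y, p y -> bruhat S x y -> y = x.
Proof.
by move=> Hm y Hy /bruhat_len [//|]; have := Hm y Hy; llia.
Qed.

(** The finite double coset has a longest element; longest implies maximal, maximal implies full on
    both sides, and [full_uniq] leaves only [x]. This resolves the choice in [maxel]. *)
Lemma maxel_full x : lfull I x -> lfull J x^-1 -> maxel S (dcoset I x J) = x.
Proof.
move=> Ix Jx; apply: xget_unique; last first.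
  move=> y [Hy /(maximal_full Hy) [Iy Jy]].
  exact: full_uniq IS JS Ix Jx Iy Jy Hy.
split; first exact: dcoset_refl.
apply: longer_maximal => y Hy.
have [|z [Hz Hm]] := finite_longest (dcoset_finite x).
  by exists x; exact: dcoset_refl.
have [Iz Jz] := maximal_full Hz (longer_maximal Hm).
by rewrite -(full_uniq IS JS Ix Jx Iz Jz Hz); exact: Hm.
Qed.

Lemma core_dcoset w y : iscore I J w -> dcoset I w J y ->
  exists2 a, generated I a & y = a * w.
Proof.
move=> [E _] [a Ha [b Hb <-]]; exists (a * (w * b * w^-1)).
  by apply: genM => //; exact: conj_gen E Hb.
by rewrite !mulgA mulgVK.
Qed.

Lemma minel_min w : dcoset I w J (minel S (dcoset I w J)) /\
  lmin I (minel S (dcoset I w J)).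
Proof.
set p := dcoset I w J; set P := [set x | p x /\ forall y, p y -> bruhat S y x -> y = x].
have [Hm Hu] : P (minel S p).
  apply: xgetPex.
  have ex : exists n, `[< exists2 x, p x & len x = n >].
    by exists (len w); apply/asboolP; exists w => //; exact: dcoset_refl.
  case: (ex_minnP ex) => n /asboolP [x Hx En] Hmin; exists x; split=> // y Hy.
  move=> /bruhat_len [//|]; have : (n <= len y)%N.
    by apply: Hmin; apply/asboolP; exists y.
  by rewrite -En; llia.
split=> //; apply: lminP => // s Is; have Ss := IS Is.
case: (len_S1 (minel S p) Ss) => E; first by rewrite E.
have : s * minel S p = minel S p.
  apply: Hu; last first.
    by rewrite -[X in bruhat _ _ X](SKl _ Ss); apply: bruhat_left; rewrite // SKl ?E.
  apply: (dcoset_sub Hm); rewrite -[s * _]mulg1.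
  by apply: dcoset_mul; [exact: genS|exact: gen1].
by move/(congr1 len)/(len_neq Ss).
Qed.

Lemma minel_core w : iscore I J w -> minel S (dcoset I w J) = w.
Proof.
move=> c; have [H1 H2] := minel_min w; have [E H3] := c.
have [a Ha Ea] := core_dcoset c H1.
have := @lmin_eq I 1 a _ _ (@gen1 I) Ha H2 H3.
by rewrite mul1g => /(_ Ea) [].
Qed.

Lemma coreP p : core S I J p <->
  iscore I J (minel S p) /\ p = dcoset I (minel S p) J.
Proof.
split=> [[[w ->] E]|[c E]].
  have [H1 H2] := minel_min w; split; first by split.
  exact/esym/dcoset_eq.
by split; [exists (minel S p)|case: c].
Qed.

Lemma iscore_coset w : iscore I J w -> core S I J (dcoset I w J).
Proof. by move=> c; apply/coreP; rewrite minel_core. Qed.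
End Cosets.

(** [dmul] runs along a chosen reduced word, so it is not enough that some reduced word of [y] lies
    over [J]. Exchange against such a word puts the first letter of the chosen one into W_J, hence
    into [J]. *)
Lemma redword_over J y : J `<=` S -> generated J y -> word J (redword S y).
Proof.
move=> JS Hy.
have : size (redword S y) = len (wprod (redword S y)).
  by have [_ -> _] := redwordP y.
have : generated J (wprod (redword S y)) by have [_ -> _] := redwordP y.
have [h _ _] := redwordP y; move: (redword S y) h => l {y Hy}.
elim: l => // s l IH /word_cons [Ss Sl]; rewrite wprod_cons => Hg Es.
have El : size l = len (wprod l).
  by have := len_le Sl; have := len_S1 (wprod l) Ss; rewrite /= in Es; llia.
have [l0 [h1 h2 h3]] := gen_redword JS Hg.
have : (len (s * wprod l0) < len (wprod l0))%N by rewrite h2 SKl // -Es /= El.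
move=> /(exchange Ss (word_sub JS h1)) [l1 [r [l2 [E1 E2]]]].
have Gl : generated J (wprod l).
  rewrite -(SKl (wprod l) Ss) -h2 E2; apply: gen_wprod.
  by move: h1; rewrite E1 => /word_cat [? /word_cons [_ ?]]; apply/word_cat.
apply/word_cons; split; last exact: IH.
apply: len_sub_S Ss => //; have -> : s = (s * wprod l) * (wprod l)^-1 by rewrite mulgK.
by apply: genM => //; exact: genV.
Qed.

Lemma dmul_in K x y : K `<=` S -> generated K y ->
  exists2 b, generated K b & dmul S x y = x * b.
Proof.
move=> KS /(redword_over KS); rewrite /dmul.
elim: (redword S y) x => [|s l IH] x; first by exists 1; rewrite ?mulg1 //; exact: gen1.
move=> /word_cons [Ks Kl]; have [b Hb E] := IH (dmul1 S x s) Kl; rewrite /= E.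
rewrite /dmul1; case: ifP => _; last by exists b.
by exists (s * b); rewrite ?mulgA //; apply: genM => //; exact: genS.
Qed.

Lemma dmul_full J x y : J `<=` S -> lfull J x^-1 -> generated J y ->
  dmul S x y = x.
Proof.
move=> JS Jx /(redword_over JS); rewrite /dmul.
elim: (redword S y) => [|s l IH] // /word_cons [Js Jl] /=.
rewrite /dmul1 ifN ?IH // -leqNgt ltnW //.
by have := Jx _ Js; rewrite lenV -(lenV (x * s)) invgM (SinvE (JS _ Js)).
Qed.

(** * Length additivity along an expression *)

Definition gst (J K : set W) : W := longest S J * longest S (J `|` K).
(** A step up from J to K contributes w_J w_K, a step down contributes 1. For a reduced expression
    from I, w_I times this product is the maximal element of the coset expressed. *)
Fixpoint gprod (J : set W) (l : seq (set W)) : W :=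
  if l is K :: l' then gst J K * gprod K l' else 1.
Fixpoint glen (J : set W) (l : seq (set W)) : nat :=
  if l is K :: l' then (len (gst J K) + glen K l')%N else 0%N.
(** A criterion for reducedness that looks at the tails of an expression, as the action on Z[W]
    does, whereas [reduced] reads prefixes. *)
Fixpoint gmin (J : set W) (l : seq (set W)) : Prop :=
  if l is K :: l' then lmin (J `|` K) (gprod K l') /\ gmin K l' else True.
Fixpoint chain (J : set W) (l : seq (set W)) : Prop :=
  if l is K :: l' then [/\ adjacent J K, is_finitary S K & chain K l'] else True.

Lemma len_gprod J (l : seq (set W)) : (len (gprod J l) <= glen J l)%N.
Proof.
elim: l J => [|K l IH] J /=; first by rewrite len1.
by apply: leq_trans (lenM _ _) _; rewrite leq_add2l.
Qed.

Lemma adjacentU J K : adjacent J K ->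
  (J `<=` K /\ J `|` K = K) \/ (K `<=` J /\ J `|` K = J).
Proof.
case=> s [[nJ ->]|[Js ->]]; [left|right].
  by split=> [x|]; [right|apply/setUidr => x; right].
by split=> [x []|]; [|apply/setUidl => x []].
Qed.

Lemma gst_gen J K : is_finitary S (J `|` K) -> generated (J `|` K) (gst J K) /\
  len (longest S (J `|` K)) = (len (longest S J) + len (gst J K))%N.
Proof.
move=> fM; have fJ : is_finitary S J := fg_sub (@subsetUl _ J K) fM.
have gJ := gen_mono (@subsetUl _ J K) (longest_gen fJ).
split; first by apply: genM => //; exact: longest_gen.
exact: longest_mul.
Qed.

(** As [x] ends with w_J, the product x w_J w_(J u K) ends with w_(J u K); thus the invariant on
    right descents passes to the next subset. *)
Lemma gst_full J K x : is_finitary S (J `|` K) -> lfull J x^-1 ->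
  len (x * gst J K) = (len x + len (gst J K))%N ->
  lfull (J `|` K) (x * gst J K)^-1.
Proof.
move=> fM Jx E; have fJ : is_finitary S J := fg_sub (@subsetUl _ J K) fM.
have [_ El] := gst_gen fM.
have h := lfull_len_mul (proj1 fJ) Jx (longest_gen fJ).
have E1 : (x * gst J K)^-1 = longest S (J `|` K) * (longest S J * x^-1).
  by rewrite /gst !invgM (longestV fM) (longestV fJ) !mulgA.
rewrite E1; apply: lfull_mul; [exact: (proj1 fM)|exact: longest_full|].
by rewrite -E1 lenV; rewrite lenV in h; llia.
Qed.

(** Since [x] ends with w_M, additivity for [x * v] restricts to additivity for w_M v. *)
Lemma full_additive_lmin M x v : is_finitary S M -> lfull M x^-1 ->
  len (x * v) = (len x + len v)%N -> lmin M v.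
Proof.
move=> fM Mx E; apply/lmin_longest => //.
have h := lfull_len_mul (proj1 fM) Mx (longest_gen fM).
have := lenM (longest S M) v.
have := lenM (x * longest S M) (longest S M * v).
rewrite !mulgA longestKr // E -(lenV (x * _)) invgM longestV //.
by rewrite lenV in h; llia.
Qed.

Lemma gmin_additive J (l : seq (set W)) : is_finitary S J -> chain J l -> gmin J l ->
  len (gprod J l) = glen J l /\ lmin J (gprod J l).
Proof.
elim: l J => [|K l IH] J fJ /=; first by rewrite len1; split=> //; exact: lmin1.
move=> [aJK fK ch] [Hm /(IH _ fK ch) [E _]].
have fM : is_finitary S (J `|` K) by case: (adjacentU aJK) => -[_ ->].
have [Hg El] := gst_gen fM.
split; first by rewrite Hm // E.
apply/(lmin_longest fJ); rewrite (Hm _ Hg) /gst !mulgA longestK // mul1g.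
by rewrite (Hm _ (longest_gen fM)) El addnA.
Qed.

(** A product is never longer than the sum of the lengths, so equality for the whole expression
    forces equality at every step. *)
Lemma additive_gmin J (l : seq (set W)) x : is_finitary S J -> chain J l -> lfull J x^-1 ->
  len (x * gprod J l) = (len x + glen J l)%N -> gmin J l.
Proof.
elim: l J x => [|K l IH] J x fJ //= [aJK fK ch] Jx.
have fM : is_finitary S (J `|` K) by case: (adjacentU aJK) => -[_ ->].
rewrite (mulgA x (gst J K)) => E; have := lenM (x * gst J K) (gprod K l).
have := lenM x (gst J K); have := len_gprod K l => h1 h2 h3.
have E1 : len (x * gst J K) = (len x + len (gst J K))%N by llia.
have F := gst_full fM Jx E1.
split; first by apply: full_additive_lmin fM F _; llia.
apply: IH (x * gst J K) fK ch _ _; last by llia.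
exact: lfull_sub (@subsetUr _ J K) F.
Qed.

(** * Reduced expressions *)

Section Expressed.
Variable I0 : set W.
Hypothesis fI0 : is_finitary S I0.

Lemma maxel_union J K : adjacent J K -> is_finitary S J -> is_finitary S K ->
  maxel S (dcoset J 1 K) = longest S (J `|` K).
Proof.
move=> aJK fJ fK.
have fM : is_finitary S (J `|` K) by case: (adjacentU aJK) => -[_ ->].
have <- : dcoset J (longest S (J `|` K)) K = dcoset J 1 K.
  apply: dcoset_eq; case: (adjacentU aJK) => -[_ ->].
    by rewrite -[longest S K]mul1g -[1 in X in _ X]mulg1;
       apply: dcoset_mul; [exact: gen1|exact: longest_gen].
  rewrite -[longest S J]mulg1 -[X in X * 1]mulg1.
  by apply: dcoset_mul; [exact: longest_gen|exact: gen1].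
apply: maxel_full => //; first exact: lfull_sub (@subsetUl _ J K) (longest_full fM).
by rewrite longestV //; exact: lfull_sub (@subsetUr _ J K) (longest_full fM).
Qed.

(** In a step down, [x] absorbs w_J in the Coxeter monoid; in a step up, the monoid product only
    adds a right factor from W_K. This holds for reduced and non-reduced steps alike. *)
Lemma step_comp J K x : adjacent J K -> is_finitary S J -> is_finitary S K ->
  lfull I0 x -> lfull J x^-1 ->
  coset_comp S I0 K (dcoset I0 x J) (dcoset J 1 K) = dcoset I0 x K.
Proof.
move=> aJK fJ fK Ix Jx; rewrite /coset_comp maxel_full // maxel_union //.
case: (adjacentU aJK) => -[JK ->]; last first.
  by rewrite (dmul_full (proj1 fJ) Jx) //; exact: longest_gen.
have [b Hb ->] := dmul_in x (proj1 fK) (longest_gen fK).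
apply: dcoset_eq; rewrite -[x in x * b]mul1g.
by apply: dcoset_mul => //; exact: gen1.
Qed.

Lemma step_reduced J K x : adjacent J K -> is_finitary S J -> is_finitary S K ->
  lfull I0 x -> lfull J x^-1 ->
  reduced_comp S J (dcoset I0 x J) (dcoset J 1 K) <->
  len (x * gst J K) = (len x + len (gst J K))%N.
Proof.
move=> aJK fJ fK Ix Jx; rewrite /reduced_comp maxel_full // maxel_union //.
have fM : is_finitary S (J `|` K) by case: (adjacentU aJK) => -[_ ->].
have [_ El] := gst_gen fM.
rewrite longestV // -mulgA -/(gst J K).
have h := lfull_len_mul (proj1 fJ) Jx (longest_gen fJ).
have -> : len (x * longest S J) = len (longest S J * x^-1).
  by rewrite -(lenV (x * _)) invgM longestV.
by rewrite lenV in h; split; llia.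
Qed.

Lemma dcoset_gst J K x : adjacent J K -> is_finitary S J -> is_finitary S K ->
  dcoset I0 (x * gst J K) K = dcoset I0 x K.
Proof.
move=> aJK fJ fK.
have fM : is_finitary S (J `|` K) by case: (adjacentU aJK) => -[_ ->].
have [Hg _] := gst_gen fM; apply: dcoset_eq.
rewrite -[x in x * _]mul1g; apply: dcoset_mul; first exact: gen1.
case: (adjacentU aJK) => -[_ E]; first by rewrite -{1}E.
by rewrite /gst E longestK //; exact: gen1.
Qed.

(** Here [x] is the maximal element of the coset read so far. One length equation replaces the list
    of conditions because a deficit at one step is never made up later. *)
Lemma reduced_fromP J (l : seq (set W)) x : chain J l -> is_finitary S J -> lfull I0 x ->
  lfull J x^-1 ->
  (reduced_from S I0 J (dcoset I0 x J) l <->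
    len (x * gprod J l) = (len x + glen J l)%N) /\
  (len (x * gprod J l) = (len x + glen J l)%N ->
    [/\ expressed_from S I0 J (dcoset I0 x J) l =
          dcoset I0 (x * gprod J l) (last J l),
        lfull I0 (x * gprod J l) & lfull (last J l) (x * gprod J l)^-1]).
Proof.
elim: l J x => [|K l IH] J x /=; first by rewrite mulg1 addn0.
move=> [aJK fK ch] fJ Ix Jx.
have fM : is_finitary S (J `|` K) by case: (adjacentU aJK) => -[_ ->].
have Hr := step_reduced aJK fJ fK Ix Jx.
rewrite (step_comp aJK fJ fK Ix Jx) -(dcoset_gst x aJK fJ fK) (mulgA x (gst J K)).
have := lenM (x * gst J K) (gprod K l).
have := lenM x (gst J K); have := len_gprod K l => h1 h2 h3.
case: (pselect (len (x * gst J K) = (len x + len (gst J K))%N)) => E1; last first.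
  by split; [split=> [[/Hr //]|]|]; llia.
have F := gst_full fM Jx E1.
have F2 := lfull_sub (@subsetUr _ J K) F.
have F1 : lfull I0 (x * gst J K) := lfull_mul (proj1 fI0) Ix E1.
have [H1 H2] := IH K (x * gst J K) ch fK F1 F2.
split; last by rewrite addnA -E1.
by rewrite addnA -E1; split=> [[_ /H1]|/H1] // H; split=> //; apply/Hr.
Qed.

Lemma reducedP (l : seq (set W)) : chain I0 l ->
  (reduced S (I0 :: l) <-> gmin I0 l) /\
  (gmin I0 l ->
    [/\ expressed S (I0 :: l) = dcoset I0 (longest S I0 * gprod I0 l) (last I0 l),
        lfull I0 (longest S I0 * gprod I0 l)
      & lfull (last I0 l) (longest S I0 * gprod I0 l)^-1]).
Proof.
have LF := longest_full fI0.
case: l => [|I1 l] ch /=.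
  split=> // _; rewrite mulg1; split; rewrite ?longestV //.
  by apply/esym/dcoset_eq; rewrite -[longest S I0]mulg1 -[X in X * 1]mulg1;
     apply: dcoset_mul; [exact: longest_gen|exact: gen1].
move: (ch) => /= [aJK fK ch'].
have fM : is_finitary S (I0 `|` I1) by case: (adjacentU aJK) => -[_ ->].
have E0 : longest S I0 * gst I0 I1 = longest S (I0 `|` I1).
  by rewrite /gst longestKl.
have [_ El] := gst_gen fM.
have F := longest_full fM.
have F1 := lfull_sub (@subsetUl _ I0 I1) F.
have F2 : lfull I1 (longest S (I0 `|` I1))^-1.
  by rewrite longestV //; exact: lfull_sub (@subsetUr _ I0 I1) F.
have ED : dcoset I0 (longest S (I0 `|` I1)) I1 = dcoset I0 1 I1.
  rewrite -E0 dcoset_gst //; apply: dcoset_eq.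
  rewrite -[longest S I0]mulg1 -[X in X * 1]mulg1.
  by apply: dcoset_mul; [exact: longest_gen|exact: gen1].
have [H1 H2] := reduced_fromP ch' fK F1 F2.
rewrite (mulgA _ (gst I0 I1)) E0 -ED.
have HH : len (longest S (I0 `|` I1) * gprod I1 l) =
    (len (longest S (I0 `|` I1)) + glen I1 l)%N <-> gmin I0 (I1 :: l).
  split=> H.
    apply: (@additive_gmin _ _ (longest S I0)) => //; first by rewrite longestV.
    by rewrite /= (mulgA _ (gst I0 I1)) E0 H El addnA.
  have [/= E /(_ _ (longest_gen fI0))] := gmin_additive fI0 ch H.
  by rewrite (mulgA _ (gst I0 I1)) E0 E El => ->; rewrite addnA.
split; first by split=> [/H1 /HH //|/HH /H1].
by move=> /HH /H2.
Qed.
End Expressed.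

(** The condition under which the expression does not kill [v] in Z[W]; [gmin] is the case v = 1. *)
Fixpoint gminv (J : set W) (l : seq (set W)) (v : W) : Prop :=
  if l is K :: l' then lmin (J `|` K) (gprod K l' * v) /\ gminv K l' v else True.

Lemma gminv1 J (l : seq (set W)) : gminv J l 1 <-> gmin J l.
Proof. by elim: l J => [|K l IH] J //=; rewrite mulg1 IH. Qed.

Lemma gminv_additive J (l : seq (set W)) v : is_finitary S J -> chain J l ->
  lmin (last J l) v -> gminv J l v ->
  len (gprod J l * v) = (glen J l + len v)%N /\ lmin J (gprod J l * v).
Proof.
elim: l J => [|K l IH] J fJ /=; first by rewrite mul1g.
move=> [aJK fK ch] Hv [Hm /(IH _ fK ch Hv) [E _]].
have fM : is_finitary S (J `|` K) by case: (adjacentU aJK) => -[_ ->].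
have [Hg El] := gst_gen fM.
rewrite -(mulgA (gst J K)).
split; first by rewrite Hm // E addnA.
apply/(lmin_longest fJ); rewrite (Hm _ Hg) /gst -(mulgA (longest S J)) longestKl //.
by rewrite (Hm _ (longest_gen fM)) El addnA.
Qed.

Lemma gprod_gen M J (l : seq (set W)) : is_finitary S M -> J `<=` M ->
  (forall K, K \in l -> K `<=` M) -> generated M (gprod J l).
Proof.
move=> fM; elim: l J => [|K l IH] J JM H /=; first exact: gen1.
have KM : K `<=` M by apply: H; rewrite inE eqxx.
have UM : J `|` K `<=` M by move=> x [/JM|/KM].
apply: genM.
  by apply: (gen_mono UM); case: (gst_gen (fg_sub UM fM)).
by apply: IH => // K' HK'; apply: H; rewrite inE HK' orbT.
Qed.

(** To the elements of W_M, a [v] minimal for [M] merely adds its length, so the conditions reduce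
    to those for v = 1. *)
Lemma gmin_gminv M J (l : seq (set W)) v : is_finitary S M -> J `<=` M ->
  (forall K, K \in l -> K `<=` M) -> gmin J l -> lmin M v -> gminv J l v.
Proof.
move=> fM JM H H1 Hv; elim: l J JM H H1 => [|K l IH] J JM H //= [Hm Hl].
have KM : K `<=` M by apply: H; rewrite inE eqxx.
have UM : J `|` K `<=` M by move=> x [/JM|/KM].
have lM K' : K' \in l -> K' `<=` M by move=> HK'; apply: H; rewrite inE HK' orbT.
have Hg := gprod_gen fM KM lM.
split; last exact: IH.
move=> x Hx; rewrite mulgA (Hv _ (genM (gen_mono UM Hx) Hg)).
by rewrite (Hm _ Hx) (Hv _ Hg) addnA.
Qed.

Lemma gprod_cat J (l l' : seq (set W)) :
  gprod J (l ++ l') = gprod J l * gprod (last J l) l'.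
Proof.
elim: l J => [|K l IH] J /=; first by rewrite mul1g.
by rewrite IH (mulgA (gst J K)).
Qed.

Lemma glen_cat J (l l' : seq (set W)) :
  glen J (l ++ l') = (glen J l + glen (last J l) l')%N.
Proof. by elim: l J => [|K l IH] J //=; rewrite IH addnA. Qed.

Lemma gminP J (l : seq (set W)) : is_finitary S J -> chain J l ->
  gmin J l <-> len (longest S J * gprod J l) = (len (longest S J) + glen J l)%N.
Proof.
move=> fJ ch; split=> [/(gmin_additive fJ ch) [<- H]|].
  by apply: H; exact: longest_gen.
apply: additive_gmin => //; rewrite longestV //; exact: longest_full.
Qed.

Lemma notin_len L s x : is_finitary S L -> S s -> ~ L s -> generated L x ->
  (len x < len (s * x))%N.
Proof.
move=> [LS _] Ss nLs Hx; case: (len_S1 x Ss) => E; first by rewrite E.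
have [l [h1 h2 h3]] := gen_redword LS Hx.
have : (len (s * wprod l) < len (wprod l))%N by rewrite h2 E.
move=> /(exchange Ss (word_sub LS h1)) [l1 [r [l2 [E1 E2]]]].
case: nLs; apply: len_sub_S Ss => //.
have -> : s = (s * x) * x^-1 by rewrite mulgK.
rewrite -h2 E2; apply: genM; last by rewrite h2; exact: genV.
apply: gen_wprod.
by move: h1; rewrite E1 => /word_cat [? /word_cons [_ ?]]; apply/word_cat.
Qed.

Lemma longest_lt L P s : is_finitary S P -> L `<=` P -> P s -> ~ L s ->
  (len (longest S L) < len (longest S P))%N.
Proof.
move=> fP LP Ps nLs; have fL := fg_sub LP fP; have gL := longest_gen fL.
apply: leq_trans (notin_len fL (proj1 fP _ Ps) nLs gL) _.
apply: longest_le => //; apply: genM; [exact: genS|exact: gen_mono gL].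
Qed.

(** * Rotation sequences *)

Section Rotation.
Variables (M : set W) (s t : W).
Hypotheses (fM : is_finitary S M) (Ms : M s) (Mt : M t) (Hst : wconj S M s <> t).
Let MS : M `<=` S := proj1 fM.

Notation r := (Defs.rot S M s t).
Notation u i := (r i).2.
Notation up i := (r i).1.
Notation L := (rotL S M s t).
Notation P := (rotP S M s t).

Lemma finP x : is_finitary S (M `\ x).
Proof. by apply: fg_sub fM => y []. Qed.

Lemma rotS i : r i.+1 = (u i, wconj S (P i) (up i)).
Proof. by rewrite /Defs.rot iterS. Qed.

Lemma rot_ok i : [/\ M (up i), M (u i) & up i <> u i].
Proof.
elim: i => [|i [h1 h2 h3]].
  split=> //; first exact: wconj_S.
  by move=> E; apply: Hst; have <- : wconj S M t = s := E; rewrite wconjK.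
rewrite rotS /=; have : P i (wconj S (P i) (up i)).
  by apply: (wconj_S (finP _)); split.
by case=> h4 h5; split=> // E; apply: h5; rewrite /= E.
Qed.

Lemma fP i : is_finitary S (P i). Proof. exact: finP. Qed.
Lemma fL i : is_finitary S (L i). Proof. by apply: fg_sub fM => y []. Qed.

Lemma P_L i : P i = up i |` L i.
Proof.
have [h1 h2 h3] := rot_ok i; apply/seteqP; split=> x.
  move=> [Mx xu]; case: (pselect (x = up i)) => [->|nx]; first by left.
  by right; split=> // -[].
by case=> [->|[Mx H]]; split=> // E; apply: H; left.
Qed.
Lemma P_LS i : P i = u i.+1 |` L i.+1.
Proof.
have [h1 h2 h3] := rot_ok i.+1; apply/seteqP; split=> x.
  move=> [Mx xu]; case: (pselect (x = u i.+1)) => [->|nx]; first by left.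
  by right; split=> // -[//|]; rewrite rotS.
case=> [->|[Mx H]]; split=> // E.
  by apply: h3; have -> : u i.+1 = u i := E; rewrite rotS.
by apply: H; right; rewrite rotS.
Qed.
Lemma L_P i : L i.+1 = P i `\ u i.+1.
Proof.
apply/seteqP; split=> x; rewrite /rotL /rotP [(r i.+1).1]/(u i).
  by move=> [Mx H]; split; [split=> // E; apply: H; right|move=> E; apply: H; left].
by move=> [[Mx H1] H2]; split=> // -[].
Qed.
Lemma nLup i : ~ L i (up i). Proof. by case=> _; apply; right. Qed.
Lemma nLu i : ~ L i (u i). Proof. by case=> _; apply; left. Qed.
Lemma LP_sub i : L i `<=` P i. Proof. by rewrite P_L => x; right. Qed.
Lemma LPS_sub i : L i.+1 `<=` P i. Proof. by rewrite P_LS => x; right. Qed.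
Lemma PM i : P i `<=` M. Proof. by move=> x []. Qed.
Lemma LM i : L i `<=` M. Proof. by move=> x []. Qed.
Lemma adjLP i : adjacent (L i) (P i).
Proof. by exists (up i); left; split; [exact: nLup|exact: P_L]. Qed.
Lemma adjPL i : adjacent (P i) (L i.+1).
Proof.
by exists (u i.+1); right; split; [rewrite P_LS; left|exact: L_P].
Qed.
Lemma gstPL i : gst (P i) (L i.+1) = 1.
Proof. by rewrite /gst setUidl ?longestK //; [exact: fP|exact: LPS_sub]. Qed.

(** The minimal element of the atom expressed by [L_i, P_i, L_{i+1}]. *)
Definition ra i := longest S (L i) * longest S (P i).
Lemma gstLP i : gst (L i) (P i) = ra i.
Proof. by rewrite /gst setUidr //; exact: LP_sub. Qed.

(** [rl k n] follows L_k and [sl k n] follows P_{k-1}: the same zigzag, read from a small set as a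
    string of atoms, or from a large one as in the switchback relation. *)
Definition rl k n := flatten [seq [:: P i; L i.+1] | i <- iota k n].
Definition sl k n := flatten [seq [:: L i; P i] | i <- iota k n].

Lemma rl_last k n : last (L k) (rl k n) = L (k + n)%N.
Proof.
elim: n k => [|n IH] k; first by rewrite addn0.
by rewrite /rl /= -/(rl k.+1 n) IH addSnnS.
Qed.
Lemma sl_last k n : last (P k) (sl k.+1 n) = P (k + n)%N.
Proof.
elim: n k => [|n IH] k; first by rewrite addn0.
by rewrite /sl /= -/(sl k.+2 n) IH addSnnS.
Qed.
Lemma rl_chain k n : chain (L k) (rl k n).
Proof.
elim: n k => [|n IH] k //=.
by split; [exact: adjLP|exact: fP|split; [exact: adjPL|exact: fL|exact: IH]].
Qed.
Lemma sl_chain k n : chain (P k) (sl k.+1 n).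
Proof.
elim: n k => [|n IH] k //=.
by split; [exact: adjPL|exact: fL|split; [exact: adjLP|exact: fP|exact: IH]].
Qed.

Lemma rot_exprE k : rot_expr S M s t k = L 0 :: rl 0 k.+1.
Proof.
rewrite /rot_expr; have -> : forall j n,
  rcons (flatten [seq [:: L i; P i] | i <- iota j n]) (L (j + n)%N) = L j :: rl j n.
  move=> j n; elim: n j => [|n IH] j; first by rewrite addn0.
  by rewrite /= addnS -addSn IH.
by [].
Qed.

Fixpoint rB n : W := if n is n'.+1 then rB n' * ra n' else 1.
Fixpoint rT n : nat := if n is n'.+1 then (rT n' + len (ra n'))%N else 0%N.

Lemma rl_S n : rl 0 n.+1 = rl 0 n ++ [:: P n; L n.+1].
Proof.
have E : iota 0 n.+1 = iota 0 n ++ [:: n] by rewrite -addn1 iotaD.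
by rewrite /rl E map_cat flatten_cat.
Qed.

Lemma rl_gprod n : gprod (L 0) (rl 0 n) = rB n.
Proof.
elim: n => // n IH; rewrite rl_S gprod_cat IH rl_last add0n /= gstLP gstPL.
by rewrite !mulg1.
Qed.
Lemma rl_glen n : glen (L 0) (rl 0 n) = rT n.
Proof.
elim: n => // n IH; rewrite rl_S glen_cat IH rl_last add0n /= gstLP gstPL.
by rewrite len1 !addn0.
Qed.

Notation w0 := (longest S (L 0)).
(** Reducedness of the first n atoms; [rot_expr] with index k has k + 1 atoms, whence the shift in
    [rredP]. *)
Definition rred n := len (w0 * rB n) = (len w0 + rT n)%N.

Lemma rredP k : reduced S (rot_expr S M s t k) <-> rred k.+1.
Proof.
have ch := rl_chain 0 k.+1.
rewrite rot_exprE (proj1 (reducedP (fL 0) ch)) (gminP (fL 0) ch).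
by rewrite rl_gprod rl_glen.
Qed.

Lemma len_rB n : (len (rB n) <= rT n)%N.
Proof. by rewrite -rl_gprod -rl_glen; exact: len_gprod. Qed.

Lemma rred_prev n : rred n.+1 -> rred n /\
  len (w0 * rB n * ra n) = (len (w0 * rB n) + len (ra n))%N.
Proof.
rewrite /rred /= (mulgA _ _ (ra n)) => E.
have := lenM (w0 * rB n) (ra n); have := lenM w0 (rB n); have := len_rB n.
by split; llia.
Qed.

Lemma rB_gen n : generated M (rB n).
Proof.
elim: n => [|n IH] /=; first exact: gen1.
apply: genM => //; apply: genM.
  exact: gen_mono (@LM n) _ (longest_gen (fL n)).
exact: gen_mono (@PM n) _ (longest_gen (fP n)).
Qed.

(** By the recursion, w_{P_n} exchanges u_{n-1} and u_{n+1}, hence their complements L_n and L_{n+1}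
    in P_n. *)
Lemma L_conj n : L n = conj_set (longest S (P n)) (L n.+1).
Proof.
have E : forall x, longest S (P n) * x * (longest S (P n))^-1 = wconj S (P n) x.
  by move=> x; rewrite longestV //; exact: fP.
have Eu : u n.+1 = wconj S (P n) (up n) by rewrite rotS.
apply/seteqP; split=> [x Lx|_ [x Lx <-]].
  exists (wconj S (P n) x); last by rewrite E wconjK //; exact: fP.
  rewrite L_P; split; first by apply: wconj_S; [exact: fP|exact: LP_sub].
  move=> Ex; apply: (@nLup n).
  by rewrite -(wconj_inj (fP n) (etrans Ex Eu)).
rewrite E; have : P n (wconj S (P n) x) by apply: wconj_S; [exact: fP|exact: LPS_sub].
rewrite {1}P_L => -[Ex|//]; case: (@nLu n.+1).
by rewrite Eu -Ex wconjK //; exact: fP.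
Qed.

Lemma longestL_conj n : longest S (L n) * longest S (P n) =
  longest S (P n) * longest S (L n.+1).
Proof.
rewrite (conj_longest (fL n) (fL n.+1) (L_conj n)) longestV; last exact: fP.
by rewrite -!mulgA longestK ?mulg1 //; exact: fP.
Qed.

Lemma L_conj_ra n : L n = conj_set (ra n) (L n.+1).
Proof.
rewrite {1}L_conj /ra; apply: conj_setM; last exact: L_conj.
have E : forall x, longest S (L n) * x * (longest S (L n))^-1 = wconj S (L n) x.
  by move=> x; rewrite longestV //; exact: fL.
rewrite -L_conj; apply/seteqP; split=> [x Lx|_ [x Lx <-]].
  exists (wconj S (L n) x); last by rewrite E wconjK //; exact: fL.
  by apply: wconj_S => //; exact: fL.
by rewrite E; apply: wconj_S => //; exact: fL.
Qed.

Lemma L_conj_rB n : L 0 = conj_set (rB n) (L n).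
Proof.
elim: n => [|n IH] /=; last exact: conj_setM IH (L_conj_ra n).
by have [] := iscore1 (L 0).
Qed.

Lemma rB_longest n : w0 * rB n = rB n * longest S (L n).
Proof. by rewrite (conj_longest (fL 0) (fL n) (L_conj_rB n)) mulgVK. Qed.

Lemma rred_core n : rred n -> iscore (L 0) (L n) (rB n) /\ len (rB n) = rT n.
Proof.
rewrite /rred => E; have := lenM w0 (rB n); have := len_rB n => h1 h2.
split; last by llia.
split; first exact: L_conj_rB.
by apply/(lmin_longest (fL 0)); llia.
Qed.

Lemma rred_full n : rred n -> lfull (L n) (w0 * rB n)^-1.
Proof.
move=> /rred_core [c _].
by have [_ _] := iscore_full (fL 0) (fL n) c.
Qed.

Lemma rred_fullP n : rred n.+1 -> lfull (P n) (w0 * rB n.+1)^-1.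
Proof.
move=> /rred_prev [h E].
have UE : L n `|` P n = P n by apply/setUidr; exact: LP_sub.
have := @gst_full (L n) (P n) (w0 * rB n).
by rewrite UE gstLP /= (mulgA _ _ (ra n)); apply=> //; [exact: fP|exact: rred_full].
Qed.

Lemma ra_len n : len (longest S (P n)) = (len (longest S (L n)) + len (ra n))%N.
Proof.
have := @gst_gen (L n) (P n); rewrite gstLP setUidr; last exact: LP_sub.
by move=> /(_ (fP n)) [].
Qed.

Lemma ra_pos n : (0 < len (ra n))%N.
Proof.
have [h1 h2 h3] := rot_ok n.
have Pu : P n (up n) by split.
by have := longest_lt (fP n) (@LP_sub n) Pu (@nLup n); rewrite ra_len; llia.
Qed.

Lemma w0_gen : generated M w0.
Proof. exact: gen_mono (@LM 0) _ (longest_gen (fL 0)). Qed.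

(** The right descents of w_{L_0} B_{n+1} contain P_n, all of M except perhaps u_n. If u_n is one
    too, the element is w_M. Otherwise the inverse of B_{n+1} is minimal for L_{n+1} and u_n, that
    is for P_{n+1}, and the next atom adds its length. *)
Lemma rred_step n : rred n.+1 -> w0 * rB n.+1 = longest S M \/ rred n.+2.
Proof.
move=> H; have Fz := rred_fullP H; have [c El] := rred_core H.
set z := w0 * rB n.+1 in Fz *.
have [h1 h2 h3] := rot_ok n.
have Su := MS h2.
have Hz : generated M z by apply: genM; [exact: w0_gen|exact: rB_gen].
have MP x : M x -> x = u n \/ P n x.
  by move=> Mx; case: (pselect (x = u n)) => [|nx]; [left|right; split].
case: (len_S1 z^-1 Su) => E; [right|left]; last first.
  apply: (can_inj (@invgK _)); rewrite (longestV fM).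
  apply: full_longest => //; first exact: genV.
  by move=> x /MP [->|/Fz //]; rewrite E.
have [_ Hmin] := iscoreV (proj1 (fL 0)) (proj1 (fL n.+1)) c.
have Bmin : lmin (P n.+1) (rB n.+1)^-1.
  apply: lminP; first exact: (proj1 (fP _)).
  move=> x; rewrite P_L => -[->|]; last exact: lminS (proj1 (fL _)) Hmin.
  rewrite rotS /=; case: (len_S1 (rB n.+1)^-1 Su) => E1; first by rewrite E1.
  have := lenM (u n * (rB n.+1)^-1) w0^-1.
  rewrite -mulgA -invgM -/z E lenV /z.
  by move: H; rewrite /rred => ->; rewrite !lenV in E1 *; llia.
have := rminP Bmin (longest_gen (fP n.+1)).
have -> : rB n.+1 * longest S (P n.+1) = w0 * rB n.+2.
  rewrite [in RHS]/= (mulgA _ (rB n.+1)) [w0 * rB n.+1]rB_longest /ra.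
  by rewrite -!mulgA longestKl //; exact: fL.
rewrite /rred => ->; rewrite ra_len El.
have := rB_longest n.+1 => /(congr1 len).
have := rminP Hmin (longest_gen (fL n.+1)) => ->.
by rewrite H El /=; llia.
Qed.

Lemma ra_gen n : generated M (ra n).
Proof.
apply: genM; [exact: gen_mono (@LM n) _ (longest_gen (fL n))|].
exact: gen_mono (@PM n) _ (longest_gen (fP n)).
Qed.

Lemma rred_stop n : w0 * rB n = longest S M -> rred n -> ~ rred n.+1.
Proof.
move=> E H; rewrite /rred /= (mulgA _ _ (ra n)) E => E2.
have := longest_le fM (genM (longest_gen fM) (ra_gen n)).
have := ra_pos n; move: H; rewrite /rred E; llia.
Qed.

Lemma rred1 : rred 1.
Proof.
rewrite /rred /= mul1g /ra longestKl; last exact: fL.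
by rewrite ra_len.
Qed.

Lemma rred_le n k : (n <= k)%N -> rred k -> rred n.
Proof.
elim: k => [|k IH]; first by rewrite leqn0 => /eqP ->.
by rewrite leq_eqVlt => /orP [/eqP -> //|H] /rred_prev [/(IH H)].
Qed.

Lemma rred_bound n : rred n -> (n <= len (longest S M))%N.
Proof.
move=> H; apply: leq_trans (longest_le fM (genM w0_gen (rB_gen n))).
rewrite H; apply: leq_trans (leq_addl _ _).
by elim: n {H} => //= n IH; have := ra_pos n; llia.
Qed.

Notation d := (rot_depth S M s t).

Lemma rot_depthP : rred d.+1 /\ w0 * rB d.+1 = longest S M.
Proof.
have Hd : rred d.+1 /\ forall k, rred k.+1 -> (k <= d)%N.
  have : [set k | reduced S (rot_expr S M s t k) /\
    forall k', reduced S (rot_expr S M s t k') -> (k' <= k)%N] d.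
    apply: xgetPex.
    (* The maximum defining the depth exists: one atom is reduced, and since atoms have positive
       length, the length of w_M bounds their number. *)
    have ex : exists k, `[< rred k.+1 >] by exists 0%N; apply/asboolP/rred1.
    have bd k : `[< rred k.+1 >] -> (k <= len (longest S M))%N.
      by move=> /asboolP /rred_bound; exact: ltnW.
    case: (ex_maxnP ex bd) => k /asboolP H1 H2; exists k; split; first exact/rredP.
    by move=> k' /rredP H; apply: H2; apply/asboolP.
  by case=> /rredP H1 H2; split=> // k /rredP /H2.
case: Hd => H1 H2; split=> //; case: (rred_step H1) => // /H2.
by rewrite ltnn.
Qed.

(** Nothing can be appended once w_M is reached, so reaching w_M pins down the depth; this computes
    the depth of the reversed sequence. *)
Lemma rot_depth_uniq k : rred k.+1 -> w0 * rB k.+1 = longest S M -> k = d.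
Proof.
move=> H1 H2; have [H3 H4] := rot_depthP.
case: (ltngtP k d) => // H.
  by case: (rred_stop H2 H1); exact: rred_le H3.
by case: (rred_stop H4 H3); exact: rred_le H1.
Qed.

Lemma rot_depth_pos : (0 < d)%N.
Proof.
case: posnP => // E; have [_] := rot_depthP; rewrite E /= mul1g /ra.
rewrite longestKl; last exact: fL.
move=> E2; have [h1 h2 h3] := rot_ok 0.
have nP : ~ P 0 (u 0) by case=> _; apply.
by have := longest_lt fM (@PM 0) h2 nP; rewrite E2 ltnn.
Qed.

Lemma rB_depth : rB d.+1 = w0 * longest S M.
Proof. by have [_ <-] := rot_depthP; rewrite longestKl //; exact: fL. Qed.

Lemma rot_end_L : L d.+1 = wconj S M @` L 0.
Proof.
have := L_conj_rB d.+1; rewrite rB_depth => /conj_setV.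
rewrite invgM (longestV fM) (longestV (fL 0)) => ->.
have E : L 0 = conj_set w0 (L 0).
  have F : forall x, w0 * x * w0^-1 = wconj S (L 0) x.
    by move=> x; rewrite longestV //; exact: fL.
  apply/seteqP; split=> [x Lx|_ [x Lx <-]]; last first.
    by rewrite F; apply: wconj_S => //; exact: fL.
  exists (wconj S (L 0) x); last by rewrite F wconjK //; exact: fL.
  by apply: wconj_S => //; exact: fL.
rewrite -(conj_setM erefl E); apply: eq_imagel => x _.
by rewrite /wconj longestV.
Qed.

Lemma wconjP_image x : M x -> wconj S M @` (M `\ x) = M `\ wconj S M x.
Proof.
move=> Mx; apply/seteqP; split=> [_ [y [My nyx] <-]|y [My ny]].
  split; first exact: wconj_S.
  by move=> /(wconj_inj fM).
exists (wconj S M y); last by rewrite wconjK.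
by split; [exact: wconj_S|move=> E; apply: ny; rewrite /= -E wconjK].
Qed.

Lemma longest_wconj K : is_finitary S K -> K `<=` M ->
  longest S (wconj S M @` K) = wconj S M (longest S K).
Proof.
move=> fK KM; have E : wconj S M @` K = conj_set (longest S M) K.
  by apply: eq_imagel => x _; rewrite /wconj longestV.
have fK' : is_finitary S (wconj S M @` K).
  by apply: fg_sub fM => _ [x Kx <-]; apply: wconj_S => //; exact: KM.
by rewrite (conj_longest fK' fK E) longestV.
Qed.

Lemma rot_tail k n : (len ((rB k)^-1 * rB (k + n)) + rT k <= rT (k + n))%N.
Proof.
elim: n => [|n IH]; first by rewrite addn0 mulVg len1.
rewrite addnS [rB _.+1]/= (mulgA _ (rB (k + n))).
by have := lenM ((rB k)^-1 * rB (k + n)) (ra (k + n)); rewrite /=; llia.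
Qed.

(** [rot_end_L] gives u_d and u_{d+1} only as an unordered pair; this excludes the wrong order. In
    that order P_d = w_M P_0 w_M, the last atom is a conjugate inverse of the first, and the d - 1
    middle atoms multiply to w_{L_1} w_M, which is as long as all d + 1 atoms together. *)
Lemma rot_end_neq : u d.+1 <> wconj S M (up 0).
Proof.
move=> E.
have [h1 h2 h3] := rot_ok d.+1; have [k1 k2 k3] := rot_ok 0.
have Eu : u d = wconj S M (u 0).
  have : L d.+1 (u d) -> False by case=> _; apply; right; rewrite rotS.
  rewrite rot_end_L => nL; have [_ Mu _] := rot_ok d.
  case: (pselect (u d = wconj S M (u 0))) => // n0; case: nL.
  exists (wconj S M (u d)); last by rewrite wconjK.
  split; first exact: wconj_S.
  case=> /(congr1 (wconj S M)); rewrite wconjK // => E2.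
  by apply: h3; rewrite E -E2 rotS.
have EP : P d = wconj S M @` P 0 by rewrite /rotP wconjP_image // -Eu.
have Ea : ra d = wconj S M (ra 0)^-1.
  rewrite /ra longestL_conj rot_end_L EP !longest_wconj //; first last.
  - exact: PM. - exact: fP. - exact: LM. - exact: fL.
  rewrite invgM (longestV (fP 0)) (longestV (fL 0)) -wconjM //.
have [R1 R2] := rot_depthP.
have dE : d = d.-1.+1 by rewrite prednK ?rot_depth_pos.
have E3 : (ra 0)^-1 * rB d = longest S (L 1) * longest S M.
  have : rB d = rB d.+1 * (ra d)^-1 by rewrite /= mulgK.
  rewrite rB_depth Ea (conj_longest (fL 0) (fL 1) (L_conj_ra 0)) => ->.
  move: (ra 0) => a; rewrite /wconj !invgM invgK (longestV fM) !mulgA mulVg mul1g.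
  by rewrite longestKr // mulgVK.
have E4 : len (longest S (L 1)) = len w0.
  by have := conj_len (proj1 (fL 0)) (proj1 (fL 1)) (L_conj_ra 0) (longest_gen (fL 1));
    rewrite -(conj_longest (fL 0) (fL 1) (L_conj_ra 0)).
have := rot_tail 1 d.-1; rewrite add1n -dE /= mul1g E3.
have := longest_mul fM (gen_mono (@LM 1) (longest_gen (fL 1))).
move: R1; rewrite /rred R2 /=; have := ra_pos 0; have := ra_pos d.
by rewrite E4; llia.
Qed.

Lemma rot_end : u d.+1 = wconj S M (u 0) /\ u d = wconj S M (up 0).
Proof.
have [h1 h2 h3] := rot_ok d.+1; have [k1 k2 k3] := rot_ok 0.
have nL x : M x -> ~ L d.+1 x -> x = wconj S M (u 0) \/ x = wconj S M (up 0).
  move=> Mx; rewrite rot_end_L => nL; apply: contrapT => /not_orP [n1 n2]; apply: nL.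
  exists (wconj S M x); last by rewrite wconjK.
  split; first exact: wconj_S.
  by case=> /(congr1 (wconj S M)); rewrite wconjK.
have E1 : u d.+1 = wconj S M (u 0).
  by case: (nL _ h2 (@nLu _)) => // /rot_end_neq.
have Eup : up d.+1 = u d by rewrite rotS.
split=> //; case: (nL _ h1 (@nLup _)) => E; last by rewrite -Eup.
by case: h3; rewrite E1.
Qed.

(** This makes the two sides of the switchback relation end at the same object: P_d is [M] without
    [t]. *)
Lemma rot_last : u d = t.
Proof. by have [_ ->] := rot_end; rewrite wconjK. Qed.

Lemma sl_gprod k n : gprod (P k) (sl k.+1 n) = (rB k.+1)^-1 * rB (k.+1 + n)%N.
Proof.
elim: n k => [|n IH] k; first by rewrite addn0 mulVg.
rewrite /sl /= -/(sl k.+2 n) IH gstPL gstLP mul1g [rB k.+2]/= addSnnS invgM.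
by rewrite !mulgA mulgV mul1g.
Qed.
Lemma sl_glen k n : (glen (P k) (sl k.+1 n) + rT k.+1)%N = rT (k.+1 + n)%N.
Proof.
elim: n k => [|n IH] k; first by rewrite addn0.
rewrite /sl [glen _ _]/= -/(sl k.+2 n) gstPL gstLP len1 -addSnnS -IH /=; llia.
Qed.

Lemma sl_gprod_depth : gprod (P 0) (sl 1 d) = longest S (P 0) * longest S M.
Proof.
rewrite sl_gprod add1n rB_depth /= mul1g /ra invgM (longestV (fL 0)).
by rewrite (longestV (fP 0)) -mulgA longestKl //; exact: fL.
Qed.

Lemma sl_gmin_depth : gmin (P 0) (sl 1 d).
Proof.
apply/(gminP (fP 0) (sl_chain 0 d)).
rewrite sl_gprod_depth longestKl; last exact: fP.
have [R1 R2] := rot_depthP; move: R1; rewrite /rred R2 => ->.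
by have := sl_glen 0 d; rewrite add1n ra_len [rT 1]/=; llia.
Qed.

(* Both sides of the switchback relation act in the same way on W. *)
Lemma switchback_gminv v : gminv (P 0) (sl 1 d) v /\ lmin (P d) v <-> lmin M v.
Proof.
split=> [[H Hv]|Hv].
  have [|E Hm] := gminv_additive (fP 0) (sl_chain 0 d) _ H.
    by rewrite sl_last.
  have := Hm _ (longest_gen (fP 0)); rewrite E sl_gprod_depth mulgA longestKl; last exact: fP.
  move=> Hl; apply/lmin_longest => //; rewrite Hl.
  move/gminP: sl_gmin_depth => /(_ (fP 0) (sl_chain 0 d)).
  by rewrite sl_gprod_depth longestKl; [llia|exact: fP].
split; last exact: lmin_sub (@PM d) Hv.
apply: gmin_gminv Hv => //; [exact: PM| |exact: sl_gmin_depth].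
move=> K /flattenP [_ /mapP [i _ ->]]; rewrite !inE => /orP [] /eqP ->; [exact: LM|exact: PM].
Qed.
End Rotation.

Section Reversal.
Variables (M : set W) (s t : W).
Hypotheses (fM : is_finitary S M) (Ms : M s) (Mt : M t) (Hst : wconj S M s <> t).

Notation r := (Defs.rot S M s t).
Notation d := (rot_depth S M s t).
Notation s' := (wconj S M t).
Notation t' := (wconj S M s).

Lemma rev_Hst : wconj S M s' <> t'.
Proof. by rewrite wconjK // => E; apply: Hst. Qed.

(** The sequence read backwards and conjugated by w_M obeys the same recursion, because conjugation
    by w_{P_j} is an involution; [rot_end] and [rot_last] match the initial values. *)
Lemma rot_rev i : (i <= d.+1)%N ->
  Defs.rot S M s' t' i =
  (wconj S M (r (d.+1 - i)%N).2, wconj S M (r (d.+1 - i)%N).1).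
Proof.
elim: i => [|i IH] Hi.
  have [-> Eu] := rot_end fM Ms Mt Hst.
  by rewrite subn0 rotS /= (rot_last fM Ms Mt Hst) wconjK.
rewrite rotS IH; last exact: ltnW.
have -> : (d.+1 - i = (d.+1 - i.+1).+1)%N by lia.
set j := (d.+1 - i.+1)%N; rewrite rotS /=; congr pair.
have [h1 h2 h3] := rot_ok fM Ms Mt Hst j.
have E : rotP S M s' t' i = wconj S M @` rotP S M s t j.
  rewrite wconjP_image // /rotP IH ?(ltnW Hi) //=.
  have -> : (d.+1 - i = j.+1)%N by rewrite /j; lia.
  by rewrite rotS.
rewrite E {1}/wconj longest_wconj //; [|exact: fP|exact: PM].
by rewrite -!wconjM // -/(wconj S (rotP S M s t j) _) wconjK //; exact: fP.
Qed.

Lemma rotL_rev i : (i <= d.+1)%N ->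
  rotL S M s' t' i = wconj S M @` rotL S M s t (d.+1 - i).
Proof.
move=> Hi; rewrite /rotL rot_rev //=; apply/seteqP; split=> [x [Mx H]|_ [x [Mx H] <-]].
  exists (wconj S M x); last by rewrite wconjK.
  split; first exact: wconj_S.
  by case=> E; apply: H; [right|left]; rewrite /= -E wconjK.
split; first exact: wconj_S.
by case=> /(wconj_inj fM) E; apply: H; [right|left].
Qed.

Lemma rotP_rev i : (i <= d)%N ->
  rotP S M s' t' i = wconj S M @` rotP S M s t (d - i).
Proof.
move=> Hi; have [h1 h2 h3] := rot_ok fM Ms Mt Hst (d - i).
rewrite /rotP rot_rev ?leqW //= wconjP_image //.
by have -> : (d.+1 - i = (d - i).+1)%N by lia; rewrite rotS.
Qed.

Lemma ra_rev i : (i <= d)%N -> ra M s' t' i = wconj S M (ra M s t (d - i))^-1.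
Proof.
move=> Hi; rewrite /ra rotL_rev ?leqW // rotP_rev //.
rewrite !longest_wconj //; do ?[exact: fL|exact: fP|exact: LM|exact: PM].
have -> : (d.+1 - i = (d - i).+1)%N by lia.
rewrite (longestL_conj fM Ms Mt Hst) invgM longestV ?longestV -?wconjM //.
  exact: fP. exact: fL.
Qed.

Lemma rB_rev k : (k <= d.+1)%N ->
  rB M s' t' k = wconj S M ((rB M s t d.+1)^-1 * rB M s t (d.+1 - k)) /\
  (rT M s' t' k + rT M s t (d.+1 - k))%N = rT M s t d.+1.
Proof.
elim: k => [|k IH] Hk.
  by rewrite subn0 mulVg /wconj mulg1 longestK.
have [E1 E2] := IH (ltnW Hk).
have Ek : (d.+1 - k = (d - k).+1)%N by lia.
rewrite Ek in E1 E2; rewrite /= E1 ra_rev // -wconjM // subSS; split.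
  by rewrite [rB M s t (d - k).+1]/= (mulgA _ (rB M s t (d - k))) mulgK.
have Hg : generated M (ra M s t (d - k)) by exact: ra_gen.
by rewrite wconj_len ?lenV //; [move: E2 => /=; llia|exact: genV].
Qed.

Lemma rot_depth_rev : rot_depth S M s' t' = d.
Proof.
have Ms' := wconj_S fM Mt; have Mt' := wconj_S fM Ms.
have [E1 E2] := rB_rev (leqnn d.+1); rewrite subnn mulg1 addn0 in E1 E2.
have E3 := rB_depth fM Ms Mt Hst.
have EL : rotL S M s' t' 0 = rotL S M s t 0.
  rewrite rotL_rev // subn0 rot_end_L // image_comp.
  rewrite (_ : wconj S M \o wconj S M = id) ?image_id //.
  by apply/funext => x /=; rewrite wconjK.
have f0 : is_finitary S (rotL S M s t 0) by exact: fL.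
have E4 : longest S (rotL S M s' t' 0) * rB M s' t' d.+1 = longest S M.
  rewrite E1 E3 EL invgM (longestV fM) (longestV f0) /wconj !mulgA.
  by rewrite longestKr // longestK // mul1g.
apply/esym/(rot_depth_uniq fM Ms' Mt' rev_Hst) => //.
rewrite /rred E4 EL E2.
by have [] := rot_depthP fM Ms Mt Hst; rewrite /rred => <- ->.
Qed.
End Reversal.

(** Reversal makes the atomic braid relation symmetric in [s] and [t], so that from here on only
    left sides need to be studied. *)
Lemma braid_rhsE M s t : is_finitary S M -> M s -> M t -> s <> t ->
  braid_rhs S M s t = braid_lhs S M t s.
Proof.
move=> fM Ms Mt Hst.
have Ms' := wconj_S fM Ms.
have H1 : wconj S M t <> wconj S M s by move=> /(wconj_inj fM) /esym.
have E := wconjK fM s.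
have D := rot_depth_rev fM Mt Ms' H1; rewrite E in D.
have RL := rotL_rev fM Mt Ms' H1; rewrite E in RL.
have RP := rotP_rev fM Mt Ms' H1; rewrite E in RP.
rewrite /braid_rhs /braid_lhs D.
move: (rot_depth S M t (wconj S M s)) RL RP {D} => d RL RP.
apply: (@eq_from_nth _ (set0, set0, set0)).
  by rewrite !size_map size_rev.
move=> i; rewrite size_map size_rev size_iota => Hi.
have Hi2 : (d.+1 - i.+1 < d.+1)%N by lia.
rewrite (nth_map 0%N) ?size_rev ?size_iota // nth_rev ?size_iota //.
rewrite (nth_map 0%N) ?size_iota // !nth_iota // !add0n.
rewrite RL ?(ltnW Hi) // RL // RP // subSS.
by have -> : (d.+1 - i = (d - i).+1)%N by lia.
Qed.

Lemma longest_inj I J : is_finitary S I -> is_finitary S J ->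
  longest S I = longest S J -> I = J.
Proof.
move=> fI fJ E.
have sub A B : is_finitary S A -> is_finitary S B ->
    longest S A = longest S B -> A `<=` B.
  move=> fA fB EAB s As; apply: contrapT => nBs.
  have := notin_len fB (proj1 fA _ As) nBs (longest_gen fB).
  by have := longest_full fA As; rewrite EAB; llia.
by apply/seteqP; split; apply: sub.
Qed.

Lemma setU1D s I : ~ I s -> (s |` I) `\ s = I.
Proof.
move=> nI; apply/seteqP; split=> [x [[->|//] H]|x Ix]; first by case: H.
by split; [right|move=> E; apply: nI; rewrite -E].
Qed.

(** * Atoms *)

Section Atoms.
Variables (I : set W) (s : W).
Hypothesis add : addable S I s.
Notation M := (s |` I).
Notation J := (atom_end S I s).

Lemma add_nI : ~ I s. Proof. by case: add. Qed.
Lemma add_fM : is_finitary S M. Proof. by case: add. Qed.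
Lemma add_M : M s. Proof. by left. Qed.
Lemma add_fI : is_finitary S I.
Proof. by apply: fg_sub add_fM => x; right. Qed.
Lemma add_fJ : is_finitary S J. Proof. by apply: fg_sub add_fM => x []. Qed.
Lemma add_IM : I `<=` M. Proof. by move=> x; right. Qed.
Lemma add_JM : J `<=` M. Proof. by move=> x []. Qed.
Lemma add_conj : wconj S M @` I = J.
Proof.
have fM := add_fM; have nI := add_nI.
by rewrite -{1}(setU1D nI) wconjP_image //; left.
Qed.
Lemma add_adjI : adjacent I M.
Proof. by exists s; left; split=> //; exact: add_nI. Qed.
Lemma add_adjJ : adjacent M J.
Proof. by exists (wconj S M s); right; split=> //; exact: (wconj_S add_fM add_M). Qed.

Definition amin := longest S I * longest S M.

Lemma amin_core : iscore I J amin.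
Proof.
have c1 : iscore (wconj S M @` I) J 1 by rewrite add_conj; exact: iscore1.
have [+ _] := core_up add_fI add_fM add_IM (@lmin1 M) c1.
by rewrite mulg1.
Qed.

Lemma latomE : latom S I s = dcoset I amin J.
Proof.
apply: dcoset_eq; rewrite -[longest S M](longestKl add_fI) -/amin.
rewrite -[longest S I * amin]mulg1.
by apply: dcoset_mul; [exact: (longest_gen add_fI)|exact: gen1].
Qed.

Lemma latom_core : core S I J (latom S I s).
Proof. by rewrite latomE; exact: iscore_coset add_fI _ amin_core. Qed.

Lemma latom_minel : minel S (latom S I s) = amin.
Proof. by rewrite latomE; apply: (minel_core add_fI); exact: amin_core. Qed.

Lemma latom_maxel : maxel S (latom S I s) = longest S M.
Proof.
have fM := add_fM; apply: maxel_full; [exact: add_fI|exact: add_fJ| |].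
  exact: lfull_sub add_IM (longest_full fM).
by rewrite longestV //; exact: lfull_sub add_JM (longest_full fM).
Qed.

Lemma latom_chain : chain I [:: M; J].
Proof.
by split; [exact: add_adjI|exact: add_fM|split; [exact: add_adjJ|exact: add_fJ|]].
Qed.

Lemma latom_gprod : gprod I [:: M; J] = amin.
Proof.
rewrite /= /gst !mulg1 setUidr; last exact: add_IM.
by rewrite (setUidl add_JM) (longestK add_fM) mulg1.
Qed.

Lemma latom_gmin : gmin I [:: M; J].
Proof.
rewrite /= !mulg1 /gst (setUidl add_JM) (longestK add_fM).
by split; [exact: lmin1|split=> //; exact: lmin1].
Qed.

Lemma latom_reduced : reduced S [:: I; M; J] /\ expressed S [:: I; M; J] = latom S I s.
Proof.
have [H1 H2] := reducedP add_fI latom_chain; split; first exact/H1/latom_gmin.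
case: (H2 latom_gmin) => -> _ _; rewrite latom_gprod /amin longestKl //.
exact: add_fI.
Qed.

(** Conjugation by w_M exchanges I with J, and s with the element missing from J; so the two
    parametrisations of atoms list the same cosets. *)
Lemma add_swap : [/\ addable S J (wconj S M s), wconj S M s |` J = M,
  atom_end S J (wconj S M s) = I & ratom S J (wconj S M s) = latom S I s].
Proof.
have fM := add_fM.
have Ms' := wconj_S fM add_M.
have E : wconj S M s |` J = M.
  apply/seteqP; split=> [x [->|[]]|x Mx] //.
  by case: (pselect (x = wconj S M s)) => [->|n]; [left|right; split].
have E2 : atom_end S J (wconj S M s) = I.
  by rewrite /atom_end E wconjK // setU1D //; exact: add_nI.
split=> //; first by split; [case=> _; apply|rewrite E].
by rewrite /ratom E2 E.
Qed.
End Atoms.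

(** The maximal element of the atom is w_{Is}, and a finitary set is recovered from its longest
    element. *)
Lemma latom_inj I s s' : addable S I s -> addable S I s' ->
  latom S I s = latom S I s' -> s = s'.
Proof.
move=> a a' E; have E2 := latom_maxel a; rewrite E (latom_maxel a') in E2.
have Es : s' |` I = s |` I := longest_inj (add_fM a') (add_fM a) E2.
have : (s' |` I) s by rewrite Es; left.
by case=> // /(add_nI a).
Qed.

(** * Morphisms of [SD] given by lists of subsets *)

Notation SDC := (SD S).

Lemma finitary_eq (I J : finitary S) : I = J :> set W -> I = J.
Proof.
case: I J => [I fI] [J fJ] /= E; subst J; congr Finitary; exact: Prop_irrelevance.
Qed.

Lemma eq_rect_id (T : Type) (a : T) (P : T -> Type) (x : P a) (E : a = a) :
  eq_rect a P x a E = x.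
Proof. by rewrite (Prop_irrelevance E erefl). Qed.

(** [adjacent] is a proposition, so only the subsets matter; the transport along [E] lets the
    induction treat first objects that are not yet identified. *)
Lemma expr_inj_gen (I J : finitary S) (e : expr I J) (I' : finitary S)
    (e' : expr I' J) (E : I = I') :
  subsets e = subsets e' -> eq_rect I (fun X => expr X J) e I' E = e'.
Proof.
rewrite /subsets; elim: e I' e' E => {I J} [A|A B K g q IH] I' e'.
  case: e' => [B|B B' K g' q'] E /=; first by rewrite eq_rect_id.
  by case.
case: e' q IH => [C|C B' K' g' q'] q IH E /=; first by case.
subst C; rewrite eq_rect_id /= => -[] /finitary_eq EB Eq; subst B'.
rewrite -(IH _ q' erefl); last by rewrite Eq.
by have -> : g = g' := @Prop_irrelevance (adjacent A B) g g'.
Qed.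

Lemma expr_inj (I J : finitary S) (e e' : expr I J) :
  subsets e = subsets e' -> e = e'.
Proof. exact: (expr_inj_gen erefl). Qed.

(** Ties a morphism to the bare list of subsets after [I], so that morphisms are compared by
    rewriting lists; the objects, which carry proofs, come back through [is_path_split] and
    [finitary_eq]. *)
Definition is_path (I J : finitary S) (l : seq (set W)) (f : lhom SDC J I) :=
  exists2 e : expr I J, subsets e = (I : set W) :: l & f = dexpr e.

Lemma is_path_inj (I J : finitary S) (l : seq (set W)) (f f' : lhom SDC J I) :
  is_path l f -> is_path l f' -> f = f'.
Proof. by move=> [e E ->] [e' E' ->]; congr dexpr; apply: expr_inj; rewrite E E'. Qed.

Definition dgen (I J : finitary S) (H : adjacent I J) : lhom SDC J I :=
  pterm (@sd_rel W S) (Gen (H : sd_gen J I)).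

Lemma is_path_nil (I : finitary S) : is_path [::] (lid SDC I).
Proof. by exists (gnil _ I). Qed.

Lemma dexpr_cons (I J K : finitary S) (g : adjacent I J) (q : expr J K) :
  dexpr (gcons (g : sd_gen J I) q) = lcomp (dgen g) (dexpr q).
Proof. exact: pterm_comp. Qed.

Lemma is_path_cons (I K J : finitary S) (H : adjacent I K) (l : seq (set W)) (f : lhom SDC J K) :
  is_path l f -> is_path ((K : set W) :: l) (lcomp (dgen H) f).
Proof.
move=> [e E ->]; exists (gcons (H : sd_gen K I) e); last by rewrite dexpr_cons.
by rewrite /subsets /=; case: E => ->.
Qed.

Lemma is_path_gen (I J : finitary S) (H : adjacent I J) :
  is_path [:: J : set W] (dgen H).
Proof. by rewrite -[dgen H]compm1; apply/is_path_cons/is_path_nil. Qed.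

Lemma is_path_consI (I J : finitary S) (A : set W) (l : seq (set W)) (f : lhom SDC J I) :
  is_path (A :: l) f -> exists (K : finitary S) (H : adjacent I K) (f' : lhom SDC J K),
    [/\ K = A :> set W, is_path l f' & f = lcomp (dgen H) f'].
Proof.
move=> [e + ->]; rewrite /subsets; case: e => [B|B B' K g q] /=; first by case.
case=> EA El; exists B', g, (dexpr q); split; rewrite ?dexpr_cons //.
by exists q => //; rewrite /subsets El.
Qed.

Lemma is_path_nilI (I J : finitary S) (f : lhom SDC J I) :
  is_path [::] f -> I = J.
Proof. by move=> [e + _]; rewrite /subsets; case: e => [B|B B' K g q] //= [[]]. Qed.

Lemma is_path_cat (I J K : finitary S) (l l' : seq (set W)) (f : lhom SDC J I) (f' : lhom SDC K J) :
  is_path l f -> is_path l' f' -> is_path (l ++ l') (lcomp f f').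
Proof.
elim: l I f => [|A l IH] I f Hf Hf' /=.
  have E := is_path_nilI Hf; subst J.
  by rewrite (is_path_inj Hf (is_path_nil I)) comp1m.
have [L [H [f1 [<- H1 ->]]]] := is_path_consI Hf.
by rewrite -Defs.compA; apply: is_path_cons; exact: IH.
Qed.

Lemma is_path_chain (I J : finitary S) (l : seq (set W)) (f : lhom SDC J I) :
  is_path l f -> chain I l /\ last (I : set W) l = J.
Proof.
elim: l I f => [|A l IH] I f Hf /=; first by rewrite (is_path_nilI Hf).
have [L [H [f1 [<- H1 _]]]] := is_path_consI Hf.
by have [h1 h2] := IH _ _ H1; split=> //; split=> //; case: L {H f1 H1 h1 h2}.
Qed.

Lemma is_path_ex (I J : finitary S) (l : seq (set W)) : chain I l -> last (I : set W) l = J ->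
  exists f : lhom SDC J I, is_path l f.
Proof.
elim: l I => [|A l IH] I /=.
  by move=> _ /finitary_eq <-; exists (lid SDC I); exact: is_path_nil.
move=> [H fA ch] El; have [f Hf] := IH (Finitary fA) ch El.
exists (lcomp (dgen (H : adjacent I (Finitary fA))) f).
exact: (@is_path_cons I (Finitary fA) J H l f Hf).
Qed.

Lemma is_path_split (I J : finitary S) (l l' : seq (set W)) (f : lhom SDC J I) :
  is_path (l ++ l') f -> exists (K : finitary S) (g : lhom SDC K I) (h : lhom SDC J K),
    [/\ K = last (I : set W) (l : seq (set W)) :> set W, is_path l g, is_path l' h & f = lcomp g h].
Proof.
elim: l I f => [|A l IH] I f Hf /=.
  by exists I, (lid SDC I), f; split; rewrite ?comp1m //; exact: is_path_nil.
have [L [H [f1 [EL H1 ->]]]] := is_path_consI Hf.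
have [K [g [h [EK Hg Hh ->]]]] := IH _ _ H1.
exists K, (lcomp (dgen H) g), h; split; rewrite ?Defs.compA -?EL //.
exact: is_path_cons.
Qed.

Lemma sd_rel_eq (I J : finitary S) (e e' : expr I J) :
  sd_rel (sd_path e) (sd_path e') -> dexpr e = dexpr e'.
Proof. by move=> H; apply: clsP; exact: eqt_rel. Qed.

Lemma path_up (I J : finitary S) s t (f f' : lhom SDC J I) :
  is_path [:: s |` I; t |` (s |` I)] f -> is_path [:: t |` I; s |` (t |` I)] f' ->
  f = f'.
Proof.
by move=> [e E ->] [e' E' ->]; apply: sd_rel_eq; exact: sd_up E E'.
Qed.

Lemma path_down (I J : finitary S) s t (f f' : lhom SDC J I) :
  is_path [:: I `\ s; (I `\ s) `\ t] f -> is_path [:: I `\ t; (I `\ t) `\ s] f' ->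
  f = f'.
Proof.
by move=> [e E ->] [e' E' ->]; apply: sd_rel_eq; exact: sd_down E E'.
Qed.

Lemma setDU1 s I : I s -> s |` (I `\ s) = I.
Proof.
move=> Is; apply/seteqP; split=> [x [->|[]]|x Ix] //.
by case: (pselect (x = s)) => [->|n]; [left|right].
Qed.

Lemma path_nil (I : finitary S) s (f : lhom SDC I I) :
  (I : set W) s -> is_path [:: I `\ s; I : set W] f -> f = 0%R.
Proof.
move=> Is [e E ->]; apply: clsP; apply: eqt_rel; apply: (sd_nil (s := s)).
by rewrite E /walk /= setDU1.
Qed.

Lemma walk_sl M s t k n : is_finitary S M -> M s -> M t -> wconj S M s <> t ->
  scanl (@do_move W) (rotP S M s t k)
    (flatten [seq [:: Minus (rotu S M s t i); Plus (rotu S M s t i.-1)]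
             | i <- iota k.+1 n]) = sl M s t k.+1 n.
Proof.
move=> fM Ms Mt Hst; elim: n k => [|n IH] k //=.
have <- : rotL S M s t k.+1 = rotP S M s t k `\ rotu S M s t k.+1 by exact: L_P.
have -> : rotu S M s t k |` rotL S M s t k.+1 = rotP S M s t k.+1.
  by rewrite (P_L fM Ms Mt Hst) rotS.
by rewrite IH.
Qed.

Lemma path_switch (I J : finitary S) s t (f f' : lhom SDC J I) :
  let M := s |` I in ~ (I : set W) s -> is_finitary S M -> M t -> wconj S M s <> t ->
  is_path [:: M; M `\ t] f -> is_path (sl M s t 1 (rot_depth S M s t)) f' ->
  f = f'.
Proof.
move=> M nI fM Mt Hst [e E ->] [e' E' ->]; apply: sd_rel_eq.
have Ms : M s by left.
apply: (sd_switchback E Hst); rewrite E' /walk; congr cons.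
have EP : rotP S M s t 0 = I by rewrite /rotP /= /M setU1D.
by have := walk_sl 0 (rot_depth S M s t) fM Ms Mt Hst; rewrite EP => <-.
Qed.

(** * The action on the group ring *)

Section Action.
Implicit Types u : W -> int.

Definition gact (J K : set W) u : W -> int := fun v =>
  if `[< lmin (J `|` K) ((gst J K)^-1 * v) >] then u ((gst J K)^-1 * v) else 0%R.

(* The morphism [J, K] takes the basis element v of Z[W] to gst J K * v if v is
   minimal for J U K and to 0 otherwise; [gact] is this on functions on W. *)
Fixpoint tact (J I : finitary S) (x : term (@sd_gen W S) J I) (u : W -> int) :
    W -> int :=
  match x with
  | Gen A B _ => gact B A u
  | Id _ => u
  | Comp _ _ _ g f => tact g (tact f u)
  | Zero _ _ => fun=> 0%R
  | Opp _ _ x => fun v => (- tact x u v)%R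
  | Add _ _ x y => fun v => (tact x u v + tact y u v)%R
  end.

Fixpoint pact (J : set W) (l : seq (set W)) u : W -> int :=
  if l is K :: l' then gact J K (pact K l' u) else u.

(** A whole expression translates or kills a basis element in one go, so a relation holds on Z[W]
    once both sides have the same product and the same survivors, as in [pact_eq]. *)
Lemma pactE J (l : seq (set W)) u v : pact J l u v =
  if `[< gminv J l ((gprod J l)^-1 * v) >] then u ((gprod J l)^-1 * v) else 0%R.
Proof.
elim: l J v => [|K l IH] J v /=.
  by rewrite invg1 mul1g; case: asboolP.
rewrite /gact IH (invgM (gst J K)) -(mulgA (gprod K l)^-1) mulVKg.
case: asboolP => H1; last by case: asboolP => // -[].
by case: asboolP => H2; case: asboolP => // H3; [case: H3|case: H2; case: H3].
Qed.

Lemma tact_path (I J : finitary S) (l : seq (set W)) (e : expr I J) u :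
  subsets e = (I : set W) :: l -> tact (sd_path e) u = pact I l u.
Proof.
rewrite /subsets /sd_path => -[<-]; elim: e => {I J} [A|A B K g q IH] //=.
by rewrite IH.
Qed.

Lemma tactD (J I : finitary S) (x : term (@sd_gen W S) J I) u u' v :
  tact x (fun w => u w + u' w)%R v = (tact x u v + tact x u' v)%R.
Proof.
elim: x u u' v => {J I} /=.
- by move=> J I _ u u' v; rewrite /gact; case: asboolP.
- by [].
- move=> A B C g IHg f IHf u u' v; rewrite -IHg; congr (tact g _ v).
  by apply/funext => w; exact: IHf.
- by move=> *; rewrite GRing.addr0.
- by move=> A B x IH u u' v; rewrite IH GRing.opprD.
- by move=> A B x IHx y IHy u u' v; rewrite IHx IHy GRing.addrACA.
Qed.

Lemma pact_eq (J : set W) (l l' : seq (set W)) :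
  gprod J l = gprod J l' -> (forall v, gminv J l v <-> gminv J l' v) ->
  forall u, pact J l u = pact J l' u.
Proof.
move=> E H u; apply/funext => v; rewrite !pactE E.
by congr (if _ then _ else _); apply/asbool_equiv_eq/H.
Qed.

Lemma lmin_gst (K M : set W) v : K `<=` M -> is_finitary S M -> lmin M v ->
  lmin K (longest S K * longest S M * v).
Proof.
move=> KM fM Hv; have fK := fg_sub KM fM.
have gK := gen_mono KM (longest_gen fK).
apply/(lmin_longest fK); rewrite -mulgA longestKl //.
rewrite mulgA (Hv _ (longest_gen fM)) (Hv _ (genM gK (longest_gen fM))).
by rewrite addnA (longest_mul fM gK).
Qed.

Lemma gst_up J K : J `<=` K -> gst J K = longest S J * longest S K.
Proof. by move=> /setUidr E; rewrite /gst E. Qed.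
Lemma gst_down J K : is_finitary S J -> K `<=` J -> gst J K = 1.
Proof. by move=> fJ /setUidl E; rewrite /gst E longestK. Qed.

Lemma up_gminv I K M v : I `<=` K -> K `<=` M -> is_finitary S M ->
  gprod I [:: K; M] = longest S I * longest S M /\
  (gminv I [:: K; M] v <-> lmin M v).
Proof.
move=> IK KM fM; have fK := fg_sub KM fM.
rewrite /= (gst_up IK) (gst_up KM) (setUidr IK) (setUidr KM) mulg1 mul1g.
split; first by rewrite -!mulgA longestKl.
split=> [[_ []]|Hv] //; split=> //; exact: lmin_gst.
Qed.

Lemma down_gminv I K L v : is_finitary S I -> K `<=` I -> L `<=` K ->
  gprod I [:: K; L] = 1 /\ (gminv I [:: K; L] v <-> lmin I v).
Proof.
move=> fI KI LK; have fK := fg_sub KI fI.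
rewrite /= (gst_down fI KI) (gst_down fK LK) (setUidl KI) (setUidl LK) !mulg1 !mul1g.
split=> //; split=> [[]|Hv] //; split=> //; split=> //; exact: lmin_sub Hv.
Qed.

Lemma walk_chain (I J : finitary S) (e : expr I J) (l : seq (set W)) :
  subsets e = (I : set W) :: l -> chain I l /\ last (I : set W) l = J.
Proof. by move=> E; apply: (@is_path_chain I J l (dexpr e)); exists e. Qed.

Lemma adjacentU1 s I : adjacent I (s |` I) -> ~ I s.
Proof.
move=> [r [[nI E]|[Ir E]]] Is; have E2 : s |` I = I by apply/setUidr => x ->.
  by apply: nI; rewrite -E2 E; left.
have [_] : (I `\ r) r by rewrite -E E2.
exact.
Qed.

Lemma adjacentD1 s I : adjacent I (I `\ s) -> I s.
Proof.
move=> H; apply: contrapT => nIs; have E2 : I `\ s = I.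
  by apply/seteqP; split=> [x []|x Ix] //; split=> // E; apply: nIs; rewrite -E.
case: H => r [[nI E]|[Ir E]].
  by apply: nI; rewrite -E2 E; left.
have [_] : (I `\ r) r by rewrite -E E2.
exact.
Qed.

Lemma gminv_last J (l : seq (set W)) v : l != [::] -> gminv J l v ->
  lmin (last J l) v.
Proof.
elim: l J => // K [|K' l] IH J _ [H1 H2]; last exact: (IH K).
by rewrite /= mul1g in H1; exact: lmin_sub (@subsetUr _ J K) H1.
Qed.

Lemma tact_rel (J I : finitary S) (x y : term (@sd_gen W S) J I) u :
  sd_rel x y -> tact x u = tact y u.
Proof.
case=> {J I x y}.
- move=> I J e e' s t E E'.
  have [/= [_ _ [_ fM _]] _] := walk_chain E.
  rewrite (tact_path (l := [:: s |` I; t |` (s |` I)]) _ E).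
  rewrite (tact_path (l := [:: t |` I; s |` (t |` I)]) _ E').
  have EM : s |` (t |` I) = t |` (s |` I) by rewrite setUCA.
  have fM' : is_finitary S (s |` (t |` I)) by rewrite EM.
  have G v := up_gminv v (@subsetUr _ [set s] I) (@subsetUr _ [set t] _) fM.
  have G' v := up_gminv v (@subsetUr _ [set t] I) (@subsetUr _ [set s] _) fM'.
  apply: pact_eq => [|v]; first by rewrite (proj1 (G 1)) (proj1 (G' 1)) EM.
  by rewrite (proj2 (G v)) (proj2 (G' v)) EM.
- move=> I J e e' s t E E'.
  rewrite (tact_path (l := [:: I `\ s; (I `\ s) `\ t]) _ E).
  rewrite (tact_path (l := [:: I `\ t; (I `\ t) `\ s]) _ E').
  have fI : is_finitary S I by case: I {e e' E E'}.
  have sub r (A : set W) : A `\ r `<=` A by move=> x [].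
  have G v := down_gminv v fI (sub s I) (sub t _).
  have G' v := down_gminv v fI (sub t I) (sub s _).
  apply: pact_eq => [|v]; first by rewrite (proj1 (G 1)) (proj1 (G' 1)).
  by rewrite (proj2 (G v)) (proj2 (G' v)).
- move=> I J e e' s t E Hst E'.
  have [/= [aI fM [aM fJ _]] EJ] := walk_chain E.
  rewrite (tact_path (l := [:: s |` I; (s |` I) `\ t]) _ E).
  have nI := adjacentU1 aI; have Mt := adjacentD1 aM.
  set M := s |` I in fM Mt aM Hst E E' EJ *.
  have Ms : M s by left.
  have EP : rotP S M s t 0 = I by rewrite /rotP /= /M setU1D.
  have IM : I `<=` M by move=> x; right.
  have JM : M `\ t `<=` M by move=> x [].
  have {}E' : subsets e' = (I : set W) :: sl M s t 1 (rot_depth S M s t).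
    by rewrite E' /walk -{2}EP walk_sl.
  rewrite (tact_path _ E'); apply: pact_eq => [|v].
    rewrite -{2}EP sl_gprod_depth // EP /=.
    by rewrite (gst_up IM) (gst_down fM JM) !mulg1.
  rewrite /= (setUidr IM) (setUidl JM) (gst_down fM JM) !mul1g.
  have := switchback_gminv fM Ms Mt Hst v; rewrite EP => H.
  split=> [[_ [Hv _]]|H2]; first by case/H: Hv.
  suff Hv : lmin M v by do !split.
  apply/H; split=> //.
  have := @sl_last M s t 0 (rot_depth S M s t); rewrite EP add0n => <-.
  by apply: gminv_last H2; case: (rot_depth S M s t) (rot_depth_pos fM Ms Mt Hst).
(* To survive, [z] must be minimal for I, and so must its image [g * z]. Both lie in W_I z, which
   would force g = w_K w_I to be 1. *)
- move=> I e s E.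
  have [/= [aI fK _] _] := walk_chain E; have Is := adjacentD1 aI.
  rewrite (tact_path (l := [:: I `\ s; s |` (I `\ s)]) _ E).
  apply/funext => v; rewrite pactE setDU1 //; case: asboolP => // -[/=].
  have fI : is_finitary S I by case: I {e E aI fK Is}.
  set K := I `\ s in fK *; have KI : K `<=` I by move=> x [].
  rewrite (setUidl KI) (setUidr KI) (gst_down fI KI) (gst_up KI) mulg1 !mul1g.
  set g := longest S K * longest S I; set z := (_ * v) => H1 [H2 _].
  have Hg : generated I g.
    by apply: genM; [exact: gen_mono KI _ (longest_gen fK)|exact: longest_gen].
  have [g1 _] : g = 1 /\ z = g * z.
    by apply: (lmin_eq Hg (@gen1 I) H2 H1); rewrite mul1g.
  have nKs : ~ K s by case=> _; apply.
  have := longest_lt fI KI Is nKs.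
  by rewrite -{1}(longestKl fK (longest S I)) -/g g1 mulg1 ltnn.
Qed.

Definition Ev (J I : finitary S) (f : lhom SDC J I) := tact (repr f).

Lemma tact_eqterm (J I : finitary S) (x y : term (@sd_gen W S) J I) u :
  eqterm (@sd_rel W S) x y -> tact x u = tact y u.
Proof.
move=> H; elim: H u => {J I x y} /=.
- by move=> J I x y H u; exact: tact_rel.
- by [].
- by move=> J I x y _ IH u; rewrite IH.
- by move=> J I x y z _ IH _ IH' u; rewrite IH IH'.
- by move=> A B C g g' f f' _ IHg _ IHf u; rewrite IHg IHf.
- by move=> A B x x' _ IH u; rewrite IH.
- by move=> A B x x' y y' _ IHx _ IHy u; rewrite IHx IHy.
- by [].
- by [].
- by [].
- by [].
- by move=> A B C g f f' u; apply/funext => v; rewrite tactD.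
- by move=> A B x y z u; apply/funext => v; rewrite GRing.addrA.
- by move=> A B x y u; apply/funext => v; rewrite GRing.addrC.
- by move=> A B x u; apply/funext => v; rewrite GRing.add0r.
- by move=> A B x u; apply/funext => v; rewrite GRing.addNr.
Qed.

Lemma EvE (J I : finitary S) (x : term (@sd_gen W S) J I) :
  Ev (pterm (@sd_rel W S) x) = tact x.
Proof. by apply/funext => u; apply: tact_eqterm; exact: repr_cls. Qed.

Lemma Ev_id (I : finitary S) u : Ev (lid SDC I) u = u.
Proof. by rewrite (EvE (Id _ I)). Qed.

Lemma Ev_comp (A B C : finitary S) (g : lhom SDC B C) (f : lhom SDC A B) u :
  Ev (lcomp g f) u = Ev g (Ev f u).
Proof. by rewrite -(ptermK f) -(ptermK g) -pterm_comp !EvE. Qed.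

Lemma EvD (J I : finitary S) (f g : lhom SDC J I) u v :
  Ev (f + g)%R u v = (Ev f u v + Ev g u v)%R.
Proof. by rewrite -(ptermK f) -(ptermK g) -ptermD !EvE. Qed.

Lemma Ev0 (J I : finitary S) u v : Ev (0 : lhom SDC J I)%R u v = 0%R.
Proof. by rewrite (EvE (Zero _ J I)). Qed.

Lemma EvN (J I : finitary S) (f : lhom SDC J I) u v :
  Ev (- f)%R u v = (- Ev f u v)%R.
Proof. by apply: (@GRing.addrI _ (Ev f u v)); rewrite -EvD !GRing.subrr Ev0. Qed.

Lemma Ev_path (I J : finitary S) (l : seq (set W)) (f : lhom SDC J I) u :
  is_path l f -> Ev f u = pact I l u.
Proof. by move=> [e E ->]; rewrite EvE; exact: tact_path E. Qed.

Definition delta (w : W) : W -> int := fun v => if `[< v = w >] then 1%R else 0%R.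

Lemma Ev_path_delta (I J : finitary S) (l : seq (set W)) (f : lhom SDC J I) w : is_path l f ->
  gminv I l w -> Ev f (delta w) = delta (gprod I l * w).
Proof.
move=> Hf H; rewrite (Ev_path _ Hf); apply/funext => v; rewrite pactE /delta.
case: (pselect (v = gprod I l * w)) => [->|n].
  by rewrite !mulKg; do !case: asboolP.
case: (asboolP (v = _)) => // _; case: asboolP => // _; case: asboolP => // E.
by case: n; rewrite -E mulVKg.
Qed.

Lemma Ev_path_delta0 (I J : finitary S) (l : seq (set W)) (f : lhom SDC J I) w : is_path l f ->
  ~ gminv I l w -> Ev f (delta w) = fun=> 0%R.
Proof.
move=> Hf H; rewrite (Ev_path _ Hf); apply/funext => v; rewrite pactE /delta.
case: asboolP => // H1; case: asboolP => // E; case: H.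
by rewrite -E.
Qed.
End Action.

Lemma latom_atom (I J : finitary S) s : addable S I s ->
  J = atom_end S I s :> set W -> atom I J (latom S I s).
Proof.
move=> a EJ; split; first by rewrite EJ; exact: latom_core.
have [f [e E _]] := is_path_ex (latom_chain a) (esym EJ).
exists e, s, (wconj S (s |` I) s); rewrite E.
by have [H1 H2] := latom_reduced a.
Qed.

Lemma maxel_core (I J : finitary S) w : iscore I J w ->
  maxel S (dcoset I w J) = longest S I * w.
Proof.
have [fI fJ] : is_finitary S I /\ is_finitary S J by case: I; case: J.
move=> c; have [_ h1 h2] := iscore_full fI fJ c.
rewrite -(maxel_full fI fJ h1 h2); congr (maxel S _); apply/esym/dcoset_eq.
rewrite -[_ * w]mulg1; apply: dcoset_mul; [exact: longest_gen|exact: gen1].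
Qed.

Lemma atomP (I J : finitary S) p : atom I J p ->
  exists s, [/\ addable S I s, J = atom_end S I s :> set W & p = latom S I s].
Proof.
move=> [Hc [e [s [t [E Hr Hp]]]]].
have [fI fJ] : is_finitary S I /\ is_finitary S J by case: I {Hc e E Hr Hp}; case: J.
set M := s |` I; have {}E : subsets e = (I : set W) :: [:: M; M `\ t] := E.
have [ch EJ] := walk_chain E; have /= [aI fM [aM _ _]] := ch.
have add : addable S I s by split=> //; exact: adjacentU1.
have IM := @add_IM I s; have JM : M `\ t `<=` M by move=> x [].
have [H1 H2] := reducedP fI ch; rewrite E in Hr Hp.
have := H2 (proj1 H1 Hr); rewrite Hp.
rewrite /= (gst_up IM) (gst_down fM JM) !mulg1 longestKl // => -[Ep h1 h2].
rewrite [M `\ t]EJ in Ep h2.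
have [c Ec] : iscore I J (minel S p) /\ p = dcoset I (minel S p) J by apply/coreP.
set m := minel S p in c Ec.
have Em : longest S I * m = longest S M.
  by rewrite -(maxel_core c) -Ec Ep maxel_full.
have {}Em : m = amin I s by rewrite -(longestKl fI m) Em.
have EJ2 : J = atom_end S I s :> set W.
  have [/conj_setV E1 _] := c; have [/conj_setV E2 _] := amin_core add.
  by rewrite {1}E1 Em -E2.
by exists s; rewrite /latom -EJ2.
Qed.

Lemma atom_uniq (I J : finitary S) p : atom I J p ->
  exists! s : W, [/\ addable S I s, J = atom_end S I s :> set W & p = latom S I s].
Proof.
move=> /atomP [s [a E Ep]]; exists s; split=> // s' [a' _ Ep'].
by apply: latom_inj a a' _; rewrite -Ep.
Qed.

Lemma add_back (J : finitary S) t : addable S J t ->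
  let I := atom_end S J t in let s := wconj S (t |` J) t in
  [/\ addable S I s, s |` I = t |` J, J = atom_end S I s :> set W &
      ratom S J t = latom S I s].
Proof.
move=> a /=; have [h1 h2 h3 h4] := add_swap a; split=> //.
have [_ _ _ h6] := add_swap h1.
by rewrite h3 h2 (wconjK (add_fM a)) in h6.
Qed.

Lemma ratom_atom (I J : finitary S) t : addable S J t ->
  I = atom_end S J t :> set W -> atom I J (ratom S J t).
Proof.
move=> a E; have [h1 h2 h3 ->] := add_back a.
by rewrite -E in h1 h3 *; exact: latom_atom.
Qed.

Lemma ratom_uniq (I J : finitary S) p : atom I J p ->
  exists! t : W, [/\ addable S J t, I = atom_end S J t :> set W & p = ratom S J t].
Proof.
move=> /atomP [s [a E Ep]]; have [h1 h2 h3 h4] := add_swap a.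
rewrite -E in h1 h2 h3 h4.
exists (wconj S (s |` I) s); split; first by rewrite h3 h4.
move=> t [a' E' Ep']; have [k1 k2 k3 k4] := add_back a'.
rewrite -E' in k1 k2 k3 k4.
have Es : s = wconj S (t |` J) t.
  by apply: latom_inj a k1 _; rewrite -Ep -k4.
by rewrite Es k2 wconjK //; exact: add_fM.
Qed.

(** * The functor from the atomic category *)

Definition phi_spec (I J : finitary S) (p : set W) (f : lhom SDC J I) :=
  exists s, [/\ addable S I s, p = latom S I s & is_path [:: s |` I; J : set W] f].

(** The morphism of the expression [I + s - t] of the atom; its agreement with the choice made by
    [dcos] is only established in [phi_dcos]. *)
Definition phi (J I : finitary S) (a : atom_gen J I) : lhom SDC J I :=
  xget 0%R (phi_spec (sval a)).

Lemma phiE (I J : finitary S) (a : atom_gen J I) s : addable S I s ->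
  sval a = latom S I s -> is_path [:: s |` I; J : set W] (phi a).
Proof.
move=> ad E; have [s' [ad' EJ Ep]] := atomP (svalP a).
have [f Hf] : exists f : lhom SDC J I, is_path [:: s' |` I; J : set W] f.
  by apply: is_path_ex => //; rewrite EJ; exact: latom_chain.
have Es : s' = s by apply: latom_inj ad' ad _; rewrite -Ep.
have : phi_spec (sval a) (phi a).
  by apply: xgetPex; exists f; exists s'.
case=> r [ar Er H]; have -> // : s = r.
by apply: latom_inj ad ar _; rewrite -Er -E.
Qed.

Definition FT (J I : finitary S) := @teval _ _ SDC phi J I.

Section BraidImage.
Variables (M : set W) (s t : W).
Hypotheses (fM : is_finitary S M) (Ms : M s) (Mt : M t) (Hst : wconj S M s <> t).
Notation L := (rotL S M s t).
Notation P := (rotP S M s t).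
Notation u i := (Defs.rot S M s t i).2.
Notation up i := (Defs.rot S M s t i).1.
Notation d := (rot_depth S M s t).

Lemma rot_add i : [/\ addable S (L i) (up i), up i |` L i = P i,
  atom_end S (L i) (up i) = L i.+1 &
  expressed S [:: L i; P i; L i.+1] = latom S (L i) (up i)].
Proof.
have EP := P_L fM Ms Mt Hst i.
have ad : addable S (L i) (up i).
  by split; [exact: nLup|rewrite -EP; exact: fP].
have EL : atom_end S (L i) (up i) = L i.+1.
  rewrite /atom_end -EP; have -> : L i.+1 = P i `\ u i.+1 by exact: L_P.
  by rewrite rotS.
by split=> //; have [_] := latom_reduced ad; rewrite -EP EL.
Qed.

Lemma atoms_path (I J : finitary S) (x : atom_path I J) k n : 
  I = L k :> set W ->
  atoms x = [seq expr_coset S (L i) (P i) (L i.+1) | i <- iota k n] ->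
  is_path (rl M s t k n) (FT (path_term x)).
Proof.
rewrite /atoms; elim: x k n => {I J} [A|A B K g q IH] k [|n] //= EI.
  by move=> _; exact: is_path_nil.
case=> _ Eg EB Eq; rewrite /FT /=.
have [ad EP EL Ex] := rot_add k; rewrite -EI in ad EP.
have : is_path [:: up k |` A; B : set W] (phi g).
  by apply: phiE ad _; rewrite Eg EI -Ex.
rewrite EP EB => Hg; exact: (is_path_cat Hg (IH k.+1 n EB Eq)).
Qed.

Lemma rl_sl n k : P k :: sl M s t k.+1 n ++ [:: L (k + n).+1] = rl M s t k n.+1.
Proof.
elim: n k => [|n IH] k; first by rewrite addn0.
by rewrite -[RHS]/(P k :: L k.+1 :: rl M s t k.+1 n.+1) -IH addSnnS.
Qed.

Lemma switch_mid (I J : finitary S) (f f' : lhom SDC J I) : I = P 0 :> set W ->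
  is_path [:: M; M `\ t] f -> is_path (sl M s t 1 d) f' -> f = f'.
Proof.
move=> EI; have EM : s |` I = M by rewrite EI setDU1.
have nI : ~ (I : set W) s by rewrite EI => -[_]; apply.
by move: (@path_switch I J s t f f' nI); rewrite EM => /(_ fM Mt Hst).
Qed.

(** Between P_0 and P_d the d + 1 atoms run through the long side of a switchback relation;
    replacing it by the short side leaves an expression that climbs to [M] and descends. *)
Lemma braid_path (I J : finitary S) (f g : lhom SDC J I) :
  I = L 0 :> set W -> is_path (rl M s t 0 d.+1) f ->
  is_path [:: M `\ s; M; M `\ t; J : set W] g -> f = g.
Proof.
move=> EI; rewrite -rl_sl => Hf Hg.
have [_ El] := is_path_chain Hf; rewrite /= last_cat /= in El.
have [K [H [f1 [EK Hf1 ->]]]] := is_path_consI Hf.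
have [N [f2 [f3 [EN Hf2 Hf3 ->]]]] := is_path_split Hf1.
have [K' [H' [g1 [EK' Hg1 ->]]]] := is_path_consI Hg.
have EKK : K' = K by apply: finitary_eq; rewrite EK EK'.
subst K'; have -> : H' = H by exact: Prop_irrelevance.
congr lcomp.
have [N' [g2 [g3 [EN' Hg2 Hg3 ->]]]] := @is_path_split K J [:: M; M `\ t] [:: J : set W] g1 Hg1.
have EPd : P d = M `\ t by rewrite /rotP rot_last.
have ENN : N' = N.
  apply: finitary_eq; rewrite EN EN' /= -EPd.
  have := @sl_last M s t 0 d; rewrite add0n => <-.
  by rewrite EK; case: (d) (rot_depth_pos fM Ms Mt Hst).
subst N'; rewrite El in Hf3; rewrite (is_path_inj Hf3 Hg3); congr lcomp.
exact/esym/(switch_mid EK Hg2).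
Qed.
End BraidImage.

Lemma path_up_down (I J : finitary S) s t s' t' (f g : lhom SDC J I) :
  let M := s |` (t |` I) in
  is_path [:: s |` I; M; M `\ s'; J : set W] f ->
  is_path [:: t |` I; M; M `\ t'; J : set W] g -> J = (M `\ s') `\ t' :> set W -> f = g.
Proof.
move=> M Hf Hg EJ.
have [N [f1 [f2 [EN Hf1 Hf2 ->]]]] :=
  @is_path_split I J [:: s |` I; M] [:: M `\ s'; J : set W] f Hf.
have [N' [g1 [g2 [EN' Hg1 Hg2 ->]]]] :=
  @is_path_split I J [:: t |` I; M] [:: M `\ t'; J : set W] g Hg.
have E : N' = N by apply: finitary_eq; rewrite EN EN'.
subst N'; rewrite /= in EN; congr lcomp.
  by apply: (path_up (s := s) (t := t)) => //; rewrite setUCA.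
have EJ' : (M `\ s') `\ t' = (M `\ t') `\ s'.
  by apply/seteqP; split=> x [[? ?] ?]; split=> //; split.
apply: (path_down (s := s') (t := t')); rewrite EN; first by rewrite -EJ.
by rewrite -EJ' -EJ.
Qed.

Lemma updown_ex (I J : finitary S) s t : let M := s |` (t |` I) in
  ~ (I : set W) s -> ~ (I : set W) t -> s <> t -> is_finitary S M ->
  J = (M `\ wconj S M s) `\ wconj S M t :> set W -> exists f : lhom SDC J I,
    is_path [:: s |` I; M; M `\ wconj S M s; J : set W] f.
Proof.
move=> M nIs nIt Hst fM EJ.
have Ms : M s by left.
have Mt : M t by right; left.
have Ms' := wconj_S fM Ms; have Mt' := wconj_S fM Mt.
apply: is_path_ex => //=; split; first by exists s; left.
  by apply: fg_sub fM; rewrite /M setUCA => x; right.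
split=> //; first by exists t; left; split; [case=> [/esym|]|rewrite /M setUCA].
split; [by exists (wconj S M s); right|by apply: fg_sub fM => x []|].
split=> //; last by rewrite EJ; apply: fg_sub fM => x [[]].
exists (wconj S M t); right; split=> //.
by split=> // /(wconj_inj fM) /esym.
Qed.

Lemma phi_rel (J I : finitary S) (x y : term (@atom_gen W S) J I) :
  atom_rel x y -> FT x = FT y.
Proof.
case=> {J I x y}.
- move=> I J x y s t nIs nIt Hst; set M := s |` (t |` I) => fM.
  have Ms : M s by left.
  have Mt : M t by right; left.
  rewrite braid_rhsE // /braid_lhs => Ex Ey.
  have Ms' := wconj_S fM Ms; have Mt' := wconj_S fM Mt.
  have H1 : wconj S M t <> wconj S M s by move=> /(wconj_inj fM) /esym.
  have H2 : wconj S M s <> wconj S M t by move=> /(wconj_inj fM).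
  have EI a b : [set a; b] = [set s; t] -> I = M `\` [set a; b] :> set W.
    move=> ->; apply/seteqP; split=> [z Iz|z [[->|[->|//]] H]].
    - split; first by right; right.
      by case=> E; [apply: nIs|apply: nIt]; rewrite -E.
    - by case: H; left.
    - by case: H; right.
  have EI1 : I = rotL S M t (wconj S M s) 0 :> set W.
    by apply: EI; rewrite /= wconjK // setUC.
  have EI2 : I = rotL S M s (wconj S M t) 0 :> set W.
    by apply: EI; rewrite /= wconjK.
  have Hx := atoms_path fM Mt Ms' H1 EI1 Ex.
  have Hy := atoms_path fM Ms Mt' H2 EI2 Ey.
  have [_ EJ] := is_path_chain Hx.
  rewrite EI1 rl_last add0n rot_end_L // -EI1 in EJ.
  have {}EJ : J = (M `\ wconj S M s) `\ wconj S M t :> set W.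
    have -> : (M `\ wconj S M s) `\ wconj S M t = wconj S M @` ((M `\ s) `\ t).
      apply/seteqP; split=> [z [[Mz n1] n2]|_ [z [[Mz n1] n2] <-]]; last first.
        split; first by split; [exact: wconj_S|move=> /(wconj_inj fM)].
        by move=> /(wconj_inj fM).
      exists (wconj S M z); last by rewrite wconjK.
      split; first split; first exact: wconj_S.
        by move=> E; apply: n1; rewrite /= -E wconjK.
      by move=> E; apply: n2; rewrite /= -E wconjK.
    rewrite -EJ; congr (_ @` _); rewrite (EI s t) //.
    apply/seteqP; split=> [z [Mz H]|z [[Mz n1] n2]].
      by split; [split=> // E; apply: H; left|move=> E; apply: H; right].
    by split=> // -[].
  have EMt : s |` I = M `\ t.
    rewrite /M setUCA setU1D // => -[E|//]; exact: Hst.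
  have EMs : t |` I = M `\ s.
    by rewrite /M setU1D // => -[E|//]; exact: Hst.
  have EJ' : J = (M `\ wconj S M t) `\ wconj S M s :> set W.
    by rewrite EJ; apply/seteqP; split=> z [[? ?] ?]; split=> //; split.
  have [fx Hfx] := updown_ex nIs nIt Hst fM EJ.
  have [fy Hfy] : exists f : lhom SDC J I,
      is_path [:: t |` I; M; M `\ wconj S M t; J : set W] f.
    rewrite /M setUCA; rewrite /M setUCA in fM EJ'.
    by apply: updown_ex EJ' => // E; exact: Hst.
  rewrite (braid_path fM Mt Ms' H1 EI1 Hx (g := fx)); last by rewrite -EMt.
  rewrite (braid_path fM Ms Mt' H2 EI2 Hy (g := fy)); last by rewrite -EMs.
  exact: path_up_down Hfx Hfy EJ.
- move=> I J s a a' ad EJ Ea Ea'.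
  have [h1 h2 h3 h4] := add_back ad; rewrite -EJ in h1 h2 h3 h4.
  have Ha : is_path [:: s |` I; I : set W] (phi a).
    by rewrite -h2; apply: phiE h1 _; rewrite Ea h4.
  have Ha' := phiE ad Ea'.
  rewrite /FT /=.
  have [K [H [f1 [EK Hf1 ->]]]] := is_path_consI Ha.
  have [K' [H' [f1' [EK' Hf1' ->]]]] := is_path_consI Ha'.
  have EKK : K' = K by apply: finitary_eq; rewrite EK EK'.
  subst K'; rewrite -Defs.compA (Defs.compA f1).
  (* The two atoms compose to [J, M, I, M, J] with M = Is, whose middle is [M - s + s]. *)
  have -> : lcomp f1 (dgen H') = 0%R.
    apply: (@path_nil K s); first by rewrite EK; left.
    have := is_path_cat Hf1 (is_path_gen H'); rewrite EK setU1D //.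
    exact: add_nI ad.
  by rewrite comp0m compm0.
Qed.

Notation AC := (atomic_cat S).

Definition Fun (J I : finitary S) (x : lhom AC J I) : lhom SDC J I :=
  @pfun _ _ (@atom_rel W S) SDC phi J I x.

Lemma Fun_linear : linear_functor Fun.
Proof. exact: pfun_linear phi_rel. Qed.

Lemma Fun_term (J I : finitary S) (x : term (@atom_gen W S) J I) :
  Fun (pterm (@atom_rel W S) x) = FT x.
Proof. by apply: pfunE; exact: phi_rel. Qed.

Lemma Fun_datom (I J : finitary S) (a : atom_gen J I) : Fun (datom a) = phi a.
Proof. exact: Fun_term. Qed.

(** * Reduced atomic paths *)

(* [ared f w]: f is the class of a reduced atomic path of the core coset with
   minimal element w. *)
Inductive ared (K : finitary S) : forall I : finitary S, lhom AC K I -> W -> Prop :=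
| ared_id : ared (lid AC K) 1
| ared_cons (I J : finitary S) (a : atom_gen J I) s (f : lhom AC K J) w :
    addable S I s -> J = atom_end S I s :> set W -> sval a = latom S I s ->
    ared f w -> lmin (s |` I) w -> ared (lcomp (datom a) f) (amin I s * w).

Lemma finitary_fin (I : finitary S) : is_finitary S I. Proof. by case: I. Qed.

Lemma ared_core (K I : finitary S) (f : lhom AC K I) w : ared f w -> iscore I K w.
Proof.
elim=> {I f w} [|I J a s f w ad EJ Ea _ c Hm]; first exact: iscore1.
rewrite EJ -add_conj // in c.
by have [] := core_up (finitary_fin I) (add_fM ad) (@add_IM I s) Hm c.
Qed.

Lemma amin_pos I s : addable S I s -> (0 < len (amin I s))%N.
Proof.
move=> ad; have := longest_lt (add_fM ad) (@add_IM I s) (add_M I s) (add_nI ad).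
rewrite /amin (longest_mul (add_fM ad) (gen_mono (@add_IM I s) (longest_gen (add_fI ad)))).
by llia.
Qed.

Lemma amin_gen I s : addable S I s -> generated (s |` I) (amin I s).
Proof.
move=> ad; apply: genM; last exact: longest_gen (add_fM ad).
exact: gen_mono (@add_IM I s) _ (longest_gen (add_fI ad)).
Qed.

(** Otherwise [amin I s], a nontrivial element of W_{Is}, would be minimal for all of Is. *)
Lemma amin_descent I s w : addable S I s -> lmin (s |` I) w ->
  (len (s * (amin I s * w)) < len (amin I s * w))%N.
Proof.
move=> ad Hm; have Ss := proj1 (add_fM ad) _ (add_M I s).
have Hg := amin_gen ad; have Hs := genS (add_M I s).
rewrite mulgA !Hm //; last exact: genM.
rewrite ltn_add2r; case: (len_S1 (amin I s) Ss) => E; last by rewrite E.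
have [_ Hc] := amin_core ad.
have : lmin (s |` I) (amin I s).
  apply: lminP; first exact: (proj1 (add_fM ad)).
  move=> x [->|Ix]; first by rewrite E.
  exact: lminS (proj1 (add_fI ad)) Hc Ix.
move=> /(_ _ (genV Hg)); rewrite mulVg len1; have := amin_pos ad; llia.
Qed.

Lemma finite_U1 s I : finite_set I -> finite_set (s |` I).
Proof. by move=> fI; rewrite finite_setU; split=> //; exact: finite_set1. Qed.

(** [core_peel] with M = Is: a left descent of a core element splits off an atom, just as it splits
    off a first letter in the group. *)
Lemma core_step (I K : finitary S) w s : iscore I K w -> S s ->
  (len (s * w) < len w)%N -> exists v,
  [/\ addable S I s, w = amin I s * v, lmin (s |` I) v & iscore (atom_end S I s) K v].
Proof.
move=> c Ss Hs; have fI := finitary_fin I; have [_ Hm] := c.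
have nI : ~ (I : set W) s.
  by move=> Is; have := lminS (proj1 fI) Hm Is; llia.
have [||||fM [v [E Hv cv]]] := core_peel fI (finitary_fin K) (M := s |` I) c.
- exact: add_IM.
- by move=> x [->|/(proj1 fI)].
- exact/finite_U1/fg_finite.
- by move=> x [-> //|].
have ad : addable S I s by split.
by exists v; split=> //; rewrite -add_conj.
Qed.

Lemma ared_ex (I K : finitary S) w : iscore I K w -> exists f : lhom AC K I, ared f w.
Proof.
have [n] := ubnP (len w); elim: n I w => // n IH I w Hn c.
case E: (redword S w) => [|s l].
  have w1 : w = 1 by have [_ <- _] := redwordP w; rewrite E wprod_nil.
  have EI : K = I.
    apply: finitary_eq; case: c => -> _; rewrite w1.
    by case: (iscore1 K).
  by subst I; rewrite w1; exists (lid AC K); exact: ared_id.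
have [h1 h2 _] := redwordP w; rewrite E in h1 h2.
move: h1 => /word_cons [Ss Sl].
have Hs : (len (s * w) < len w)%N.
  rewrite -{1}h2 wprod_cons SKl // /len E -/(len _).
  exact: leq_ltn_trans (len_le Sl) _.
have [v [ad Ew Hv cv]] := core_step c Ss Hs.
have [|f Hf] := IH (Finitary (add_fJ ad)) v _ cv.
  have : len w = (len (amin I s) + len v)%N by rewrite Ew Hv //; exact: amin_gen.
  by have := amin_pos ad; llia.
have EJ : Finitary (add_fJ ad) = atom_end S I s :> set W by [].
exists (lcomp (datom (exist _ (latom S I s) (latom_atom ad EJ))) f).
by rewrite Ew; apply: ared_cons Hf _.
Qed.

Lemma ared_inv (K I : finitary S) (f : lhom AC K I) w : ared f w ->
  (w = 1 /\ exists E : K = I, f = eq_rect K (fun X => lhom AC K X) (lid AC K) I E) \/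
  exists (J : finitary S) (a : atom_gen J I) s (f' : lhom AC K J) w',
    [/\ [/\ addable S I s, J = atom_end S I s :> set W & sval a = latom S I s],
      ared f' w', lmin (s |` I) w', f = lcomp (datom a) f' & w = amin I s * w'].
Proof.
case=> [|{}I J a s {}f {}w ad EJ Ea Hf Hm]; first by left; split=> //; exists erefl.
by right; exists J, a, s, f, w.
Qed.

Lemma atom_gen_eq (I J : finitary S) (a a' : atom_gen J I) : sval a = sval a' -> a = a'.
Proof.
case: a a' => [p Hp] [q Hq] /= E; subst q; congr exist; exact: Prop_irrelevance.
Qed.

Lemma datom_path (I J N : finitary S) (a : atom_gen J I) (x : atom_path J N) :
  pterm (@atom_rel W S) (path_term (gcons a x)) =
  lcomp (datom a) (pterm (@atom_rel W S) (path_term x)).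
Proof. exact: pterm_comp. Qed.

Section BraidWord.
Variables (M : set W) (s t : W).
Hypotheses (fM : is_finitary S M) (Ms : M s) (Mt : M t) (Hst : wconj S M s <> t).
Notation L := (rotL S M s t).
Notation P := (rotP S M s t).
Notation up i := (Defs.rot S M s t i).1.
Notation d := (rot_depth S M s t).
Notation B := (rB M s t).

(** w_{L_0} B_{j+1} ends with w_{P_j}, and times this tail it gives w_M v with additive lengths; so
    the tail is minimal for P_j. *)
Lemma braid_tail_lmin j v : (j <= d)%N -> lmin M v ->
  lmin (P j) ((B j.+1)^-1 * B d.+1 * v).
Proof.
move=> Hj Hv; have [R1 R2] := rot_depthP fM Ms Mt Hst.
have Rj : rred M s t j.+1 by apply: rred_le R1.
have F := rred_fullP fM Ms Mt Hst Rj.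
apply: full_additive_lmin (fP s t fM j) F _.
set w' := (_ * v).
have E : longest S (L 0) * B j.+1 * w' = longest S M * v.
  by rewrite /w' -R2; move: (B j.+1) (B d.+1) => x y; rewrite !mulgA mulgK.
have HM : generated M (longest S M) := longest_gen fM.
rewrite E (Hv _ HM) -R2 R1 Rj.
have : (len w' <= len ((B j.+1)^-1 * B d.+1) + len v)%N by exact: lenM.
have := rot_tail M s t j.+1 (d - j); rewrite addSn subnKC //.
have := lenM (longest S (L 0) * B j.+1) w'.
by rewrite E (Hv _ HM) -R2 R1 Rj; llia.
Qed.

(** The index [i] counts atoms from the end, because [ared] extends a path on its left. *)
Lemma braid_word_ared (K N : finitary S) v (z : lhom AC K N) i :
  (i <= d.+1)%N -> N = L d.+1 :> set W -> lmin M v -> ared z v ->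
  forall I : finitary S, I = L (d.+1 - i) :> set W ->
  exists x : atom_path I N,
    atoms x = [seq expr_coset S (L k) (P k) (L k.+1) | k <- iota (d.+1 - i) i] /\
    ared (lcomp (pterm (@atom_rel W S) (path_term x)) z)
      ((B (d.+1 - i))^-1 * B d.+1 * v).
Proof.
move=> + EN Hv Hz; elim: i => [_ I|i IH Hi I].
  rewrite subn0 -EN => /finitary_eq EI; subst N; exists (gnil _ I); split=> //.
  by rewrite mulVg mul1g (comp1m (z : lhom AC K I)).
set j := (d.+1 - i.+1)%N => EI.
have Ej : (d.+1 - i = j.+1)%N by rewrite /j; lia.
have [ad EP EL Ex] := rot_add fM Ms Mt Hst j.
rewrite Ej in IH.
have [x [Ax Hx]] := IH (ltnW Hi) (Finitary (fL s t fM j.+1)) erefl.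
rewrite -EI in ad EP EL Ex.
have EJ : Finitary (fL s t fM j.+1) = atom_end S I (up j) :> set W by [].
exists (gcons (exist _ (latom S I (up j)) (latom_atom ad EJ) : atom_gen _ I) x).
split.
  rewrite /atoms /= in Ax *; rewrite Ax -/j; congr (_ :: _).
  by rewrite /expr_coset -Ex EI.
rewrite datom_path -Defs.compA.
have -> : (B j)^-1 * B d.+1 * v = amin I (up j) * ((B j.+1)^-1 * B d.+1 * v).
  by rewrite /amin EP EI -/(ra M s t j) [B j.+1]/= invgM !mulgA mulgV mul1g.
apply: (@ared_cons K I _ _ (up j) _ _ ad EJ _ Hx) => //.
by rewrite EP; apply: braid_tail_lmin => //; rewrite /j; lia.
Qed.
End BraidWord.

Lemma setM_rot (I : set W) M s t : M = s |` (t |` I) -> ~ I s -> ~ I t ->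
  is_finitary S M -> rotL S M t (wconj S M s) 0 = I.
Proof.
move=> EM nIs nIt fM; rewrite /rotL /= wconjK //; apply/seteqP; split=> x.
  by rewrite EM => -[[->|[->|//]] H]; case: H; [right|left].
move=> Ix; split; first by rewrite EM; right; right.
by case=> E; [apply: nIt|apply: nIs]; rewrite -E.
Qed.

(** The uniqueness assumed for [w], which the induction of [ared_uniq] supplies, allows the part
    after the first atom to be exchanged for the rest of a braid word followed by [z]. *)
Lemma braid_word_side (I J K N : finitary S) M s t (a : atom_gen J I) v
    (z : lhom AC K N) (f : lhom AC K J) w :
  is_finitary S M -> M = s |` (t |` I) -> s <> t -> ~ (I : set W) t ->
  addable S I s -> J = atom_end S I s :> set W -> sval a = latom S I s ->
  N = wconj S M @` I :> set W -> lmin M v -> ared z v ->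
  amin I s * w = longest S I * longest S M * v ->
  (forall f' : lhom AC K J, ared f' w -> f = f') ->
  exists2 x : atom_path I N, atoms x = braid_lhs S M s t &
    lcomp (datom a) f = lcomp (pterm (@atom_rel W S) (path_term x)) z.
Proof.
move=> fM EM Hst nIt ad EJ Ea EN Hv Hz Ew Hu.
have Ms : M s by rewrite EM; left.
have Mt : M t by rewrite EM; right; left.
have Ms' := wconj_S fM Ms.
have H1 : wconj S M t <> wconj S M s by move=> /(wconj_inj fM) /esym.
have EI := setM_rot EM (add_nI ad) nIt fM.
have := rot_end_L fM Mt Ms' H1; rewrite EI -EN => EN'.
have [ad0 EP EL Ex] := rot_add fM Mt Ms' H1 0.
rewrite EI /= wconjK // -EJ in EL.
have [||x [Ax Hx]] := @braid_word_ared M t (wconj S M s) fM Mt Ms' H1 K N v z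
  (rot_depth S M t (wconj S M s)) _ (esym EN') Hv Hz J.
- exact: leqnSn.
- by rewrite subSnn EL.
rewrite subSnn in Ax Hx.
have Er : (rB M t (wconj S M s) 1)^-1 * rB M t (wconj S M s)
    (rot_depth S M t (wconj S M s)).+1 * v = w.
  rewrite (rB_depth fM Mt Ms' H1) EI -mulgA -Ew.
  have -> : rB M t (wconj S M s) 1 = amin I s.
    by rewrite /= mul1g /ra -EP EI /= wconjK.
  by rewrite mulKg.
rewrite Er in Hx; exists (gcons a x); last first.
  by rewrite datom_path -Defs.compA -(Hu _ Hx).
rewrite /braid_lhs /= -Ax /atoms /=; congr (_ :: _).
by rewrite /expr_coset Ex EI -EL Ea /= wconjK.
Qed.

Lemma ared_uniq (K I : finitary S) (f f' : lhom AC K I) w : ared f w -> ared f' w ->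
  f = f'.
Proof.
have [n] := ubnP (len w); elim: n I f f' w => // n IH I f f' w Hn Hf Hf'.
have lt (J : finitary S) s w' : addable S I s -> lmin (s |` I) w' ->
    w = amin I s * w' -> (len w' < n)%N.
  move=> ad Hm Ew; have := Hm _ (amin_gen ad); rewrite -Ew.
  by have := amin_pos ad; llia.
have ne1 s w' : addable S I s -> lmin (s |` I) w' -> w = amin I s * w' -> w <> 1.
  move=> ad Hm Ew w1; have := Hm _ (amin_gen ad); rewrite -Ew w1 len1.
  by have := amin_pos ad; llia.
have [[w1 [E ->]]|[J [a [s [f1 [w1 [[ad EJ Ea] H1 Hm1 -> Ew1]]]]]]] := ared_inv Hf.
  have [[_ [E' ->]]|[J' [a' [s' [f1' [w1' [[ad' _ _] _ Hm' _ Ew']]]]]]] := ared_inv Hf'.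
    by rewrite (Prop_irrelevance E E').
  by case: (ne1 _ _ ad' Hm' Ew').
have [[w0 _]|[J' [a' [s' [f1' [w1' [[ad' EJ' Ea'] H1' Hm1' -> Ew1']]]]]]] := ared_inv Hf'.
  by case: (ne1 _ _ ad Hm1 Ew1).
case: (pselect (s = s')) => [Es|Hss].
  subst s'; have EJJ : J' = J by apply: finitary_eq; rewrite EJ EJ'.
  subst J'; have -> : a' = a by apply: atom_gen_eq; rewrite Ea Ea'.
  have Ew : w1' = w1 by apply: (can_inj (mulKg (amin I s))); rewrite -Ew1 -Ew1'.
  by rewrite Ew in H1'; congr lcomp; apply: IH H1 H1'; exact: lt Ew1.
have c := ared_core Hf; have fI := finitary_fin I.
set M := s |` (s' |` I).
have EM' : M = s' |` (s |` I) by rewrite /M setUCA.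
have Ss := proj1 (add_fM ad) _ (add_M I s).
have Ss' := proj1 (add_fM ad') _ (add_M I s').
(* Two different first atoms make both [s] and [s'] left descents, so w = w_I w_M v, and each path
   can be rewritten to begin with one side of the braid relation in [M]. *)
have [||||fM [v [Ew Hv cv]]] := core_peel fI (finitary_fin K) (M := M) c.
- by move=> x Ix; right; right.
- by move=> x [->|[->|/(proj1 fI)]].
- exact/finite_U1/finite_U1/fg_finite.
- move=> x [->|[->|//]] _; first by rewrite Ew1; exact: amin_descent.
  by rewrite Ew1'; exact: amin_descent.
have fN : is_finitary S (wconj S M @` I).
  by apply: (fg_sub _ fM) => _ [x Ix <-]; apply: (wconj_S fM); right; right.
have [z Hz] := @ared_ex (Finitary fN) K v cv.
have [x Ax ->] := @braid_word_side I J K (Finitary fN) M s s' a v z f1 w1 fM erefl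
  Hss (add_nI ad') ad EJ Ea erefl Hv Hz (etrans (esym Ew1) Ew)
  (fun g Hg => IH _ _ _ _ (lt J _ _ ad Hm1 Ew1) H1 Hg).
have [y Ay ->] := @braid_word_side I J' K (Finitary fN) M s' s a' v z f1' w1' fM EM'
  (fun E => Hss (esym E)) (add_nI ad) ad' EJ' Ea' erefl Hv Hz (etrans (esym Ew1') Ew)
  (fun g Hg => IH _ _ _ _ (lt J' _ _ ad' Hm1' Ew1') H1' Hg).
congr lcomp; apply: clsP; apply: eqt_rel.
apply: (atom_braid (s := s) (t := s')) Ax _ => //; [exact: add_nI ad|exact: add_nI ad'|].
rewrite -/M braid_rhsE //; first by left.
by right; left.
Qed.

(** If [w] is not minimal for M = Is, then, being minimal for J, it has the left descent w_M s w_M.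
    By uniqueness its path may be taken to start with the inverse atom, and the nil-quadratic
    relation gives 0. *)
Lemma ared_atom (K I J : finitary S) (a : atom_gen J I) (f : lhom AC K J) w :
  ared f w -> lcomp (datom a) f = 0%R \/ exists w', ared (lcomp (datom a) f) w'.
Proof.
move=> Hf; have [s [ad EJ Ea]] := atomP (svalP a).
case: (pselect (lmin (s |` I) w)) => Hm.
  by right; exists (amin I s * w); exact: ared_cons Hf Hm.
left; have [h1 h2 h3 h4] := add_swap ad; rewrite -EJ in h1 h2 h3 h4.
set t := wconj S (s |` I) s in h1 h2 h3 h4.
have c := ared_core Hf; have [_ Hmw] := c.
have St : S t by apply: (proj1 (add_fM h1)); left.
have Ht : (len (t * w) < len w)%N.
  case: (len_S1 w St) => E; last by rewrite E.
  case: Hm; rewrite -h2; apply: lminP; first exact: (proj1 (add_fM h1)).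
  move=> x [->|Jx]; first by rewrite E.
  exact: lminS (proj1 (finitary_fin J)) Hmw Jx.
have [v [_ Ew Hv cv]] := core_step c St Ht; rewrite h3 in cv.
have [g Hg] := ared_ex cv.
pose b : atom_gen I J := exist _ (latom S J t) (latom_atom h1 (esym h3)).
have Hb : ared (lcomp (datom b) g) w by rewrite Ew; apply: ared_cons Hg Hv.
rewrite (ared_uniq Hf Hb) Defs.compA.
have -> : lcomp (datom a) (datom b) = 0%R.
  rewrite -pterm_comp; apply: clsP; apply: eqt_rel; apply: (atom_nil h1) => //.
  by rewrite Ea h4.
by rewrite comp0m.
Qed.

(** * Action of atoms on Z[W] and faithfulness *)

Lemma Ev_zero (J I : finitary S) (f : lhom SDC J I) : Ev f (fun=> 0%R) = fun=> 0%R.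
Proof.
apply/funext => v; apply: (@GRing.addrI _ (Ev f (fun=> 0%R) v)).
by rewrite GRing.addr0 -tactD /Ev; congr (tact _ _ v).
Qed.

Lemma delta_inj w w' : delta w = delta w' -> w = w'.
Proof.
move=> /(congr1 (@^~ w)); rewrite /delta; case: asboolP => // _.
by case: asboolP.
Qed.

Lemma delta_neq0 w : delta w <> fun=> 0%R.
Proof. by move=> /(congr1 (@^~ w)); rewrite /delta; case: asboolP. Qed.

Lemma atom_gminv I s v : addable S I s ->
  gminv I [:: s |` I; atom_end S I s] v <-> lmin (s |` I) v.
Proof.
move=> ad; have JM := @add_JM I s.
rewrite /= (setUidr (@add_IM I s)) (setUidl JM) (gst_down (add_fM ad) JM) !mul1g.
by split=> [[_ []]|H] //; split.
Qed.

Section AtomAction.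
Variables (I J : finitary S) (a : atom_gen J I) (s : W).
Hypotheses (ad : addable S I s) (EJ : J = atom_end S I s :> set W).
Hypothesis Ea : sval a = latom S I s.

Lemma Ev_phi v : lmin (s |` I) v -> Ev (phi a) (delta v) = delta (amin I s * v).
Proof.
move=> Hv; have := phiE ad Ea; rewrite EJ => H.
by rewrite (Ev_path_delta H); [rewrite latom_gprod|apply/atom_gminv].
Qed.

Lemma Ev_phi0 v : ~ lmin (s |` I) v -> Ev (phi a) (delta v) = fun=> 0%R.
Proof.
move=> Hv; have := phiE ad Ea; rewrite EJ => H.
by apply: (Ev_path_delta0 H) => /(atom_gminv _ ad) /Hv.
Qed.
End AtomAction.

Lemma Fun_comp_datom (I J K : finitary S) (a : atom_gen J I) (f : lhom AC K J) :
  Fun (lcomp (datom a) f) = lcomp (phi a) (Fun f).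
Proof. by have [_ _ ->] := Fun_linear; rewrite Fun_datom. Qed.

Lemma ared_Ev1 (K I : finitary S) (f : lhom AC K I) w : ared f w ->
  Ev (Fun f) (delta 1) = delta w.
Proof.
elim=> {I f w} [|I J a s f w ad EJ Ea _ IH Hm].
  by have [_ -> _] := Fun_linear; rewrite Ev_id.
by rewrite Fun_comp_datom Ev_comp IH; exact: Ev_phi Hm.
Qed.

(** Each surviving step adds its length by minimality. The additivity is what later excludes a
    nontrivial ascending part to the right of the atoms. *)
Lemma ared_Ev (K I : finitary S) (f : lhom AC K I) w v : ared f w ->
  Ev (Fun f) (delta v) = (fun=> 0%R) \/
  (Ev (Fun f) (delta v) = delta (w * v) /\ len (w * v) = (len w + len v)%N).
Proof.
elim=> {I f w} [|I J a s f w ad EJ Ea _ IH Hm].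
  by right; have [_ -> _] := Fun_linear; rewrite Ev_id mul1g len1.
rewrite Fun_comp_datom Ev_comp; case: IH => [->|[-> El]].
  by left; exact: Ev_zero.
case: (pselect (lmin (s |` I) (w * v))) => Hwv; last by left; exact: Ev_phi0 Hwv.
right; rewrite -mulgA (Ev_phi ad EJ Ea Hwv); split=> //.
by rewrite (Hwv _ (amin_gen ad)) (Hm _ (amin_gen ad)) El addnA.
Qed.

Inductive aspan (K I : finitary S) : lhom AC K I -> Prop :=
| aspan_ared f w : ared f w -> aspan f
| aspan0 : aspan 0%R
| aspanD f g : aspan f -> aspan g -> aspan (f + g)%R
| aspanN f : aspan f -> aspan (- f)%R.

Lemma aspan_datom (K I J : finitary S) (a : atom_gen J I) (f : lhom AC K J) :
  aspan f -> aspan (lcomp (datom a) f).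
Proof.
elim=> [{}f w /ared_atom H||f1 f2 _ h1 _ h2|f1 _ h1].
- by case: (H I a) => [->|[w' Hw']]; [exact: aspan0|exact: aspan_ared Hw'].
- by rewrite compm0; exact: aspan0.
- by rewrite compDr; exact: aspanD.
- by rewrite compmN; exact: aspanN.
Qed.

Lemma aspan_term (A B : finitary S) (t : term (@atom_gen W S) A B)
    (K : finitary S) (f : lhom AC K A) : aspan f -> aspan (lcomp (pterm (@atom_rel W S) t) f).
Proof.
elim: t K f => {A B} [A B g|A|A B D g IHg h IHh|A B|A B x IH|A B x IHx y IHy] K f Hf.
- exact: aspan_datom.
- by rewrite (comp1m (f : lhom AC K A)).
- by rewrite pterm_comp -Defs.compA; apply/IHg/IHh.
- by rewrite [lcomp _ _](@comp0m _ AC); exact: aspan0.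
- by rewrite ptermN compNm; apply/aspanN/IH.
- by rewrite ptermD compDl; apply: aspanD; [exact: IHx|exact: IHy].
Qed.

Lemma aspan_all (K I : finitary S) (f : lhom AC K I) : aspan f.
Proof.
rewrite -[f]compm1 -[X in lcomp X _](ptermK f); apply: aspan_term.
exact: aspan_ared (ared_id K).
Qed.

Definition NF (K I : finitary S) (w : W) : lhom AC K I := xget 0%R (fun f => ared f w).

Lemma NF_ared (K I : finitary S) (f : lhom AC K I) w : ared f w -> NF K I w = f.
Proof. by move=> H; apply: xget_unique => // g Hg; exact: ared_uniq Hg H. Qed.

(** A reduced path of [w] sends 1 to [w], so the coefficients can be read off the image under [Fun],
    which gives injectivity at once. *)
Definition coef (K I : finitary S) (f : lhom AC K I) : W -> int :=
  Ev (Fun f) (delta 1).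

Lemma coefD (K I : finitary S) (f g : lhom AC K I) w :
  coef (f + g)%R w = (coef f w + coef g w)%R.
Proof. by have [FD _ _] := Fun_linear; rewrite /coef FD EvD. Qed.
Lemma coefN (K I : finitary S) (f : lhom AC K I) w : coef (- f)%R w = (- coef f w)%R.
Proof. by rewrite /coef (lfunctorN Fun_linear) EvN. Qed.
Lemma coef0 (K I : finitary S) w : coef (0 : lhom AC K I)%R w = 0%R.
Proof. by rewrite /coef (lfunctor0 Fun_linear) Ev0. Qed.

(** Allowing every larger duplicate-free list in place of the support [s] lets both summands of a
    sum be expanded over a common list. *)
Lemma expansion (K I : finitary S) (f : lhom AC K I) : exists s : seq W,
  forall s' : seq W, uniq s' -> {subset s <= s'} ->
  f = (\sum_(w <- s') NF K I w *~ coef f w)%R.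
Proof.
elim: (aspan_all f) => {f} [f w Hf||f g _ [s1 H1] _ [s2 H2]|f _ [s H]].
- exists [:: w] => s' us sub; have ws : w \in s' by apply: sub; rewrite inE.
  rewrite (bigD1_seq w) //= big1 ?GRing.addr0 => [|w' /eqP nw].
    rewrite /coef (ared_Ev1 Hf) /delta (NF_ared Hf).
    by case: asboolP => // _; rewrite mulr1z.
  by rewrite /coef (ared_Ev1 Hf) /delta; case: asboolP.
- exists [::] => s' _ _; rewrite big1 // => w _.
  by rewrite coef0 mulr0z.
- exists (s1 ++ s2) => s' us sub.
  rewrite {1}(H1 s') // => [|w ws]; last by apply: sub; rewrite mem_cat ws.
  rewrite {1}(H2 s') // => [|w ws]; last by apply: sub; rewrite mem_cat ws orbT.
  rewrite -big_split; apply: eq_bigr => w _.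
  by rewrite coefD mulrzDr.
- exists s => s' us sub; rewrite {1}(H s') // -GRing.sumrN; apply: eq_bigr => w _.
  by rewrite coefN mulrNz.
Qed.

Lemma Fun_inj (K I : finitary S) : injective (@Fun K I).
Proof.
move=> f g E; apply: GRing.subr0_eq; have [s H] := expansion (f - g)%R.
rewrite (H (undup s)) ?undup_uniq //; last by move=> w; rewrite mem_undup.
rewrite big1 // => w _; rewrite coefD coefN /coef E GRing.subrr.
by rewrite mulr0z.
Qed.

(** * Sandwich form of an expression *)

Inductive desc (K : finitary S) : forall I : finitary S, lhom SDC K I -> Prop :=
| desc_id : desc (lid SDC K)
| desc_step (I I' : finitary S) (H : adjacent I I') (f : lhom SDC K I') :
    I' `<=` I -> desc f -> desc (lcomp (dgen H) f).

Inductive asc (J : finitary S) : forall L : finitary S, lhom SDC J L -> Prop :=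
| asc_id : asc (lid SDC J)
| asc_step (L L' : finitary S) (H : adjacent L L') (f : lhom SDC J L') :
    L `<=` L' -> asc f -> asc (lcomp (dgen H) f).

Inductive atp (K : finitary S) : forall I : finitary S, lhom SDC K I -> Prop :=
| atp_id : atp (lid SDC K)
| atp_step (I J : finitary S) s (g : lhom SDC J I) (f : lhom SDC K J) :
    addable S I s -> J = atom_end S I s :> set W ->
    is_path [:: s |` I; J : set W] g -> atp f -> atp (lcomp g f).

(** The residue of one ascending step pushed to the right: it survives as one ascending step or is
    used up in forming an atom. *)
Inductive upid (K : finitary S) : forall I : finitary S, lhom SDC K I -> Prop :=
| upid_id : upid (lid SDC K)
| upid_up (I : finitary S) (H : adjacent I K) : I `<=` K -> upid (dgen H).

Lemma atp_cat (I J K : finitary S) (f : lhom SDC J I) (g : lhom SDC K J) :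
  atp f -> atp g -> atp (lcomp f g).
Proof.
move=> Hf Hg; elim: Hf => {I f} [|I N s g' f ad E Hp _ IH].
  by rewrite (comp1m (g : lhom SDC K J)).
by rewrite -Defs.compA; exact: atp_step Hp IH.
Qed.

Lemma adjacent_del r I : I r -> adjacent I (I `\ r).
Proof. by move=> Ir; exists r; right. Qed.

Section RotationPaths.
Variables (M : set W) (s t : W).
Hypotheses (fM : is_finitary S M) (Ms : M s) (Mt : M t) (Hst : wconj S M s <> t).
Notation L := (rotL S M s t).
Notation P := (rotP S M s t).
Notation d := (rot_depth S M s t).

Lemma rl_atp (I J : finitary S) k n (f : lhom SDC J I) : I = L k :> set W ->
  is_path (rl M s t k n) f -> atp f.
Proof.
elim: n k I f => [|n IH] k I f EI Hf.
  have E := is_path_nilI Hf; subst J.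
  by rewrite (is_path_inj Hf (is_path_nil I)); exact: atp_id.
have [N [g [h [EN Hg Hh ->]]]] :=
  @is_path_split I J [:: P k; L k.+1] (rl M s t k.+1 n) f Hf.
have [ad EP EL _] := rot_add fM Ms Mt Hst k; rewrite -EI in ad EP EL.
apply: atp_step ad _ _ (IH _ _ _ EN Hh); first by rewrite EN EL.
by rewrite EP EN.
Qed.

(** From P_0, the long side of the switchback relation is one step down, d - 1 atoms and one step
    up: already in sandwich form. *)
Lemma sl_rl : sl M s t 1 d = L 1 :: rl M s t 1 d.-1 ++ [:: P d].
Proof.
case: d (rot_depth_pos fM Ms Mt Hst) => // n _.
have := rl_sl M s t n 0; rewrite add0n => -[E].
have Ei : iota 1 n.+1 = iota 1 n ++ [:: n.+1] by rewrite -(addn1 n) iotaD addn1.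
by rewrite /sl Ei map_cat flatten_cat /= -cat_cons -/(rl M s t 1 n) -E -catA.
Qed.

Lemma mid_path (I J : finitary S) (f : lhom SDC J I) : I = M `\ s :> set W ->
  is_path [:: M; M `\ t] f -> is_path (L 1 :: rl M s t 1 d.-1 ++ [:: P d]) f.
Proof.
move=> EI Hf; rewrite -sl_rl.
have [_ EJ] := is_path_chain Hf; rewrite /= in EJ.
have EP : P d = M `\ t by rewrite /rotP rot_last.
have [f' Hf'] : exists f' : lhom SDC J I, is_path (sl M s t 1 d) f'.
  have := sl_chain fM Ms Mt Hst 0 d.
  have -> : P 0 = I by rewrite EI.
  move=> ch; apply: is_path_ex => //.
  have := @sl_last M s t 0 d; rewrite add0n EP EJ => <-.
  by have -> : P 0 = I by rewrite EI.
by rewrite (switch_mid fM Ms Mt Hst EI Hf Hf').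
Qed.
End RotationPaths.

(* By switchback, [I + s - t - r] becomes [I - x] followed by atoms. *)
Lemma atom_push_down (I J J' : finitary S) s (g : lhom SDC J I) (H : adjacent J J') :
  addable S I s -> J = atom_end S I s :> set W -> is_path [:: s |` I; J : set W] g ->
  J' `<=` J -> exists (I' : finitary S) (H' : adjacent I I') (f : lhom SDC J' I'),
    [/\ I' `<=` I, atp f & lcomp g (dgen H) = lcomp (dgen H') f].
Proof.
move=> ad EJ Hg sub; set M := s |` I.
have fM : is_finitary S M := add_fM ad.
have [r [Jr EJ']] : exists r, (J : set W) r /\ J' = J `\ r :> set W.
  case: H => r [[nJ E]|[Jr E]]; last by exists r.
  by case: nJ; apply: sub; rewrite E; left.
have Ms : M s by left.
have Mr : M r by have := Jr; rewrite EJ => -[].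
have Hsr : wconj S M s <> r by have := Jr; rewrite EJ => -[_ n] E; apply: n.
have EI : I = M `\ s :> set W by rewrite /M setU1D //; exact: add_nI ad.
have aMr := adjacent_del Mr.
have fMr : is_finitary S (M `\ r) by exact: finP.
pose F := Finitary fM; pose Fr := Finitary fMr.
have aIM : adjacent I F := add_adjI ad.
have aMr' : adjacent F Fr := aMr.
have aRJ : adjacent Fr J'.
  exists (wconj S M s); right; split.
    by split; [exact: wconj_S|].
  rewrite EJ' EJ; apply/seteqP; split=> x [[? ?] ?]; split=> //; split.
pose mid := lcomp (dgen aIM) (dgen aMr').
have Hmid : is_path [:: M; M `\ r] mid.
  exact: (@is_path_cat I F Fr [:: M] [:: M `\ r] _ _ (is_path_gen aIM) (is_path_gen aMr')).
have Hall := is_path_cat (mid_path fM Ms Mr Hsr EI Hmid) (is_path_gen aRJ).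
(* Removing w_M s w_M after the long side leads to L_{d+1}, which completes its final step up to an
   atom. *)
have EL : J' = rotL S M s r (rot_depth S M s r).+1 :> set W.
  have [Eu Eu'] := rot_end fM Ms Mr Hsr; rewrite /rotL Eu EJ' EJ.
  rewrite rotS /= (rot_last fM Ms Mr Hsr).
  apply/seteqP; split=> x; first by case=> -[? n] n'; split=> // -[].
  by case=> ? n; split; [split=> // E; apply: n; left|move=> E; apply: n; right].
have El : (rotL S M s r 1 :: rl M s r 1 (rot_depth S M s r).-1 ++
    [:: rotP S M s r (rot_depth S M s r)]) ++ [:: J' : set W] =
  rotL S M s r 1 :: rl M s r 1 (rot_depth S M s r).
  have := rl_sl M s r (rot_depth S M s r) 0; rewrite add0n sl_rl //.
  by rewrite -EL => /(congr1 behead).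
rewrite {}El in Hall.
have [I' [H' [f [EI' Hf E]]]] := is_path_consI Hall.
exists I', H', f; split.
- by rewrite EI' EI => x [Mx n]; split=> // E2; apply: n; right.
- exact: (rl_atp fM Ms Mr Hsr EI' Hf).
rewrite -E /mid -Defs.compA.
have [N [H1 [g1 [EN Hg1 ->]]]] := is_path_consI Hg.
have ENF : N = F by apply: finitary_eq.
subst N; have -> : H1 = aIM by exact: Prop_irrelevance.
rewrite -Defs.compA; congr lcomp.
apply: (@path_down F J' (wconj S M s) r).
  have := is_path_cat Hg1 (is_path_gen H); rewrite /= EJ' EJ; exact.
have := is_path_cat (is_path_gen aMr') (is_path_gen aRJ); rewrite /= EJ' EJ.
suff -> : atom_end S I s `\ r = (M `\ r) `\ wconj S M s by [].
by apply/seteqP; split=> x [[? ?] ?]; split=> //; split.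
Qed.

(* By switchback, [I + x + s - t] becomes atoms followed by an ascending step. *)
Lemma atom_push_up (I K J : finitary S) s (H : adjacent I K) (g : lhom SDC J K) :
  I `<=` K -> addable S K s -> J = atom_end S K s :> set W ->
  is_path [:: s |` K; J : set W] g ->
  exists (I' : finitary S) (H' : adjacent I' J) (f : lhom SDC I' I),
    [/\ I' `<=` J, atp f & lcomp (dgen H) g = lcomp f (dgen H')].
Proof.
move=> sub ad EJ Hg; set M := s |` K.
have fM : is_finitary S M := add_fM ad.
have [x [nIx EK]] : exists x, ~ (I : set W) x /\ K = x |` I :> set W.
  case: H => x [[nI E]|[Ix E]]; first by exists x.
  by have := sub _ Ix; rewrite E => -[_ n]; case: n.
have nKs := add_nI ad.
have Ms : M s by left.
have Kx : (K : set W) x by rewrite EK; left.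
have Mx : M x by right.
have sx : x <> s by move=> E; apply: nKs; rewrite -E.
set t := wconj S M s.
have Mt : M t := wconj_S fM Ms.
have Hxt : wconj S M x <> t by move=> /(wconj_inj fM).
have nIs : ~ (I : set W) s by move=> /sub.
have EMI : M = x |` (s |` I) by rewrite /M EK setUCA.
have EP0 : s |` I = M `\ x.
  by rewrite EMI setU1D // => -[E|//]; exact: sx.
have fP0 : is_finitary S (s |` I) by rewrite EP0; exact: finP.
pose F := Finitary fM; pose F0 := Finitary fP0.
have aI0 : adjacent I F0 by exists s; left.
have a0M : adjacent F0 F.
  by exists x; left; split; [case=> [E|//]; exact: sx|rewrite /= EMI].
have aMJ : adjacent F J by rewrite EJ; exact: add_adjJ.
pose mid := lcomp (dgen a0M) (dgen aMJ).
have Hmid : is_path [:: M; M `\ t] mid.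
  have := @is_path_cat F0 F J [:: M] [:: J : set W] _ _ (is_path_gen a0M) (is_path_gen aMJ).
  by rewrite EJ.
have EF0 : F0 = M `\ x :> set W := EP0.
have Hall := is_path_cat (is_path_gen aI0) (mid_path fM Mx Mt Hxt EF0 Hmid).
(* Adding [s] before the long side makes it start at L_0, which completes its initial step down to
   an atom. *)
have EL0 : I = rotL S M x t 0 :> set W.
  rewrite /rotL /= wconjK //; apply/seteqP; split=> z.
    by move=> Iz; split; [right; exact: sub|case=> E; [apply: nIx|apply: nIs]; rewrite -E].
  by rewrite EMI => -[[->|[->|//]] n]; case: n; [left|right].
have El : [:: F0 : set W] ++ rotL S M x t 1 :: rl M x t 1 (rot_depth S M x t).-1 ++
    [:: rotP S M x t (rot_depth S M x t)] =
  rl M x t 0 (rot_depth S M x t) ++ [:: J : set W].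
  have -> : J = rotP S M x t (rot_depth S M x t) :> set W.
    by rewrite /rotP rot_last // EJ.
  by rewrite /= EP0; case: (rot_depth S M x t) (rot_depth_pos fM Mx Mt Hxt) => //.
rewrite {}El in Hall.
have [I' [f [h [EI' Hf Hh E]]]] := is_path_split Hall.
have [N [H' [h' [EN Hh' Eh]]]] := is_path_consI Hh.
have ENJ : N = J by apply: finitary_eq.
subst N; exists I', H', f; split.
- rewrite EI' EL0 rl_last add0n EJ => z [Mz n]; split=> // E2; apply: n; left.
  by rewrite rot_last.
- exact: (rl_atp fM Mx Mt Hxt EL0 Hf).
rewrite -(is_path_inj Hh (is_path_gen H')) -E /mid Defs.compA.
have [N [H1 [g1 [EN1 Hg1 ->]]]] := is_path_consI Hg.
have ENF : N = F by apply: finitary_eq.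
subst N; rewrite (is_path_inj Hg1 (is_path_gen aMJ)) Defs.compA; congr lcomp.
apply: (@path_up I F x s).
  have := is_path_cat (is_path_gen H) (is_path_gen H1).
  by rewrite /= EK /M EK.
have := is_path_cat (is_path_gen aI0) (is_path_gen a0M).
by rewrite /= EMI.
Qed.

Lemma push_down (I K K' : finitary S) (f : lhom SDC K I) (g : lhom SDC K' K) :
  atp f -> desc g -> exists (I' : finitary S) (g' : lhom SDC I' I) (f' : lhom SDC K' I'),
    [/\ desc g', atp f' & lcomp f g = lcomp g' f'].
Proof.
have push1 (A B B' : finitary S) (h : lhom SDC B A) (H : adjacent B B') :
    atp h -> B' `<=` B -> exists (A' : finitary S) (H' : adjacent A A') (h' : lhom SDC B' A'),
    [/\ A' `<=` A, atp h' & lcomp h (dgen H) = lcomp (dgen H') h'].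
  move=> Hh; elim: Hh => {A h} [|A C s h1 h2 ad EC Hp _ IH] sub.
    exists B', H, (lid SDC B'); rewrite (comp1m (dgen H)) (compm1 (dgen H)).
    by split=> //; exact: atp_id.
  have [A1 [H1 [h3 [s1 Hh3 E3]]]] := IH sub.
  have [A2 [H2 [h4 [s2 Hh4 E4]]]] := atom_push_down H1 ad EC Hp s1.
  exists A2, H2, (lcomp h4 h3); split=> //; first exact: atp_cat.
  by rewrite -Defs.compA E3 Defs.compA E4 Defs.compA.
move=> Hf Hg; elim: Hg I f Hf => {K g} [|K K1 H g sub _ IH] I f Hf.
  exists I, (lid SDC I), f; rewrite (comp1m (f : lhom SDC K' I)) (compm1 (f : lhom SDC K' I)).
  by split=> //; exact: desc_id.
have [A [H1 [f1 [s1 Hf1 E1]]]] := push1 _ _ _ _ H Hf sub.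
have [B [g2 [f2 [Hg2 Hf2 E2]]]] := IH _ _ Hf1.
exists B, (lcomp (dgen H1) g2), f2; split=> //; first exact: desc_step.
by rewrite Defs.compA E1 -!Defs.compA E2.
Qed.

Lemma push_up (I K L : finitary S) (b : lhom SDC K I) (f : lhom SDC L K) :
  upid b -> atp f -> exists (L' : finitary S) (f' : lhom SDC L' I) (b' : lhom SDC L L'),
    [/\ atp f', upid b' & lcomp b f = lcomp f' b'].
Proof.
move=> + Hf; elim: Hf I b => {K f} [|K J s g f ad EJ Hp Hf IH] I b Hb.
  exists I, (lid SDC I), b; rewrite (comp1m (b : lhom SDC L I)) (compm1 (b : lhom SDC L I)).
  by split=> //; exact: atp_id.
case: Hb => [|A H sub] {I b}.
  exists L, (lcomp g f), (lid SDC L); rewrite comp1m compm1.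
  by split=> //; [exact: atp_step Hp Hf|exact: upid_id].
have [I' [H' [f1 [s1 Hf1 E1]]]] := atom_push_up H sub ad EJ Hp.
have [L' [f2 [b' [Hf2 Hb' E2]]]] := IH _ _ (upid_up H' s1).
exists L', (lcomp f1 f2), b'; split=> //; first exact: atp_cat.
by rewrite Defs.compA E1 -!Defs.compA E2.
Qed.

(** A step up followed by a removal forms an atom or is switched to a step down, atoms and a step
    up. The new step up faces a shorter descent, and [push_down] moves the atoms past the descending
    steps that arise. *)
Lemma up_desc (I M K : finitary S) (H : adjacent I M) (g : lhom SDC K M) :
  I `<=` M -> desc g -> exists (A B : finitary S) (g' : lhom SDC A I)
    (f : lhom SDC B A) (b : lhom SDC K B),
    [/\ desc g', atp f, upid b & lcomp (dgen H) g = lcomp g' (lcomp f b)].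
Proof.
move=> + Hg; elim: Hg I H => {M g} [|M M' H' g sub Hg IH] I H sI.
  exists I, I, (lid SDC I), (lid SDC I), (dgen H).
  by rewrite !comp1m compm1; split; [exact: desc_id|exact: atp_id|exact: upid_up|].
have fM : is_finitary S M := finitary_fin M.
have [s [nIs EM]] : exists s, ~ (I : set W) s /\ M = s |` I :> set W.
  case: H => s [[nI E]|[Is E]]; first by exists s.
  by have := sI _ Is; rewrite E => -[_ n]; case: n.
have [t [Mt EM']] : exists t, (M : set W) t /\ M' = M `\ t :> set W.
  case: H' => t [[nM E]|[Mt E]]; last by exists t.
  by case: nM; apply: sub; rewrite E; left.
have Ms : (M : set W) s by rewrite EM; left.
have Hm : is_path [:: M : set W; M' : set W] (lcomp (dgen H) (dgen H')).
  exact: (is_path_cat (is_path_gen H) (is_path_gen H')).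
case: (pselect (wconj S M s = t)) => [Et|Hst].
  have ad : addable S I s by split; rewrite // -EM.
  have EJ : M' = atom_end S I s :> set W by rewrite /atom_end -EM Et.
  have Ha : atp (lcomp (dgen H) (dgen H')).
    rewrite -[lcomp _ _]compm1; apply: atp_step ad EJ _ (atp_id _).
    by rewrite -EM.
  have [A [g' [f' [h1 h2 E]]]] := push_down Ha Hg.
  exists A, K, g', f', (lid SDC K); split=> //; first exact: upid_id.
  by rewrite compm1 -E Defs.compA.
have EI : I = M `\ s :> set W by rewrite EM setU1D.
have Hm2 : is_path [:: M : set W; M `\ t] (lcomp (dgen H) (dgen H')) by rewrite -EM'.
have Hall := mid_path fM Ms Mt Hst EI Hm2.
have [L1 [H1 [f1 [EL1 Hf1 E1]]]] := is_path_consI Hall.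
have [Ld [f2 [f3 [ELd Hf2 Hf3 E2]]]] := is_path_split Hf1.
have [N [Hu [f4 [EN Hf4 Ef3]]]] := is_path_consI Hf3.
have ENM : N = M'.
  by apply: finitary_eq; rewrite EN EM' /rotP rot_last.
subst N; rewrite (is_path_inj Hf4 (is_path_nil M')) compm1 in Ef3.
have ELd' : Ld = rotL S M s t (rot_depth S M s t) :> set W.
  by rewrite ELd EL1 rl_last add1n prednK //; exact: rot_depth_pos.
have sLd : Ld `<=` M'.
  by rewrite ELd' EN; exact: LP_sub.
have [A [B [g' [f [b [Hg' Hf Hb E3]]]]]] := IH _ Hu sLd.
have Hf2' := rl_atp fM Ms Mt Hst EL1 Hf2.
have [C [g2 [f5 [Hg2 Hf5 E4]]]] := push_down Hf2' Hg'.
exists C, B, (lcomp (dgen H1) g2), (lcomp f5 f), b; split=> //.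
- apply: desc_step Hg2; rewrite EL1 EI => x [Mx n]; split=> // E; apply: n; right.
  by rewrite E.
- exact: atp_cat.
rewrite Defs.compA E1 E2 Ef3 -!Defs.compA E3; congr lcomp.
by rewrite !Defs.compA E4.
Qed.

Definition sandwich (J I : finitary S) (f : lhom SDC J I) :=
  exists (A B : finitary S) (g : lhom SDC A I) (h : lhom SDC B A) (k : lhom SDC J B),
    [/\ desc g, atp h, asc k & f = lcomp g (lcomp h k)].

Lemma sandwich_gen (I K J : finitary S) (H : adjacent I K) (f : lhom SDC J K) :
  sandwich f -> sandwich (lcomp (dgen H) f).
Proof.
move=> [A [B [g [h [k [Hg Hh Hk ->]]]]]].
have [sub|sub] : K `<=` I \/ I `<=` K.
  by case: (H) => s [[_ ->]|[_ ->]]; [right=> x; right|left=> x []].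
  exists A, B, (lcomp (dgen H) g), h, k; split=> //; first exact: desc_step.
  by rewrite Defs.compA.
have [A' [B' [g' [h' [b [Hg' Hh' Hb E]]]]]] := up_desc H sub Hg.
have [C [h2 [b' [Hh2 Hb' E2]]]] := push_up Hb Hh.
exists A', C, g', (lcomp h' h2), (lcomp b' k); split=> //; first exact: atp_cat.
  case: Hb' {E2} => [|N H' sN]; first by rewrite (comp1m (k : lhom SDC J B)).
  exact: asc_step.
by rewrite Defs.compA E -!Defs.compA (Defs.compA b) E2 -!Defs.compA.
Qed.

Lemma sandwich_path (I J : finitary S) (e : expr I J) : sandwich (dexpr e).
Proof.
elim: e => {I J} [A|A B K g q IH].
  exists A, A, (lid SDC A), (lid SDC A), (lid SDC A); rewrite !comp1m.
  by split; [exact: desc_id|exact: atp_id|exact: asc_id|].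
by rewrite (dexpr_cons g q); exact: sandwich_gen.
Qed.

(** By [ared_atom], a string of atoms comes from 0 or from one reduced path, without sums. *)
Lemma atp_Fun (K I : finitary S) (f : lhom SDC K I) : atp f ->
  exists2 x : lhom AC K I, Fun x = f & x = 0%R \/ exists w, ared x w.
Proof.
elim=> {I f} [|I J s g f ad EJ Hg _ [x <- Hx]].
  by exists (lid AC K); [have [_ -> _] := Fun_linear|right; exists 1; exact: ared_id].
pose a : atom_gen J I := exist _ (latom S I s) (latom_atom ad EJ).
exists (lcomp (datom a) x).
  by rewrite Fun_comp_datom (is_path_inj Hg (phiE ad (erefl : sval a = _))).
by case: Hx => [->|[w /ared_atom]]; [left; exact: compm0|exact].
Qed.

(** * Reduced expressions of core cosets *)

Lemma desc_Ev (K I : finitary S) (f : lhom SDC K I) v : desc f ->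
  Ev f (delta v) = delta v \/ Ev f (delta v) = fun=> 0%R.
Proof.
elim=> {I f} [|I I' H f sub _ IH]; first by left; rewrite Ev_id.
rewrite Ev_comp; case: IH => ->; last by right; exact: Ev_zero.
have Hp := is_path_gen H.
case: (pselect (gminv I [:: I' : set W] v)) => Hv.
  left; rewrite (Ev_path_delta Hp Hv) /= (gst_down (finitary_fin I) sub).
  by rewrite mulg1 mul1g.
by right; exact: Ev_path_delta0 Hp Hv.
Qed.

(** The factors contributed by the steps up telescope. *)
Lemma asc_Ev (J L : finitary S) (f : lhom SDC J L) : asc f ->
  L `<=` J /\ Ev f (delta 1) = delta (longest S L * longest S J).
Proof.
elim=> {L f} [|L L' H f sub _ [sJ IH]].
  by split; [exact: subset_refl|rewrite Ev_id (longestK (finitary_fin J))].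
split; first exact: subset_trans sJ.
have Hv : gminv L [:: L' : set W] (longest S L' * longest S J).
  rewrite /= (setUidr sub) mul1g; split=> //.
  by rewrite -[_ * _]mulg1; apply: lmin_gst (finitary_fin J) (@lmin1 J).
rewrite Ev_comp IH (Ev_path_delta (is_path_gen H) Hv) /= (gst_up sub) mulg1.
by rewrite -!mulgA (longestKl (finitary_fin L')).
Qed.

(** Every descending step shrinks the subset strictly, so equal ends leave only the identity. *)
Lemma desc_triv (K I : finitary S) (f : lhom SDC K I) : desc f ->
  K `<=` I /\ forall E : K = I, f = eq_rect K (fun X => lhom SDC K X) (lid SDC K) I E.
Proof.
elim=> {I f} [|I I' H f sub _ [sK _]].
  by split=> // E; rewrite (Prop_irrelevance E erefl).
split; first exact: subset_trans sub.
move=> E; subst I; exfalso; case: H => s [[nK EI]|[Ks EI]].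
  by case: nK; apply: sub; rewrite EI; left.
by have := sK _ Ks; rewrite EI => -[_ n]; case: n.
Qed.

Lemma asc_triv (J L : finitary S) (f : lhom SDC J L) : asc f ->
  forall E : J = L, f = eq_rect J (fun X => lhom SDC J X) (lid SDC J) L E.
Proof.
case=> {L f} [|L L' H f sub Hf] E; first by rewrite (Prop_irrelevance E erefl).
subst L; have [sJ _] := asc_Ev Hf; exfalso; case: H => s [[nJ EL]|[Js EL]].
  by case: nJ; apply: sJ; rewrite EL; left.
by have := sub _ Js; rewrite EL => -[_ n]; case: n.
Qed.

Lemma reduced_Ev (I J : finitary S) (e : expr I J) p : core S I J p ->
  reduced S (subsets e) -> expressed S (subsets e) = p ->
  Ev (dexpr e) (delta 1) = delta (minel S p).
Proof.
move=> Hc; have [l E] : exists l : seq (set W), subsets e = (I : set W) :: l by eexists.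
have [ch El] := walk_chain E; rewrite E => Hr Hp.
have fI := finitary_fin I; have fJ := finitary_fin J.
have [H1 H2] := reducedP fI ch; have Hm := proj1 H1 Hr.
have [Ex h1 h2] := H2 Hm; rewrite Hp El in Ex h2.
have [c Ep] : iscore I J (minel S p) /\ p = dcoset I (minel S p) J by apply/coreP.
have : longest S I * gprod I l = longest S I * minel S p.
  by rewrite -(maxel_core c) -Ep Ex maxel_full.
move=> /(congr1 (fun x => longest S I * x)); rewrite !longestKl // => <-.
have Hpath : is_path l (dexpr e) by exists e.
by rewrite (Ev_path_delta Hpath) ?mulg1 //; apply/gminv1.
Qed.

(* Comparing lengths shows that the outer parts of the sandwich are trivial. *)
Lemma reduced_core_NF (I J : finitary S) (e : expr I J) p : core S I J p ->
  reduced S (subsets e) -> expressed S (subsets e) = p ->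
  dexpr e = Fun (NF J I (minel S p)).
Proof.
move=> Hc Hr Hp; have Hev := reduced_Ev Hc Hr Hp.
have fI := finitary_fin I; have fJ := finitary_fin J.
have [c Ep] : iscore I J (minel S p) /\ p = dcoset I (minel S p) J by apply/coreP.
set m := minel S p in c Ep Hev *.
have [A [B [g [h [k [Hg Hh Hk E]]]]]] := sandwich_path e.
have [x Ex Hx] := atp_Fun Hh.
have [sB Ek] := asc_Ev Hk.
rewrite E !Ev_comp Ek -Ex in Hev.
case: Hx => [x0|[w Hw]].
  case: (@delta_neq0 m); rewrite -Hev x0 (lfunctor0 Fun_linear).
  have -> : Ev (0 : lhom SDC B A)%R (delta (longest S B * longest S J)) = fun=> 0%R.
    by apply/funext => v; rewrite Ev0.
  by rewrite Ev_zero.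
case: (ared_Ev (longest S B * longest S J) Hw) => [H0|[H1 El]].
  by case: (@delta_neq0 m); rewrite -Hev H0 Ev_zero.
rewrite H1 in Hev.
case: (desc_Ev (w * (longest S B * longest S J)) Hg) => H2; last first.
  by case: (@delta_neq0 m); rewrite -Hev H2.
rewrite H2 in Hev; have {Hev}Em := delta_inj Hev.
have fB := finitary_fin B; have fA := finitary_fin A.
have cw := ared_core Hw.
have [_ Hm'] := iscoreV (proj1 fI) (proj1 fJ) c.
have [_ Hw'] := iscoreV (proj1 fA) (proj1 fB) cw.
have L1 := rminP Hm' (longest_gen fJ).
have L2 := rminP Hw' (longest_gen fB).
(* Lengths give len w_B = len (w_B w_J) + len w_J, while w_J exceeds w_B in length by the same len
   (w_B w_J); so w_B w_J = 1. *)
have E3 : m * longest S J = w * longest S B.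
  by rewrite -Em -!mulgA longestK // mulg1.
rewrite E3 L2 -Em El in L1.
have Eg := longest_mul fJ (gen_mono sB (longest_gen fB)).
have /len_eq0 E1 : len (longest S B * longest S J) = 0%N by llia.
have EBJ : B = J.
  apply/finitary_eq/(longest_inj fB fJ).
  by rewrite -[longest S J](longestKl fB) E1 mulg1.
subst B; have Ewm : w = m by rewrite -Em E1 mulg1.
have EAI : A = I.
  by apply: finitary_eq; case: c => -> _; case: cw => -> _; rewrite Ewm.
subst A; rewrite E (asc_triv Hk erefl) /= compm1.
have [_ /(_ erefl) ->] := desc_triv Hg; rewrite /= comp1m -Ex -Ewm.
by rewrite (NF_ared Hw).
Qed.

Lemma ared_path (K I : finitary S) (f : lhom AC K I) w : ared f w ->
  exists l : seq (set W), [/\ is_path l (Fun f), gmin I l & gprod I l = w].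
Proof.
elim=> {I f w} [|I J a s f w ad EJ Ea _ [l [Hl Hm Eg]] Hw].
  exists [::]; split=> //; have [_ -> _] := Fun_linear; exact: is_path_nil.
exists ([:: s |` I; J : set W] ++ l).
have JM := @add_JM I s; rewrite -EJ in JM.
have IM := @add_IM I s.
rewrite Fun_comp_datom; split; first exact: is_path_cat (phiE ad Ea) Hl.
  rewrite /= (setUidr IM) (setUidl JM) (gst_down (add_fM ad) JM) mul1g Eg.
  by split.
by rewrite /= (gst_up IM) (gst_down (add_fM ad) JM) mul1g Eg.
Qed.

Lemma dcosE (I J : finitary S) p : core S I J p ->
  dcos I J p = Fun (NF J I (minel S p)).
Proof.
move=> Hc; set Q := [set f : lhom SDC J I | exists e : expr I J,
  [/\ reduced S (subsets e), expressed S (subsets e) = p & f = dexpr e]].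
have fI := finitary_fin I; have fJ := finitary_fin J.
(* [ared_ex] and [ared_path] provide a reduced expression, so [dcos] is not its default 0; whichever
   expression it picks is covered by [reduced_core_NF]. *)
have [e [Hr Hp E]] : Q (dcos I J p); last by rewrite E; exact: reduced_core_NF.
apply: xgetPex.
have [c Ep] : iscore I J (minel S p) /\ p = dcoset I (minel S p) J by apply/coreP.
have [f Hf] := ared_ex c; have [l [Hl Hm Eg]] := ared_path Hf.
have [ch El] := is_path_chain Hl; have [H1 H2] := reducedP fI ch.
have [e Ee _] := Hl; exists (dexpr e), e; rewrite Ee; split=> //; first exact/H1.
have [-> _ _] := H2 Hm; rewrite El Eg [RHS]Ep; apply: dcoset_eq.
rewrite -[_ * _]mulg1; apply: dcoset_mul; [exact: longest_gen|exact: gen1].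
Qed.

Lemma phi_dcos (I J : finitary S) (a : atom_gen J I) : phi a = dcos I J (sval a).
Proof.
have [s [ad EJ Ea]] := atomP (svalP a).
have Hc : core S I J (sval a) by case: (svalP a).
rewrite (dcosE Hc) Ea latom_minel // -[amin I s]mulg1.
rewrite (NF_ared (ared_cons ad EJ Ea (ared_id J) (@lmin1 _))).
by rewrite compm1 Fun_datom.
Qed.

Lemma SDcore_cst (I J : finitary S) p (c : int) : core S I J p ->
  SDcore S J I (dcos I J p *~ c)%R.
Proof.
by move=> Hp; exists 1%N, (fun=> c), (fun=> p); split=> //; rewrite big_ord1.
Qed.

Lemma SDcoreD (I J : finitary S) (f g : lhom SDC J I) :
  SDcore S J I f -> SDcore S J I g -> SDcore S J I (f + g)%R.
Proof.
move=> [n [c [p [Hp ->]]]] [n' [c' [p' [Hp' ->]]]].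
exists (n + n')%N, (fun i => match fintype.split i with inl j => c j | inr j => c' j end),
  (fun i => match fintype.split i with inl j => p j | inr j => p' j end); split.
  by move=> i; case: fintype.splitP.
rewrite big_split_ord /=; congr (_ + _)%R; apply: eq_bigr => i _.
  by rewrite (unsplitK (inl i)).
by rewrite (unsplitK (inr i)).
Qed.

Lemma Fun_range (J I : finitary S) : range (@Fun J I) = SDcore S J I.
Proof.
apply/seteqP; split=> [_ [x _ <-]|_ [n [c [p [Hp ->]]]]].
  elim: (aspan_all x) => {x} [f w Hf||f g _ h1 _ h2|f _ [n [c [p [Hp E]]]]].
  - have Hc := ared_core Hf; have fI := finitary_fin I.
    have Hw : core S I J (dcoset I w J) by exact: iscore_coset fI _ Hc.
    have := SDcore_cst 1 Hw; rewrite mulr1z (dcosE Hw) (minel_core fI Hc).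
    by rewrite (NF_ared Hf).
  - rewrite (lfunctor0 Fun_linear); exists 0%N, (fun=> 0%R), (fun=> set0).
    by split; [case|rewrite big_ord0].
  - by have [-> _ _] := Fun_linear; exact: SDcoreD.
  - rewrite (lfunctorN Fun_linear) E; exists n, (fun i => (- c i)%R), p; split=> //.
    by rewrite -GRing.sumrN; apply: eq_bigr => i _; rewrite mulrNz.
exists (\sum_(i < n) NF J I (minel S (p i)) *~ c i)%R => //.
rewrite (lfunctor_sum Fun_linear); apply: eq_bigr => i _.
by rewrite (lfunctorZ Fun_linear) (dcosE (Hp i)).
Qed.

End CoxeterTheory.

Theorem theorem6p13 (W : groupType) (S : set W) (HS : coxeter_system S) :
  (* the atoms are exactly the ^I_s a, each for a unique (I, s) *)
  (forall (I : finitary S) (s : W), addable S I s ->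
     exists2 J : finitary S,
       J = atom_end S I s :> set W & atom I J (latom S I s)) /\
  (forall (I J : finitary S) (p : set W), atom I J p ->
     exists! s : W, [/\ addable S I s,
       J = atom_end S I s :> set W & p = latom S I s]) /\
  (* the atoms are exactly the a^J_t, each for a unique (J, t) *)
  (forall (J : finitary S) (t : W), addable S J t ->
     exists2 I : finitary S,
       I = atom_end S J t :> set W & atom I J (ratom S J t)) /\
  (forall (I J : finitary S) (p : set W), atom I J p ->
     exists! t : W, [/\ addable S J t,
       I = atom_end S J t :> set W & p = ratom S J t]) /\
  (* the presented category is isomorphic to SDcore, compatibly with generators *)
  exists F : forall J I : finitary S, lhom (atomic_cat S) J I -> lhom (SD S) J I,
    [/\ linear_functor F,
        forall (I J : finitary S) (a : atom_gen J I),
          F J I (datom a) = dcos I J (sval a),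
        forall J I : finitary S, injective (F J I)
      & forall J I : finitary S, range (F J I) = SDcore S J I].
Proof.
split; first by move=> I s ad; exists (Finitary (add_fJ ad)) => //; exact: latom_atom.
split; first by move=> I J p; exact: atom_uniq.
split; first by move=> J t ad; exists (Finitary (add_fJ ad)) => //; exact: ratom_atom.
split; first by move=> I J p; exact: ratom_uniq.
exists (Fun (S := S)); split.
- exact: Fun_linear.
- by move=> I J a; rewrite Fun_datom // phi_dcos.
- by move=> J I; exact: Fun_inj.
- by move=> J I; exact: Fun_range.
Qed.
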